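(* Let $k\ge 3$ and let $p\in S(k)$ be a point of the $k$-th monster space over a surface $S$. Then: (1) For each $h\ge 2$, $\mathrm{SG}_h\le 2+\#\{\,i : 2\le i\le\min\{h,k+1\},\ e_{hi}=0\,\}$. (2) For $2\le i\le k+1$ we have $\beta_{i+1}\ge b_i$.
   Context: Setting. $S$ is a surface: a smooth 2-manifold, or a complex manifold of dimension 2, or a nonsingular algebraic surface over an algebraically closed field of characteristic 0; all functions, vector fields, curves are taken in the chosen category. Monster tower. $S(0)=S$, $\Delta(0)=TS$. Recursively $S(j)=\mathbb P(\Delta(j-1))$ (a point is a point of $S(j-1)$ together with a line in the fiber of $\Delta(j-1)$ there), and $\Delta(j)$ is the rank 2 distribution on $S(j)$ of tangent vectors whose projection to $S(j-1)$ lies in the line represented by the point. $\dim S(k)=k+2$. Write $\Delta=\Delta(k)$, the focal distribution (also its sheaf of sections); curves tangent to it are focal curves. Small growth. $\Delta^1=\Delta$, and $\Delta^h=[\Delta,\Delta^{h-1}]$ is the subsheaf of the sheaf of vector fields generated by brackets of sections of $\Delta$ with sections of $\Delta^{h-1}$ and by the sections of $\Delta^{h-1}$. $\mathrm{SG}_h$ is the rank of $\Delta^h$ at $p$ (the dimension of the span in $T_pS(k)$ of the values at $p$ of its sections). The beta vector is $(\beta_2,\dots,\beta_{k+2})$ with $\beta_i=\min\{h:\mathrm{SG}_h=i\}$. Focal order. For a function $a$ near $p$ and a parameterized nonsingular focal curve germ $C$ through $p$, given by $\gamma$ with $\gamma(0)=p$, let $\#(a\cdot C)$ be the order of vanishing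 of $a\circ\gamma$ at $0$. The focal order of $a$ at $p$ is $o(a)=\min_C\#(a\cdot C)$ over all focal curve germs $C$ through $p$. Vertical orders. For $2\le j\le k$, the divisor at infinity $I_j\subset S(k)$ is the set of points whose image in $S(j)$ represents the line in $\Delta(j-1)$ tangent to the fiber of $S(j-1)\to S(j-2)$. $\mathrm{VO}_j$ is the focal order at $p$ of a local defining function of $I_j$ ($0$ if $p\notin I_j$). The numbers $e_{hi}$ and $b_i$. For $h\ge2$ and $2\le i\le\min\{h,k+1\}$, $$e_{hi}=\max\Big\{0,\;-(h-i)+\sum_{j=k-i+4}^{k}(i+j-k-3)\,\mathrm{VO}_j\Big\}.$$ For $2\le i\le k+1$, $b_i$ is the smallest integer with $e_{b_i,i}=0$; equivalently $b_i=i+\sum_{j=k-i+4}^{k}(i+j-k-3)\,\mathrm{VO}_j$. *)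

(* Defs.v *)
From HB Require Import structures.
From mathcomp Require Import all_boot all_order all_algebra.
From mathcomp Require Import complex.
From mathcomp Require mpoly.
From mathcomp Require Import boolp classical_sets functions reals topology normedtype.
From mathcomp Require Import derive.
From mathcomp Require Import zify.

Set Implicit Arguments.
Unset Strict Implicit.
Unset Printing Implicit Defensive.

Import Order.TTheory GRing.Theory Num.Theory.
Import numFieldNormedType.Exports.

Local Open Scope ring_scope.
Local Open Scope classical_set_scope.

(* What a category of manifolds says about the affine spaces K^m:
   - [gnb x] is the set of neighbourhoods of x in K^m;
   - [greg F x]: F is a function of the category on some neighbourhood of x;
   - [gpd F x i] is the i-th partial derivative of F at x;
   - [gmodel n W]: W, a subset of K^m, is one of the n-dimensional pieces from
     which the n-dimensional nonsingular spaces of the category are glued. *)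
Record geometry := Geometry {
  gK : fieldType ;
  gnb : forall m, 'rV[gK]_m -> set (set 'rV[gK]_m) ;
  greg : forall m, ('rV[gK]_m -> gK) -> 'rV[gK]_m -> Prop ;
  gpd : forall m, ('rV[gK]_m -> gK) -> 'rV[gK]_m -> 'I_m -> gK ;
  gmodel : forall n m : nat, set 'rV[gK]_m -> Prop
}.

Section SmoothGeometry.
Variable K : numFieldType.

Definition partial m (F : 'rV[K]_m -> K) (x : 'rV[K]_m) (i : 'I_m) : K :=
  'D_(delta_mx 0 i) F x.

Fixpoint differentiable_upto (l m : nat) (F : 'rV[K]_m -> K)
    (U : set 'rV[K]_m) : Prop :=
  (forall x, U x -> differentiable F x) /\
  (if l is l'.+1 then
     forall i, differentiable_upto l' (fun x => partial F x i) U
   else True).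

Definition smooth_at m (F : 'rV[K]_m -> K) (x : 'rV[K]_m) : Prop :=
  exists U : set 'rV[K]_m,
    [/\ open U, U x & forall l, differentiable_upto l F U].

(* For K = R these are C^oo manifolds given by charts.  For K = C,
   [differentiable] is complex Frechet differentiability; a complex
   differentiable function on an open set being infinitely differentiable, the
   functions are the holomorphic ones, and these are complex manifolds. *)
Definition smooth_geometry : geometry := @Geometry K
  (fun m x => nbhs x) smooth_at partial
  (fun n m W => m = n /\ open W).

End SmoothGeometry.

Section AlgebraicGeometry.
Variable K : fieldType.

Definition peval m (P : mpoly.mpoly m K) (x : 'rV[K]_m) : K :=
  mpoly.meval (fun i => x 0 i) P.

Definition zariski_nb m (x : 'rV[K]_m) (N : set 'rV[K]_m) : Prop :=
  exists H : mpoly.mpoly m K,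
    peval H x != 0 /\ (forall y, peval H y != 0 -> N y).

Definition is_quotient_at m (F : 'rV[K]_m -> K) (x : 'rV[K]_m)
    (P Q : mpoly.mpoly m K) : Prop :=
  peval Q x != 0 /\ zariski_nb x [set y | F y = peval P y / peval Q y].

Definition rational_at m (F : 'rV[K]_m -> K) (x : 'rV[K]_m) : Prop :=
  exists P Q, is_quotient_at F x P Q.

(* Quotient rule; over an infinite field the value does not depend on P, Q. *)
Definition rational_pd m (F : 'rV[K]_m -> K) (x : 'rV[K]_m) (i : 'I_m) : K :=
  xget 0 [set c | exists P Q, is_quotient_at F x P Q /\
    c = (peval (mpoly.mderiv i P) x * peval Q x
         - peval P x * peval (mpoly.mderiv i Q) x) / peval Q x ^+ 2].

(* Jacobian criterion: near each of its points a nonsingular n-dimensional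
   variety in K^m is the zero locus of r = m - n polynomials with independent
   differentials. *)
Definition jacobian_model (n m : nat) (W : set 'rV[K]_m) : Prop :=
  exists (r : nat) (f : 'I_r -> mpoly.mpoly m K) (O : set 'rV[K]_m),
    [/\ m = (n + r)%N,
        forall x, O x -> zariski_nb x O,
        W = [set x | O x /\ forall l, peval (f l) x = 0] &
        forall x, W x ->
          \rank (\matrix_(l < r, i < m) peval (mpoly.mderiv i (f l)) x) = r].

Definition algebraic_geometry : geometry := @Geometry K
  zariski_nb rational_at rational_pd jacobian_model.

End AlgebraicGeometry.

Inductive category : Type :=
| Smooth of realType
| Holomorphic of realType
| Algebraic (K : closedFieldType) of [pchar K] =i pred0.

Definition geom (C : category) : geometry :=
  match C with
  | Smooth R => smooth_geometry R
  | Holomorphic R => smooth_geometry (complex R)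
  | Algebraic K _ => algebraic_geometry K
  end.

Section Spaces.
Variable G : geometry.
Local Notation K := (gK G).

(* A space with a sheaf of K-valued functions.  Only germs matter: [nb p] is
   the set of neighbourhoods of p, and [reg f p] says that f is a function of
   the category on some neighbourhood of p; the values of f away from p are
   irrelevant. *)
Record gspace := Space {
  pt :> Type ;
  nb : pt -> set (set pt) ;
  reg : (pt -> K) -> pt -> Prop
}.

Definition tuple_map (X : Type) n (g : 'I_n -> X -> K) (q : X) : 'rV[K]_n :=
  \row_i g i q.

(* [e] identifies the open neighbourhood [U] of p, as a space with functions,
   with the model [W] in K^m. *)
Definition manifold_chart (X : gspace) (n : nat) (U : set X) m
    (e : X -> 'rV[K]_m) (W : set 'rV[K]_m) : Prop :=
  [/\ gmodel (g := G) n W,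
      forall q, U q -> nb q U,
      set_inj U e /\ e @` U = W,
      forall q, U q -> forall N, nb q N <->
        exists O, gnb (e q) O /\ forall y, U y -> O (e y) -> N y &
      forall q, U q -> forall f, reg f q <->
        exists F, greg F (e q) /\ nb q [set y | f y = F (e y)]].

Definition is_manifold (n : nat) (X : gspace) : Prop :=
  forall p : X, exists (U : set X) (m : nat) (e : X -> 'rV[K]_m)
    (W : set 'rV[K]_m), U p /\ manifold_chart n U e W.

Section Tangent.
Variable X : gspace.

(* Tangent vectors at p are represented by functionals on all functions,
   extended by 0 to the functions that are not regular at p, so that a tangent
   vector is determined by its values on germs of regular functions. *)
Definition tvec := (X -> K) -> K.

(* Derivations of the ring of germs at p, in the form of the chain rule.
   Taking for F a sum, a product or a constant gives K-linearity and the
   Leibniz rule, and F = 'X_0 shows that v only depends on germs; conversely a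
   linear map satisfying the Leibniz rule satisfies the chain rule by
   Hadamard's lemma (or by the quotient rule, if F is rational). *)
Definition tangent (p : X) : set tvec := [set v : tvec |
  (forall f, ~ reg f p -> v f = 0) /\
  (forall n (g : 'I_n -> X -> K) (F : 'rV[K]_n -> K) (f : X -> K),
     (forall i, reg (g i) p) -> greg F (tuple_map g p) ->
     nb p [set q | f q = F (tuple_map g q)] ->
     v f = \sum_i gpd F (tuple_map g p) i * v (g i))].

Definition vfield := X -> tvec.

Definition bracket (V W : vfield) : vfield := fun q f =>
  if `[< reg f q >] then V q (fun r => W r f) - W q (fun r => V r f) else 0.

Definition distribution := X -> set tvec.

(* [V] is (the germ at p of) a section of the sheaf of vector fields in [D]. *)
Definition section_of (D : distribution) (p : X) (V : vfield) : Prop :=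
  nb p [set q | D q (V q) /\ forall f, reg f q -> reg (fun r => V r f) q].

(* [small_growth_stalk D h p] is the stalk at p of the sheaf D^(h+1), where
   D^1 = D and D^(h+1) is the sheaf of modules generated by [D, D^h] and D^h. *)
Fixpoint small_growth_stalk (D : distribution) (h : nat) (p : X)
    (V : vfield) : Prop :=
  if h is h'.+1 then
    exists (n : nat) (c : 'I_n -> X -> K) (A B : 'I_n -> vfield) (V' : vfield),
      [/\ forall i, reg (c i) p,
          forall i, section_of D p (A i),
          forall i, small_growth_stalk D h' p (B i),
          small_growth_stalk D h' p V' &
          nb p [set q | forall f,
            V q f = V' q f + \sum_i c i q * bracket (A i) (B i) q f]]
  else section_of D p V.

Definition span_dim (E : set tvec) (r : nat) : Prop :=
  exists u : 'I_r -> tvec,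
    [/\ forall i, E (u i),
        forall c : 'I_r -> K,
          (forall f, \sum_i c i * u i f = 0) -> forall i, c i = 0 &
        forall v, E v ->
          exists c : 'I_r -> K, forall f, v f = \sum_i c i * u i f].

(* [a] generates the ideal of germs at p of functions vanishing on [I], and
   defines [I] near p. *)
Definition local_equation (I : set X) (p : X) (a : X -> K) : Prop :=
  [/\ reg a p,
      nb p [set q | a q = 0 <-> I q] &
      forall f, reg f p -> nb p [set q | I q -> f q = 0] ->
        exists c, reg c p /\ nb p [set q | f q = c q * a q]].

Definition local_parameter (o : X) (s : X -> K) : Prop :=
  [/\ reg s o, s o = 0 & exists2 v, tangent o v & v s != 0].

(* The order of vanishing at the point o of a curve X. *)
Definition vanishes_to_order_ge (f : X -> K) (o : X) (n : nat) : Prop :=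
  exists s u, [/\ local_parameter o s, reg u o &
    nb o [set q | f q = s q ^+ n * u q]].

Definition vanishes_to_order (f : X -> K) (o : X) (n : nat) : Prop :=
  exists s u, [/\ local_parameter o s, reg u o, u o != 0 &
    nb o [set q | f q = s q ^+ n * u q]].

End Tangent.

Definition pushforward (X Y : gspace) (phi : X -> Y) (p : X) (v : tvec X) :
    tvec Y :=
  fun g => if `[< reg g (phi p) >] then v (g \o phi) else 0.

(* A curve germ is parameterized by the germ at o of a nonsingular curve T of
   the category.  In the classical categories T may be taken to be the affine
   line, but a germ of algebraic curve need not be parameterized by the affine
   line. *)
Definition focal_curve (X : gspace) (D : distribution X) (p : X)
    (T : gspace) (o : T) (gamma : T -> X) : Prop :=
  [/\ is_manifold 1 T,
      gamma o = p,
      nb o [set s | (forall N, nb (gamma s) N -> nb s (gamma @^-1` N)) /\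
                    (forall f, reg f (gamma s) -> reg (f \o gamma) s)],
      exists2 v, tangent o v & pushforward gamma o v <> (fun=> 0) &
      nb o [set s | forall v, tangent s v ->
                      D (gamma s) (pushforward gamma s v)]].

(* [n] is the minimum, over the focal curve germs through p, of the order of
   vanishing of [a] along the curve (which may be infinite for some curves). *)
Definition focal_order (X : gspace) (D : distribution X) (a : X -> K) (p : X)
    (n : nat) : Prop :=
  (forall (T : gspace) (o : T) (gamma : T -> X), focal_curve D p o gamma ->
     vanishes_to_order_ge (a \o gamma) o n) /\
  (exists (T : gspace) (o : T) (gamma : T -> X), focal_curve D p o gamma /\
     vanishes_to_order (a \o gamma) o n).

Section Projectivization.
Variables (X : gspace) (D : distribution X).

Definition is_line (p : X) (L : set (tvec X)) : Prop :=
  exists v, [/\ D p v, v <> (fun=> 0) &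
    L = [set w | exists c : K, w = fun f => c * v f]].

Record proj_pt := ProjPt {
  base : X ;
  line : set (tvec X) ;
  _ : is_line base line
}.

(* The value at (q, L) of the fiber coordinate db/da. *)
Definition dquot (b a : X -> K) (z : proj_pt) : K :=
  xget 0 [set c | exists v, [/\ line z v, v a != 0 & c = v b / v a]].

Definition proj_generator (z : proj_pt) (h : proj_pt -> K) : Prop :=
  (exists2 g, reg g (base z) & h = g \o @base) \/
  (exists a b, [/\ reg a (base z), reg b (base z),
                   exists2 v, line z v & v a != 0 & h = dquot b a]).

Definition proj_nb (z : proj_pt) : set (set proj_pt) := [set N |
  exists n (h : 'I_n -> proj_pt -> K) (O : set 'rV[K]_n),
    [/\ forall i, proj_generator z (h i), gnb (tuple_map h z) O &
        forall y, O (tuple_map h y) -> N y]].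

Definition proj_reg (f : proj_pt -> K) (z : proj_pt) : Prop :=
  exists n (h : 'I_n -> proj_pt -> K) (F : 'rV[K]_n -> K),
    [/\ forall i, proj_generator z (h i), greg F (tuple_map h z) &
        proj_nb z [set y | f y = F (tuple_map h y)]].

(* P(D), with the structure induced from the projectivized tangent bundle of X:
   its topology and its functions are locally generated by the functions on X
   and by the affine fiber coordinates db/da on the open sets where da does not
   vanish on the line. *)
Definition proj_space : gspace := Space proj_nb proj_reg.

Definition proj_distribution : distribution proj_space :=
  fun z => [set v | tangent (X := proj_space) z v /\
    line z (pushforward (X := proj_space) (Y := X) base z v)].

End Projectivization.

Record dspace := DSpace { dsp :> gspace ; focal : distribution dsp }.

Fixpoint monster (S : gspace) (k : nat) : dspace :=
  if k is k'.+1 then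
    DSpace (proj_distribution (D := focal (d := monster S k')))
  else DSpace (@tangent S).

(* The line represented by z, a point of S(k+1), is tangent to the fiber of
   S(k) -> S(k-1). *)
Definition vertical (S : gspace) (k : nat) : monster S k.+1 -> Prop :=
  match k with
  | 0 => fun _ => False
  | k'.+1 => fun z => forall v, line z v ->
      pushforward (X := monster S k'.+1) (Y := monster S k') (@base _ _)
        (base z) v = (fun=> 0)
  end.

(* [infinity S k j] is the divisor at infinity I_j in S(k), for 2 <= j <= k. *)
Fixpoint infinity (S : gspace) (k : nat) (j : nat) : set (monster S k) :=
  match k return set (monster S k) with
  | 0 => set0
  | k'.+1 => if j == k'.+1 then @vertical S k'
             else [set z | infinity (S := S) (k := k') j (base z)]
  end.

Definition vertical_order (S : gspace) (k : nat) (p : monster S k) (j n : nat) :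
    Prop :=
  (infinity j p /\
   exists2 a, local_equation (infinity (k := k) j) p a &
              focal_order (focal (d := monster S k)) a p n) \/
  (~ infinity j p /\ n = 0%N).

(* SG_h, for h >= 1; the default value 0 is never used, the tangent spaces
   being finite-dimensional. *)
Definition SG (S : gspace) (k : nat) (p : monster S k) (h : nat) : nat :=
  xget 0%N [set r | span_dim
    [set v | exists2 V,
       small_growth_stalk (focal (d := monster S k)) h.-1 p V & v = V p] r].

Definition is_beta (S : gspace) (k : nat) (p : monster S k) (i beta : nat) :
    Prop :=
  [/\ (1 <= beta)%N, SG p beta = i &
      forall h, (1 <= h)%N -> SG p h = i -> (beta <= h)%N].

End Spaces.

Definition vo_sum (k : nat) (VO : nat -> nat) (i : nat) : nat :=
  (\sum_(k + 4 - i <= j < k.+1) (i + j - (k + 3)) * VO j)%N.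

(* For i <= h the truncated subtraction is max {0, -(h-i) + ...}; the other
   subtractions are never truncated for 2 <= i <= k+1. *)
Definition e_num (k : nat) (VO : nat -> nat) (h i : nat) : nat :=
  (vo_sum k VO i - (h - i))%N.

Definition b_num (k : nat) (VO : nat -> nat) (i : nat) : nat :=
  (i + vo_sum k VO i)%N.

Lemma b_num_least (k : nat) (VO : nat -> nat) (i : nat) :
  [/\ (i <= b_num k VO i)%N, e_num k VO (b_num k VO i) i = 0%N &
      forall h, (i <= h)%N -> e_num k VO h i = 0%N -> (b_num k VO i <= h)%N].
Proof. by rewrite /e_num /b_num; split; move=> *; lia. Qed.

(* Main.v *)
(* Near p the focal distribution is cut out by contact forms
   om_i = d(d_i) - n_{i+1} d r_{i+1} (i < k), where {r_i, n_i} are the successive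
   affine coordinates and d_i is n_i or r_i.  For a section A of Delta and a
   vector field B,
     om_i [A, B] = A (om_i B) +- (A r_{i+2}) om_{i+1} B,
   so a bracket lowers the nonholonomic order of om_i by one, unless the last
   term does worse.  A r_i has nonholonomic order at least the sum of VO_l over
   l > i.  By induction om_i vanishes on Delta^h to nonholonomic order at least
   b_{k-i+1} - h, so the span of Delta^h at p is annihilated by the om_i with
   b_{k-i+1} > h, which are independent.

   The bound on A r_i comes from a particular focal curve through p, along which
   r_k - r_k(p) and n_k - n_k(p) are equal to the parameter.  VO_l is at most the
   order of n_l on it, because n_l vanishes on the divisor at infinity I_l if
   p lies on I_l; and the nonholonomic orders of the n_l and A r_i at p are at
   least their orders on this curve.  The coordinates of
   this curve are polynomials in a parameter, so it exists as soon as S has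
   curves with prescribed polynomial coordinates.  These are affine lines in the
   smooth and holomorphic categories; in the algebraic category they are the
   curves x = P(t), y = Q(t), whose tangent lines are found by the
   Nullstellensatz. *)
Require Import Defs.
From HB Require Import structures.
From mathcomp Require Import all_boot all_order all_algebra.
From mathcomp Require Import ring zify lra complex.
From mathcomp Require mpoly.
From mathcomp Require Import boolp classical_sets functions.

Set Implicit Arguments.
Unset Strict Implicit.
Unset Printing Implicit Defensive.

Import Order.TTheory GRing.Theory Num.Theory.

Local Open Scope ring_scope.
Local Open Scope classical_set_scope.

(** * Laws of the three categories and of their spaces *)

(** Two opposite bounds have to meet. VO_l is a minimum over focal curves, so a single curve bounds
    it from above, whereas the order of A r_i has to be bounded from below for every section A. Both
    obey the same relation: d_i' = n_{i+1} r_{i+1}' on a curve and A d_i = n_{i+1} (A r_{i+1}) for a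
    section. A curve prescribed at the bottom and differentiated upwards would give no control of
    these orders. Prescribed at level k and integrated downwards, it starts with the least possible
    orders, and in characteristic 0 each integration raises an order by exactly one. Its orders are
    therefore exact, and the same recursion bounds the nonholonomic orders. The base curve is then
    lifted back; away from t = 0 the lift is forced, since R_i' has no other zero nearby.

    In the algebraic category a chart has no rational inverse, so the curve is taken to be the etale
    cover F(z) = w(t) of the line. Lifting d/dt to its functions requires that a function vanishing
    on it has derivative 0, that is, that equations with independent differentials generate a
    radical ideal locally. This is where the Nullstellensatz enters. *)

Record geometry_laws (G : geometry) : Prop := GeometryLaws {
  gchar0 : forall n, n.+1%:R != 0 :> gK G ;
  gnbT : forall m (x : 'rV[gK G]_m), gnb x setT ;
  gnbI : forall m (x : 'rV[gK G]_m) A B, gnb x A -> gnb x B -> gnb x (A `&` B) ;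
  gnbS : forall m (x : 'rV[gK G]_m) A B, A `<=` B -> gnb x A -> gnb x B ;
  gnb_in : forall m (x : 'rV[gK G]_m) A, gnb x A -> A x ;
  gnb_open : forall m (x : 'rV[gK G]_m) A,
    gnb x A -> gnb x [set y | gnb y A] ;
  gnb_neq0 : forall m (x : 'rV[gK G]_m) i,
    x 0 i != 0 -> gnb x [set y | y 0 i != 0] ;
  greg_near : forall m (F : 'rV[gK G]_m -> gK G) x,
    greg F x -> gnb x [set y | greg F y] ;
  greg_eq : forall m (F F' : 'rV[gK G]_m -> gK G) x,
    greg F x -> gnb x [set y | F' y = F y] -> greg F' x ;
  greg_cts : forall m n (g : 'I_n -> 'rV[gK G]_m -> gK G) x O,
    (forall i, greg (g i) x) -> gnb (tuple_map g x) O ->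
    gnb x [set y | O (tuple_map g y)] ;
  greg_comp : forall m n (g : 'I_n -> 'rV[gK G]_m -> gK G) F x,
    (forall i, greg (g i) x) -> greg F (tuple_map g x) ->
    greg (fun y => F (tuple_map g y)) x ;
  greg_cst : forall m (c : gK G) (x : 'rV[gK G]_m), greg (fun=> c) x ;
  greg_coord : forall m (x : 'rV[gK G]_m) i, greg (fun y => y 0 i) x ;
  greg_add : forall m (F F' : 'rV[gK G]_m -> gK G) x,
    greg F x -> greg F' x -> greg (fun y => F y + F' y) x ;
  greg_mul : forall m (F F' : 'rV[gK G]_m -> gK G) x,
    greg F x -> greg F' x -> greg (fun y => F y * F' y) x ;
  greg_inv : forall m (F : 'rV[gK G]_m -> gK G) x,
    greg F x -> F x != 0 -> greg (fun y => (F y)^-1) x ;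
  gpd_reg : forall m (F : 'rV[gK G]_m -> gK G) x i,
    greg F x -> greg (fun y => gpd F y i) x ;
  gpd_cst : forall m (c : gK G) (x : 'rV[gK G]_m) i, gpd (fun=> c) x i = 0 ;
  gpd_coord : forall m (x : 'rV[gK G]_m) j i,
    gpd (fun y => y 0 j) x i = (j == i)%:R ;
  gpd_add : forall m (F F' : 'rV[gK G]_m -> gK G) x i,
    greg F x -> greg F' x ->
    gpd (fun y => F y + F' y) x i = gpd F x i + gpd F' x i ;
  gpd_mul : forall m (F F' : 'rV[gK G]_m -> gK G) x i,
    greg F x -> greg F' x ->
    gpd (fun y => F y * F' y) x i = gpd F x i * F' x + F x * gpd F' x i ;
  gpd_eq : forall m (F F' : 'rV[gK G]_m -> gK G) x i,
    greg F x -> gnb x [set y | F' y = F y] -> gpd F' x i = gpd F x i ;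
  gpd_comp : forall m n (g : 'I_n -> 'rV[gK G]_m -> gK G) F x i,
    (forall i, greg (g i) x) -> greg F (tuple_map g x) ->
    gpd (fun y => F (tuple_map g y)) x i =
      \sum_l gpd F (tuple_map g x) l * gpd (g l) x i ;
  gpd_sym : forall m (F : 'rV[gK G]_m -> gK G) x i j, greg F x ->
    gpd (fun y => gpd F y i) x j = gpd (fun y => gpd F y j) x i
}.

(** These laws hold on manifolds and pass from X to P(D), so the tower is handled without charts on
    the S(k). Derivatives enter only through functions of the category composed with regular
    ones. *)
Record space_laws (G : geometry) (X : gspace G) : Prop := SpaceLaws {
  nbT : forall x : X, nb x setT ;
  nbI : forall (x : X) A B, nb x A -> nb x B -> nb x (A `&` B) ;
  nbS : forall (x : X) A B, A `<=` B -> nb x A -> nb x B ;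
  nb_in : forall (x : X) A, nb x A -> A x ;
  nb_open : forall (x : X) A, nb x A -> nb x [set y | nb y A] ;
  reg_near : forall (f : X -> gK G) x, reg f x -> nb x [set y | reg f y] ;
  reg_eq : forall (f f' : X -> gK G) x,
    reg f x -> nb x [set y | f' y = f y] -> reg f' x ;
  reg_cts : forall n (g : 'I_n -> X -> gK G) x O,
    (forall i, reg (g i) x) -> gnb (tuple_map g x) O ->
    nb x [set y | O (tuple_map g y)] ;
  reg_comp : forall n (g : 'I_n -> X -> gK G) F x,
    (forall i, reg (g i) x) -> greg F (tuple_map g x) ->
    reg (fun y => F (tuple_map g y)) x
}.

Section Core.
Variables (G : geometry) (HG : geometry_laws G).
Local Notation K := (gK G).

Lemma gnb_forall m (x : 'rV[K]_m) n (P : 'I_n -> set 'rV[K]_m) :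
  (forall i, gnb x (P i)) -> gnb x [set z | forall i, P i z].
Proof.
move=> hP.
suff H (s : seq 'I_n) : gnb x [set z | forall i, i \in s -> P i z].
  by apply: (gnbS HG) (H (enum 'I_n)) => // z hz i; apply: hz; rewrite mem_enum.
elim: s => [|i s IH]; first by apply: (gnbS HG) (gnbT HG x).
apply: (gnbS HG) (gnbI HG (hP i) IH) => // z [h1 h2] j.
by rewrite inE => /orP[/eqP->|/h2].
Qed.

Section SpaceTheory.
Variables (X : gspace G) (HX : space_laws X).
Implicit Types (x : X) (f g : X -> K).

Lemma nb_forall n x (N : 'I_n -> set X) :
  (forall i, nb x (N i)) -> nb x [set y | forall i, N i y].
Proof.
move=> hN.
suff H (s : seq 'I_n) : nb x [set y | forall i, i \in s -> N i y].
  by apply: nbS (H (enum 'I_n)) => // y hy i; apply: hy; rewrite mem_enum.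
elim: s => [|a s IH]; first by apply: nbS (nbT HX x).
apply: nbS (nbI HX (hN a) IH) => // y [h1 h2] i.
by rewrite inE => /orP[/eqP->|/h2].
Qed.

Lemma nb_refl x (P : set X) : (forall y, P y) -> nb x P.
Proof. by move=> h; apply: nbS (nbT HX x). Qed.

Lemma reg_cst (c : K) x : reg (fun=> c) x.
Proof.
exact: (@reg_comp _ _ HX 0 (fun _ => fun=> 0) (fun=> c) x (fun i => ltac:(case: i => //))
  (greg_cst HG c _)).
Qed.

Definition pairf (f g : X -> K) (i : 'I_2) : X -> K :=
  if i == 0 :> nat then f else g.

Lemma pairf_reg f g x : reg f x -> reg g x -> forall i, reg (pairf f g i) x.
Proof. by move=> hf hg i; rewrite /pairf; case: eqP. Qed.

Lemma reg_add f g x : reg f x -> reg g x -> reg (fun y => f y + g y) x.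
Proof.
move=> hf hg.
have := @reg_comp _ _ HX 2 (pairf f g) (fun z => z 0 0 + z 0 1) x (pairf_reg hf hg)
  (greg_add HG (greg_coord HG _ _) (greg_coord HG _ _)).
by move/(reg_eq HX); apply; apply: nb_refl => y /=; rewrite !mxE.
Qed.

Lemma reg_mul f g x : reg f x -> reg g x -> reg (fun y => f y * g y) x.
Proof.
move=> hf hg.
have := @reg_comp _ _ HX 2 (pairf f g) (fun z => z 0 0 * z 0 1) x (pairf_reg hf hg)
  (greg_mul HG (greg_coord HG _ _) (greg_coord HG _ _)).
by move/(reg_eq HX); apply; apply: nb_refl => y /=; rewrite !mxE.
Qed.

Lemma reg_opp f x : reg f x -> reg (fun y => - f y) x.
Proof.
move=> hf; apply: (reg_eq HX) (reg_mul (reg_cst (-1) x) hf) _.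
by apply: nb_refl => y /=; rewrite mulN1r.
Qed.

Lemma reg_sub f g x : reg f x -> reg g x -> reg (fun y => f y - g y) x.
Proof. by move=> hf hg; apply: reg_add => //; apply: reg_opp. Qed.

Lemma reg_sum (I : Type) (s : seq I) (P : pred I) (F : I -> X -> K) x :
  (forall i, P i -> reg (F i) x) -> reg (fun y => \sum_(i <- s | P i) F i y) x.
Proof.
move=> h; elim: s => [|a s IH].
  by apply: (reg_eq HX) (reg_cst 0 x) _; apply: nb_refl => y /=; rewrite big_nil.
case Pa: (P a).
  apply: (reg_eq HX) (reg_add (h _ Pa) IH) _.
  by apply: nb_refl => y /=; rewrite big_cons Pa.
by apply: (reg_eq HX) IH _; apply: nb_refl => y /=; rewrite big_cons Pa.
Qed.

Lemma reg_horner (P : {poly K}) f x : reg f x -> reg (fun y => P.[f y]) x.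
Proof.
move=> hf; elim/poly_ind: P => [|P c IH].
  by apply: (reg_eq HX) (reg_cst 0 x) _; apply: nb_refl => y /=; rewrite horner0.
apply: (reg_eq HX) (reg_add (reg_mul IH hf) (reg_cst c x)) _.
by apply: nb_refl => y /=; rewrite hornerMXaddC.
Qed.

Lemma nb_neq0 f x : reg f x -> f x != 0 -> nb x [set y | f y != 0].
Proof.
move=> hf fx.
have := @reg_cts _ _ HX 1 (fun=> f) x [set z | z 0 0 != 0] (fun=> hf).
move/(_ (gnb_neq0 HG _)); rewrite /= mxE => /(_ fx).
by apply: (nbS HX) => y; rewrite /= mxE.
Qed.

(** Regularity at x depends only on the germ, so the indicator function of N is regular at x. It
    turns an arbitrary neighbourhood into one cut out by a function, the form in which the topology
    of [proj_space] is generated. *)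
Lemma reg_indic x (N : set X) : nb x N ->
  exists g : X -> K, [/\ reg g x, g x != 0 & forall y, g y != 0 -> N y].
Proof.
move=> hN; exists (fun y => if `[< N y >] then 1 else 0); split.
- apply: (reg_eq HX) (reg_cst 1 x) _; apply: nbS hN => // y /= hy.
  by rewrite asboolT.
- by rewrite asboolT ?oner_eq0 //; apply: (nb_in HX).
- by move=> y; case: asboolP => //; rewrite eqxx.
Qed.

Section Tangents.
Variables (x : X) (v : tvec X) (tv : tangent x v).

Lemma tan_nreg f : ~ reg f x -> v f = 0.
Proof. by case: tv => h _; apply: h. Qed.

Lemma tan_comp n (g : 'I_n -> X -> K) F f :
  (forall i, reg (g i) x) -> greg F (tuple_map g x) ->
  nb x [set q | f q = F (tuple_map g q)] ->
  v f = \sum_i gpd F (tuple_map g x) i * v (g i).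
Proof. by case: tv => _; apply. Qed.

Lemma tan_cst (c : K) : v (fun=> c) = 0.
Proof.
have := @tan_comp 0 (fun _ => fun=> 0) (fun=> c) (fun=> c).
move=> -> //; first by rewrite big_ord0.
- by case.
- exact: (greg_cst HG).
- exact: nb_refl.
Qed.

Lemma tan_near f g : reg g x -> nb x [set q | f q = g q] -> v f = v g.
Proof.
move=> hg hn.
rewrite (@tan_comp 1 (fun=> g) (fun z => z 0 0)) //.
- by rewrite big_ord1 (gpd_coord HG) eqxx mul1r.
- exact: (greg_coord HG).
- by apply: nbS hn => // y /= ->; rewrite mxE.
Qed.

Lemma tan_pair (F : 'rV[K]_2 -> K) f g h : reg f x -> reg g x ->
  greg F (tuple_map (pairf f g) x) ->
  (forall y, h y = F (tuple_map (pairf f g) y)) ->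
  v h = gpd F (tuple_map (pairf f g) x) 0 * v f + gpd F (tuple_map (pairf f g) x) 1 * v g.
Proof.
move=> hf hg hF hh.
rewrite (@tan_comp 2 (pairf f g) F h (pairf_reg hf hg) hF) ?big_ord_recl ?big_ord0.
  by rewrite addr0; congr (_ + gpd F _ _ * _); apply/val_inj.
exact: nb_refl.
Qed.

Lemma tan_add f g : reg f x -> reg g x -> v (fun y => f y + g y) = v f + v g.
Proof.
move=> hf hg.
rewrite (@tan_pair (fun z => z 0 0 + z 0 1) f g _ hf hg).
- rewrite !(gpd_add HG) ?(gpd_coord HG) /=; try exact: (greg_coord HG).
  by rewrite addr0 add0r !mul1r.
- by apply: (greg_add HG); apply: (greg_coord HG).
- by move=> y; rewrite !mxE.
Qed.

Lemma tan_mul f g : reg f x -> reg g x ->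
  v (fun y => f y * g y) = v f * g x + f x * v g.
Proof.
move=> hf hg.
rewrite (@tan_pair (fun z => z 0 0 * z 0 1) f g _ hf hg).
- rewrite !(gpd_mul HG) ?(gpd_coord HG) /=; try exact: (greg_coord HG).
  by rewrite !mxE /= mul1r mulr0 addr0 mul0r mulr1 add0r mulrC.
- by apply: (greg_mul HG); apply: (greg_coord HG).
- by move=> y; rewrite !mxE.
Qed.

Lemma tan_opp f : reg f x -> v (fun y => - f y) = - v f.
Proof.
move=> hf; rewrite (_ : (fun y => - f y) = (fun y => -1 * f y)).
  by rewrite (@tan_mul (fun=> -1)) ?tan_cst ?mul0r ?add0r ?mulN1r //; apply: reg_cst.
by apply: funext => y; rewrite mulN1r.
Qed.

Lemma tan_sub f g : reg f x -> reg g x -> v (fun y => f y - g y) = v f - v g.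
Proof.
move=> hf hg; rewrite (@tan_add f (fun y => - g y)) ?tan_opp //.
exact: reg_opp.
Qed.

Lemma tan_sum (I : Type) (s : seq I) (F : I -> X -> K) :
  (forall i, reg (F i) x) -> v (fun y => \sum_(i <- s) F i y) = \sum_(i <- s) v (F i).
Proof.
move=> h; elim: s => [|a s IH].
  rewrite big_nil (_ : (fun y => _) = fun=> 0) ?tan_cst //.
  by apply: funext => y; rewrite big_nil.
rewrite (_ : (fun y => _) = (fun y => F a y + \sum_(i <- s) F i y)).
  by rewrite tan_add ?IH ?big_cons //; apply: reg_sum.
by apply: funext => y; rewrite big_cons.
Qed.

Lemma tan_horner (P : {poly K}) f : reg f x ->
  v (fun y => P.[f y]) = P^`().[f x] * v f.
Proof.
move=> hf; elim/poly_ind: P => [|P c IH].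
  rewrite deriv0 horner0 mul0r (_ : (fun y => _) = fun=> 0) ?tan_cst //.
  by apply: funext => y; rewrite horner0.
rewrite (_ : (fun y => _) = (fun y => P.[f y] * f y + c)); last first.
  by apply: funext => y; rewrite hornerMXaddC.
rewrite (@tan_add (fun y => P.[f y] * f y) (fun=> c)); last 2 first.
- by apply: reg_mul => //; apply: reg_horner.
- exact: reg_cst.
rewrite (@tan_mul (fun y => P.[f y])) ?IH //; last exact: reg_horner.
by rewrite tan_cst addr0 derivMXaddC hornerD hornerMX; ring.
Qed.

End Tangents.

Lemma tan_lin x n (c : 'I_n -> K) (u : 'I_n -> tvec X) :
  (forall i, tangent x (u i)) -> tangent x (fun f => \sum_i c i * u i f).
Proof.
move=> hu; split=> [f nf|m g F f hg hF hf].
  by rewrite big1 // => i _; rewrite (tan_nreg (hu i)) // mulr0.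
under eq_bigr do rewrite (tan_comp (hu _) hg hF hf) mulr_sumr.
rewrite exchange_big /=; apply: eq_bigr => j _.
by rewrite mulr_sumr; apply: eq_bigr => i _; rewrite mulrCA.
Qed.

Lemma tan_scale x (c : K) (u : tvec X) :
  tangent x u -> tangent x (fun f => c * u f).
Proof.
move=> hu; have := @tan_lin x 1 (fun=> c) (fun=> u) (fun=> hu).
by congr tangent; apply: funext => f; rewrite big_ord1.
Qed.

Lemma tan_near_nreg x (v : tvec X) f g : tangent x v ->
  nb x [set q | f q = g q] -> v f = v g.
Proof.
move=> tv hn; have [hg|ng] := pselect (reg g x); first exact: (tan_near tv).
rewrite !(tan_nreg tv) // => hf; apply: ng.
by apply: (reg_eq HX) hf _; apply: nbS hn => // y /= ->.
Qed.

End SpaceTheory.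
End Core.

(** * Manifolds and models *)

Section Core2.
Variables (G : geometry) (HG : geometry_laws G).
Local Notation K := (gK G).

Lemma chart_tuple n (X : gspace G) (HX : is_manifold n X) l (g : 'I_l -> X -> K) x :
  (forall i, reg (g i) x) ->
  exists U m (e : X -> 'rV[K]_m) W (F : 'I_l -> 'rV[K]_m -> K) (P : set 'rV[K]_m),
    [/\ U x, manifold_chart n U e W, forall i, greg (F i) (e x), gnb (e x) P &
      forall y, U y -> P (e y) -> tuple_map g y = tuple_map F (e y)].
Proof.
have [U [m [e [W [Ux ch]]]]] := HX x; have [_ _ _ hn hr] := ch => hg.
have {hg} /choice[F hF] : forall i, exists F, greg F (e x) /\ nb x [set y | g i y = F (e y)].
  by move=> i; apply/(hr _ Ux).
have /choice[P hP] : forall i, exists O, gnb (e x) O /\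
    forall y, U y -> O (e y) -> g i y = F i (e y).
  by move=> i; apply/(hn _ Ux); case: (hF i).
exists U, m, e, W, F, [set z | forall i, P i z]; split=> //.
- by move=> i; case: (hF i).
- by apply: (gnb_forall HG) => i; case: (hP i).
by move=> y Uy Py; apply/rowP => i; rewrite !mxE; case: (hP i) => _; apply.
Qed.

Lemma manifold_laws n (X : gspace G) : is_manifold n X -> space_laws X.
Proof.
move=> HX; split.
- move=> x; have [U [m [e [W [Ux [_ _ _ hn _]]]]]] := HX x.
  by apply/(hn _ Ux); exists setT; split=> //; apply: (gnbT HG).
- move=> x A B; have [U [m [e [W [Ux [_ _ _ hn _]]]]]] := HX x.
  move=> /(hn _ Ux)[O1 [h1 k1]] /(hn _ Ux)[O2 [h2 k2]].
  apply/(hn _ Ux); exists (O1 `&` O2); split; first exact: (gnbI HG).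
  by move=> y Uy [o1 o2]; split; [apply: k1|apply: k2].
- move=> x A B AB; have [U [m [e [W [Ux [_ _ _ hn _]]]]]] := HX x.
  move=> /(hn _ Ux)[O1 [h1 k1]].
  by apply/(hn _ Ux); exists O1; split=> // y Uy oy; apply: AB; apply: k1.
- move=> x A; have [U [m [e [W [Ux [_ _ _ hn _]]]]]] := HX x.
  by move=> /(hn _ Ux)[O1 [h1 k1]]; apply: k1 => //; apply: (gnb_in HG).
- move=> x A; have [U [m [e [W [Ux [_ _ _ hn _]]]]]] := HX x.
  move=> /(hn _ Ux)[O1 [h1 k1]].
  apply/(hn _ Ux); exists [set z | gnb z O1]; split; first exact: (gnb_open HG).
  by move=> y Uy oy; apply/(hn _ Uy); exists O1.
- move=> f x; have [U [m [e [W [Ux [_ hU _ hn hr]]]]]] := HX x.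
  move=> /(hr _ Ux)[F [hF /(hn _ Ux)[O [hO kO]]]].
  apply/(hn _ Ux).
  exists ([set z | gnb z O] `&` [set z | greg F z]); split.
    by apply: (gnbI HG); [apply: (gnb_open HG)|apply: (greg_near HG)].
  move=> y Uy [oy fy]; apply/(hr _ Uy); exists F; split=> //.
  by apply/(hn _ Uy); exists O.
- move=> f f' x; have [U [m [e [W [Ux [_ hU _ hn hr]]]]]] := HX x.
  move=> /(hr _ Ux)[F [hF /(hn _ Ux)[O [hO kO]]]] /(hn _ Ux)[O2 [hO2 kO2]].
  apply/(hr _ Ux); exists F; split=> //; apply/(hn _ Ux).
  exists (O `&` O2); split; first exact: (gnbI HG).
  by move=> y Uy [oy o2y] /=; rewrite (kO2 y) // (kO y).
- move=> l g x O /(chart_tuple HX)[U [m [e [W [F [P [Ux [_ _ _ hn _] hF hP E]]]]]]].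
  rewrite (E x Ux (gnb_in HG hP)) => hO; apply/(hn _ Ux).
  exists ([set y | O (tuple_map F y)] `&` P); split; first exact: (gnbI HG (greg_cts HG hF hO)).
  by move=> y Uy [Oy Py] /=; rewrite (E y Uy Py).
- move=> l g Phi x /(chart_tuple HX)[U [m [e [W [F [P [Ux [_ _ _ hn hr] hF hP E]]]]]]].
  rewrite (E x Ux (gnb_in HG hP)) => hPhi; apply/(hr _ Ux).
  exists (fun z => Phi (tuple_map F z)); split; first exact: (greg_comp HG).
  by apply/(hn _ Ux); exists P; split=> // y Uy Py /=; rewrite (E y Uy Py).
Qed.

Section RegularMaps.
Variables (X Y : gspace G) (HX : space_laws X) (HY : space_laws Y).

Definition regular_map (phi : X -> Y) (x : X) :=
  (forall N, nb (phi x) N -> nb x (phi @^-1` N)) /\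
  (forall f, reg f (phi x) -> reg (f \o phi) x).

Lemma pushforward_tangent phi x v : regular_map phi x -> tangent x v ->
  tangent (phi x) (pushforward (X := X) (Y := Y) phi x v).
Proof.
move=> [hc hr] tv; split=> [f nf|n g F f hg hF hn].
  by rewrite /pushforward asboolF.
have hf : reg f (phi x).
  by apply: (reg_eq HY) (reg_comp HY hg hF) _.
rewrite /pushforward asboolT // (tan_comp tv (g := fun i => g i \o phi) (F := F)).
- by apply: eq_bigr => i _; rewrite asboolT.
- by move=> i; apply: hr.
- exact: hF.
- exact: hc hn.
Qed.

Lemma pushforwardE phi x v f : reg f (phi x) ->
  pushforward (X := X) (Y := Y) phi x v f = v (f \o phi).
Proof. by move=> h; rewrite /pushforward asboolT. Qed.

Lemma pushforward_scale phi x v (c : K) :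
  pushforward (X := X) (Y := Y) phi x (fun f => c * v f) =
  (fun f => c * pushforward (X := X) (Y := Y) phi x v f).
Proof.
by apply: funext => f; rewrite /pushforward; case: asboolP; rewrite ?mulr0.
Qed.

End RegularMaps.

(** * Models as spaces, and vector fields on them *)

Section ModelSpace.
Variables (n m : nat) (W : set 'rV[K]_m) (hW : gmodel (g := G) n W).

Definition model_nb (s : {z | W z}) : set (set {z | W z}) :=
  [set N | exists O, gnb (sval s) O /\ forall y, O (sval y) -> N y].

Definition model_reg (f : {z | W z} -> K) (s : {z | W z}) : Prop :=
  exists F, greg F (sval s) /\ model_nb s [set y | f y = F (sval y)].

Definition model_space : gspace G := Defs.Space model_nb model_reg.

Lemma model_manifold : is_manifold n model_space.
Proof.
move=> p; exists setT, m, (fun s : model_space => sval s), W; split=> //; split=> //.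
- by move=> q _; exists setT; split=> //; apply: (gnbT HG).
- split.
    by move=> [a ha] [b hb] _ _ /= E; apply: eq_exist.
  by apply/seteqP; split=> [z [[a ha] _ <-] //|z hz]; exists (exist _ z hz).
- move=> q _ N; split=> [[O [hO kO]]|[O [hO kO]]]; exists O; split=> //.
    by move=> y _; apply: kO.
  by move=> y; apply: kO.
Qed.

Lemma model_laws : space_laws model_space.
Proof. exact: manifold_laws model_manifold. Qed.

Lemma model_reg_sval F (s : model_space) :
  greg F (sval s) -> reg (fun y : model_space => F (sval y)) s.
Proof.
move=> hF; exists F; split=> //; exists setT; split=> //; exact: (gnbT HG).
Qed.

Variables (xi : 'rV[K]_m -> 'rV[K]_m).
Hypothesis xi_reg : forall s, W s -> forall i, greg (fun z => xi z 0 i) s.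
Hypothesis xi_tan : forall s, W s -> forall F, greg F s ->
  gnb s [set z | W z -> F z = 0] -> \sum_i gpd F s i * xi s 0 i = 0.

(** The derivative along xi, computed from any extension F of f to the ambient space; by [xi_tan] it
    does not depend on F. Where f is not regular the default value 0 is the one that [tangent]
    demands. *)
Definition model_field (s : model_space) : tvec model_space :=
  fun f => xget 0 [set c | exists F, [/\ greg F (sval s),
    nb s [set y : model_space | f y = F (sval y)] &
    c = \sum_i gpd F (sval s) i * xi (sval s) 0 i]].

Lemma model_fieldE (s : model_space) f F : greg F (sval s) ->
  nb s [set y : model_space | f y = F (sval y)] ->
  model_field s f = \sum_i gpd F (sval s) i * xi (sval s) 0 i.
Proof.
move=> hF hn; rewrite /model_field; case: xgetP => [c _ [F' [hF' hn' ->]]|]; last first.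
  by move/(_ (\sum_i gpd F (sval s) i * xi (sval s) 0 i)); case; exists F.
apply/eqP; rewrite -subr_eq0 -sumrB; apply/eqP.
pose N z := -1 * F z.
have hN : greg N (sval s) by apply: (greg_mul HG) => //; apply: (greg_cst HG).
transitivity (\sum_i gpd (fun z => F' z + N z) (sval s) i * xi (sval s) 0 i).
  apply: eq_bigr => i _; rewrite (gpd_add HG) //.
  rewrite (gpd_mul HG) // ?(gpd_cst HG); last exact: (greg_cst HG).
  by rewrite mul0r add0r mulN1r mulrBl.
apply: xi_tan; first exact: svalP.
- exact: (greg_add HG).
- case: hn => O [hO kO]; case: hn' => O' [hO' kO'].
  apply: (gnbS HG) (gnbI HG hO hO') => z [oz o'z] /= wz.
  rewrite /N mulN1r -(kO (exist _ z wz)) // -(kO' (exist _ z wz)) //.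
  by rewrite subrr.
Qed.

Lemma model_field_tangent s : tangent s (model_field s).
Proof.
split=> [f nf|k g F f hg hF hn].
  rewrite /model_field; case: xgetP => // c _ [F [hF hn _]].
  by case: nf; exists F.
have /choice[Gi hGi] := hg.
have E : tuple_map g s = tuple_map Gi (sval s).
  by apply/rowP => i; rewrite !mxE; apply: (nb_in model_laws (hGi i).2).
rewrite E in hF *.
have hc := greg_comp HG (fun i => (hGi i).1) hF.
rewrite (model_fieldE hc); last first.
  apply: (nbS model_laws) (nbI model_laws hn
    (nb_forall model_laws (fun i => (hGi i).2))) => y [/= -> h].
  by congr F; apply/rowP => i; rewrite !mxE; apply: h.
under [RHS]eq_bigr => i _ do rewrite (model_fieldE (hGi i).1 (hGi i).2) mulr_sumr.
rewrite exchange_big; apply: eq_bigr => i _ /=.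
rewrite (gpd_comp HG) // ?mulr_suml; last by move=> j; case: (hGi j).
by apply: eq_bigr => j _; rewrite mulrA.
Qed.

Lemma model_field_reg s f : reg f s -> reg (fun y => model_field y f) s.
Proof.
move=> [F [hF hn]].
exists (fun z => \sum_i gpd F z i * xi z 0 i); split.
  have : greg (fun z => \sum_(i < m) gpd F z i * xi z 0 i) (sval s).
    elim: (index_enum _) => [|a l IH].
      apply: (greg_eq HG) (greg_cst HG 0 _) _.
      by apply: (gnbS HG) (gnbT HG _) => z _ /=; rewrite big_nil.
    apply: (greg_eq HG) (greg_add HG (greg_mul HG (gpd_reg HG a hF) (xi_reg (svalP s) a)) IH) _.
    by apply: (gnbS HG) (gnbT HG _) => z _ /=; rewrite big_cons.
  by [].
case: hn => O [hO kO].
exists ([set z | gnb z O] `&` [set z | greg F z]); split.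
  by apply: (gnbI HG); [apply: (gnb_open HG)|apply: (greg_near HG)].
move=> y [h1 h2] /=; apply: model_fieldE => //; by exists O.
Qed.

(** The map is obtained by choosing preimages under the bijection e of U onto WS. It is regular
    because neighbourhoods and functions on U are read off through e, where the map becomes Gam. *)
Lemma model_chart_map (S : gspace G) nS (U : set S) mS (e : S -> 'rV[K]_mS) WS
    (Gam : 'I_mS -> 'rV[K]_m -> K) :
  manifold_chart nS U e WS -> space_laws S ->
  (forall s, W s -> forall i, greg (Gam i) s) ->
  (forall s, W s -> WS (tuple_map Gam s)) ->
  exists gam : model_space -> S,
    forall s, [/\ U (gam s), e (gam s) = tuple_map Gam (sval s) & regular_map gam s].
Proof.
move=> [_ hU [einj eW] hn hr] HS hGam hGW.
have /choice[gam hgam] : forall s : model_space, exists q,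
    U q /\ e q = tuple_map Gam (sval s).
  move=> s; have := hGW _ (svalP s); rewrite -eW => -[q Uq eq]; by exists q.
exists gam => s; have [Us es] := hgam s; split=> //.
have hc N : nb (gam s) N -> nb s (gam @^-1` N).
  move/(hn _ Us) => [O [hO kO]]; exists [set z | O (tuple_map Gam z)]; split.
    by rewrite es in hO; apply: (greg_cts HG) => // i; apply: hGam; apply: svalP.
  move=> y /= Oy; have [Uy ey] := hgam y; apply: kO => //; by rewrite ey.
split=> // f /(hr _ Us)[F [hF hfn]].
exists (fun z => F (tuple_map Gam z)); split.
  by rewrite es in hF; apply: (greg_comp HG) => // i; apply: hGam; apply: svalP.
apply: (nbS model_laws) (hc _ hfn) => y /= ->.
by have [_ ->] := hgam y.
Qed.

End ModelSpace.
End Core2.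

(** * Projectivized distributions *)

Section Proj.
Variables (G : geometry) (HG : geometry_laws G).
Local Notation K := (gK G).
Variables (X : gspace G) (HX : space_laws X) (D : distribution X).
Local Notation PX := (proj_space D).
Implicit Types (z : PX).

(** Any two vectors of a line are proportional, so the choice of v in [dquot] does not matter. *)
Lemma line_dquot (z : proj_pt D) v (a b : X -> K) :
  line z v -> v a != 0 -> dquot b a z = v b / v a.
Proof.
move=> lv va; rewrite /dquot; case: xgetP => [c _ [w [lw wa ->]]|]; last first.
  by move/(_ (v b / v a)); case; exists v.
case: z lv lw => q L [u [Du u0 /= ->]] /= [c1 E1] [c2 E2].
move: va wa; rewrite E1 E2 !mulf_eq0 !negb_or => /andP[h1 h2] /andP[h3 _].
by rewrite !invfM !mulrA; field; rewrite h1 h2 h3.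
Qed.

Lemma proj_cts n (h : 'I_n -> PX -> K) z O :
  (forall i, proj_generator z (h i)) -> gnb (tuple_map h z) O ->
  nb z [set y | O (tuple_map h y)].
Proof. by move=> hg hO; exists n, h, O. Qed.

Lemma proj_nbS z A B : A `<=` B -> nb z A -> nb z B.
Proof. by move=> AB [n [h [O [h1 h2 h3]]]]; exists n, h, O; split=> // y /h3/AB. Qed.

Lemma proj_nb_in z A : nb z A -> A z.
Proof. by move=> [n [h [O [h1 h2 h3]]]]; apply: h3; apply: (gnb_in HG). Qed.

Lemma proj_nbT z : nb z setT.
Proof.
exists 0%N, (fun _ => fun=> 0), setT; split=> //; first by case.
exact: (gnbT HG).
Qed.

(* A finite family of finite families of generators, flattened. *)
Lemma proj_nb_tuples n (N : 'I_n -> nat) (h : forall i, 'I_(N i) -> PX -> K) z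
    (O : forall i, set 'rV[K]_(N i)) :
  (forall i j, proj_generator z (h i j)) ->
  (forall i, gnb (tuple_map (h i) z) (O i)) ->
  exists M (H : 'I_M -> PX -> K) (c : forall i, 'I_(N i) -> 'I_M),
    [/\ forall l, proj_generator z (H l),
        forall i j y, H (c i j) y = h i j y &
        nb z [set y | forall i, O i (tuple_map (h i) y)]].
Proof.
move=> hg hO.
pose I : finType := {i : 'I_n & 'I_(N i)}.
pose H (l : 'I_#|I|) := h (tag (enum_val l)) (tagged (enum_val l)).
pose c i (j : 'I_(N i)) : 'I_#|I| := enum_rank (Tagged (fun i => 'I_(N i)) j).
have Hc i j : H (c i j) = h i j by rewrite /H /c enum_rankK.
have gH l : proj_generator z (H l) by apply: hg.
exists #|I|, H, c; split=> //; first by move=> i j y; rewrite Hc.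
pose pr i (w : 'rV[K]_#|I|) : 'rV[K]_(N i) := \row_j w 0 (c i j).
have E i y : pr i (tuple_map H y) = tuple_map (h i) y.
  by apply/rowP => j; rewrite !mxE Hc.
have hP i : gnb (tuple_map H z) [set w | O i (pr i w)].
  apply: (greg_cts HG (g := fun j w => w 0 (c i j))).
    by move=> j; apply: (greg_coord HG).
  rewrite (_ : tuple_map _ _ = tuple_map (h i) z) //.
  by rewrite -E; apply/rowP => j; rewrite !mxE.
exists #|I|, H, [set w | forall i, O i (pr i w)]; split=> //.
  exact: (gnb_forall HG).
by move=> y /= hy i; rewrite -E; apply: hy.
Qed.

Lemma proj_nb_forall n z (P : 'I_n -> set PX) :
  (forall i, nb z (P i)) -> nb z [set y | forall i, P i y].
Proof.
move=> hP.
have /choice[N hN] := hP.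
have [h hh] : exists h : forall i, 'I_(N i) -> PX -> K, forall i, exists O, [/\ forall j, proj_generator z (h i j),
   gnb (tuple_map (h i) z) O & forall y, O (tuple_map (h i) y) -> P i y].
  exists (fun i => projT1 (cid (hN i))) => i; exact: (projT2 (cid (hN i))).
pose O i := projT1 (cid (hh i)).
have hO i := projT2 (cid (hh i)).
have [M [H [c [h1 h2 h3]]]] := @proj_nb_tuples _ N h z O (fun i => let: And3 a _ _ := hO i in a)
   (fun i => let: And3 _ a _ := hO i in a).
by apply: proj_nbS h3 => y hy i; case: (hO i) => _ _; apply; apply: hy.
Qed.

Lemma proj_nbI z A B : nb z A -> nb z B -> nb z (A `&` B).
Proof.
move=> hA hB.
apply: proj_nbS (@proj_nb_forall 2 z (fun i => if i == 0 then A else B) _).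
  by move=> y hy; split; [apply: (hy 0)|apply: (hy 1)].
by move=> i; case: ifP.
Qed.

Lemma proj_cts_base z N : nb (base z) N -> nb z (@base _ _ D @^-1` N).
Proof.
move=> /(reg_indic HG HX)[g [gr g0 gN]].
exists 1%N, (fun=> g \o @base _ _ D), [set w | w 0 0 != 0]; split.
- by move=> _; left; exists g.
- by apply: (gnb_neq0 HG); rewrite mxE.
- by move=> y /=; rewrite mxE; apply: gN.
Qed.

(** The quotient da/da is 1 where da is nonzero on the line and the default 0 elsewhere, so this
    generator makes nonvanishing of da on the line an open condition. *)
Lemma dquot_self (z : proj_pt D) (a : X -> K) : dquot a a z != 0 <-> exists2 v, line z v & v a != 0.
Proof.
split=> [|[v lv va]]; last by rewrite (line_dquot _ lv va) divff ?oner_eq0.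
by rewrite /dquot; case: xgetP => [c _ [v [lv va _]] _|]; [exists v|rewrite eqxx].
Qed.

Lemma proj_line_open z (a : X -> K) : reg a (base z) ->
  (exists2 v, line z v & v a != 0) ->
  nb z [set y : PX | exists2 v, line y v & v a != 0].
Proof.
move=> ra hv.
exists 1%N, (fun=> dquot a a), [set w | w 0 0 != 0]; split.
- by move=> _; right; exists a, a.
- by apply: (gnb_neq0 HG); rewrite mxE; apply/dquot_self.
- by move=> y /=; rewrite mxE => /dquot_self.
Qed.

Lemma proj_gen_open z (h : PX -> K) :
  proj_generator z h -> nb z [set y : PX | @proj_generator G X D y h].
Proof.
move=> [[g rg ->]|[a [b [ra rb hv ->]]]].
  apply: proj_nbS (proj_cts_base (reg_near HX rg)) => y /= ry.
  by left; exists g.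
apply: proj_nbS (proj_nbI (proj_line_open ra hv)
  (proj_nbI (proj_cts_base (reg_near HX ra)) (proj_cts_base (reg_near HX rb)))).
by move=> y [h1 [h2 h3]]; right; exists a, b.
Qed.

Lemma proj_nb_open z A : nb z A -> nb z [set y | nb y A].
Proof.
move=> [n [h [O [h1 h2 h3]]]].
apply: proj_nbS (proj_nbI (proj_nb_forall (fun i => proj_gen_open (h1 i)))
  (proj_cts h1 (gnb_open HG h2))) => y [k1 k2].
by exists n, h, O.
Qed.

Lemma proj_reg_gen z (h : PX -> K) : proj_generator z h -> reg h z.
Proof.
move=> hg; exists 1%N, (fun=> h), (fun w => w 0 0); split=> //.
- exact: (greg_coord HG).
- by apply: proj_nbS (proj_nbT z) => y _; rewrite /= mxE.
Qed.

Lemma proj_reg_base z g : reg g (base z) -> reg (g \o @base _ _ D : PX -> K) z.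
Proof. by move=> rg; apply: proj_reg_gen; left; exists g. Qed.

Lemma proj_reg_near (f : PX -> K) z : reg f z -> nb z [set y | reg f y].
Proof.
move=> [n [h [F [h1 h2 h3]]]].
apply: proj_nbS (proj_nbI (proj_nb_forall (fun i => proj_gen_open (h1 i)))
  (proj_nbI (proj_cts h1 (greg_near HG h2)) (proj_nb_open h3))) => y [k1 [k2 k3]].
by exists n, h, F.
Qed.

Lemma proj_reg_eq (f f' : PX -> K) z : reg f z -> nb z [set y | f' y = f y] -> reg f' z.
Proof.
move=> [n [h [F [h1 h2 h3]]]] he; exists n, h, F; split=> //.
by apply: proj_nbS (proj_nbI he h3) => y [/= -> ->].
Qed.

Lemma proj_reg_tuple n (g : 'I_n -> PX -> K) z : (forall i, reg (g i) z) ->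
  exists M (H : 'I_M -> PX -> K) (F : 'I_n -> 'rV[K]_M -> K),
    [/\ forall l, proj_generator z (H l), forall i, greg (F i) (tuple_map H z) &
      nb z [set y | tuple_map g y = tuple_map F (tuple_map H y)]].
Proof.
move=> hg.
have /choice[N hN] := hg.
have [h hh] : exists h : forall i, 'I_(N i) -> PX -> K, forall i, exists F, [/\ forall j, proj_generator z (h i j),
   greg F (tuple_map (h i) z) & proj_nb z [set y | g i y = F (tuple_map (h i) y)]].
  exists (fun i => projT1 (cid (hN i))) => i; exact: (projT2 (cid (hN i))).
pose F i := projT1 (cid (hh i)).
have hF i := projT2 (cid (hh i)).
have [M [H [c [h1 h2 _]]]] := @proj_nb_tuples _ N h z (fun=> setT)
   (fun i => let: And3 a _ _ := hF i in a) (fun i => gnbT HG _).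
pose pr i (w : 'rV[K]_M) : 'rV[K]_(N i) := \row_j w 0 (c i j).
have E i y : pr i (tuple_map H y) = tuple_map (h i) y.
  by apply/rowP => j; rewrite !mxE h2.
have hFr i : greg (fun w => F i (pr i w)) (tuple_map H z).
  apply: (greg_comp HG (g := fun j w => w 0 (c i j))).
    by move=> j; apply: (greg_coord HG).
  rewrite (_ : tuple_map _ _ = tuple_map (h i) z); first by case: (hF i).
  by rewrite -E; apply/rowP => j; rewrite !mxE.
have hn : nb z [set y | forall i, g i y = F i (tuple_map (h i) y)].
  by apply: proj_nb_forall => i; case: (hF i).
exists M, H, (fun i w => F i (pr i w)); split=> //.
by apply: proj_nbS hn => y hy; apply/rowP => i; rewrite !mxE E hy.
Qed.

Lemma proj_reg_cts n (g : 'I_n -> PX -> K) z O :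
  (forall i, reg (g i) z) -> gnb (tuple_map g z) O ->
  nb z [set y | O (tuple_map g y)].
Proof.
move=> /proj_reg_tuple[M [H [F [h1 h2 h3]]]]; rewrite (proj_nb_in h3) => hO.
by apply: proj_nbS (proj_nbI (proj_cts h1 (greg_cts HG h2 hO)) h3) => y [/= ? ->].
Qed.

Lemma proj_reg_comp n (g : 'I_n -> PX -> K) Phi z :
  (forall i, reg (g i) z) -> greg Phi (tuple_map g z) ->
  reg (fun y => Phi (tuple_map g y)) z.
Proof.
move=> /proj_reg_tuple[M [H [F [h1 h2 h3]]]]; rewrite (proj_nb_in h3) => hPhi.
exists M, H, (fun w => Phi (tuple_map F w)); split=> //; first exact: (greg_comp HG).
by apply: proj_nbS h3 => y /= ->.
Qed.

Lemma proj_laws : space_laws PX.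
Proof.
split; [exact: proj_nbT | exact: proj_nbI | exact: proj_nbS | exact: proj_nb_in
 | exact: proj_nb_open | exact: proj_reg_near | exact: proj_reg_eq
 | exact: proj_reg_cts | exact: proj_reg_comp].
Qed.

Lemma proj_base_map z : regular_map (X := PX) (Y := X) (@base _ _ D) z.
Proof. by split=> [N hN|f hf]; [apply: proj_cts_base|apply: proj_reg_base]. Qed.

End Proj.

(** * Coframes, curves and one prolongation *)

Section Frames.
Variables (G : geometry) (HG : geometry_laws G).
Local Notation K := (gK G).

Definition expands (X : gspace G) (D : distribution X) (r n f : X -> K) (q : X) :=
  exists f1 f2, [/\ reg f1 q, reg f2 q &
    nb q [set q' | forall v, D q' v -> v f = f1 q' * v r + f2 q' * v n]].

(* The differentials of r and n span the dual of D. *)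
Definition coframe (X : gspace G) (D : distribution X) (r n : X -> K) (U : set X) :=
  (forall q, U q -> nb q U) /\
  (forall q, U q -> [/\ reg r q, reg n q & forall f, reg f q -> expands D r n f q]).

Lemma coframe_swap (X : gspace G) (HX : space_laws X) (D : distribution X) r n U :
  coframe D r n U -> coframe D n r U.
Proof.
move=> [hU h]; split=> // q Uq; have [rr rn e] := h q Uq; split=> // f rf.
have [f1 [f2 [r1 r2 hf]]] := e f rf; exists f2, f1; split=> //.
by apply: (nbS HX) hf => q' hq' v Dv; rewrite addrC hq'.
Qed.

(** The field d plays the role of d/dt. The curve T stays the same throughout the tower, and lifting
    only shrinks the open set N. By [pc_inj] a power of t can vanish in N only at o, so that it may
    be divided by everywhere else. *)
Record param_curve (T : gspace G) (N : set T) (o : T) (t : T -> K)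
    (d : forall s : T, tvec T) : Prop := ParamCurve {
  pc_manifold : is_manifold 1 T ;
  pc_o : N o ;
  pc_open : forall s, N s -> nb s N ;
  pc_to : t o = 0 ;
  pc_inj : forall s, N s -> t s = 0 -> s = o ;
  pc_reg : forall s, N s -> reg t s ;
  pc_tan : forall s, N s -> tangent s (d s) ;
  pc_unit : forall s, N s -> d s t = 1 ;
  pc_field : forall s f, N s -> reg f s -> reg (fun s' => d s' f) s ;
  pc_span : forall s v, N s -> tangent s v -> v = (fun f => v t * d s f)
}.

Lemma param_curve_sub (T : gspace G) (N N' : set T) o t d :
  param_curve N o t d -> N' `<=` N -> N' o -> (forall s, N' s -> nb s N') ->
  param_curve N' o t d.
Proof.
move=> [h1 h2 h3 h4 h5 h6 h7 h8 h9 h10] NN N'o hN'.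
split=> //.
- by move=> s /NN; apply: h5.
- by move=> s /NN; apply: h6.
- by move=> s /NN; apply: h7.
- by move=> s /NN; apply: h8.
- by move=> s f /NN; apply: h9.
- by move=> s v /NN; apply: h10.
Qed.

Section Step.
Variables (X : gspace G) (HX : space_laws X) (D : distribution X).
Hypothesis Dtan : forall q v, D q v -> tangent q v.
Hypothesis Dscale : forall q v (c : K), D q v -> D q (fun f => c * v f).
Variables (rho del : X -> K) (U : set X).
Hypothesis HU : coframe D rho del U.
Local Notation PX := (proj_space D).
Let HPX : space_laws PX := proj_laws HG HX D.
Local Notation bs := (@base G X D).
Local Notation n' := (dquot (D := D) del rho).

Definition step_set : set PX :=
  [set z : PX | U (bs z) /\ exists2 v, line z v & v rho != 0].

Lemma line_focal (z : proj_pt D) v : line z v -> D (bs z) v.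
Proof. by case: z => q L [u [Du u0 /= ->]] [c ->]; apply: Dscale. Qed.

Lemma line_scale (z : proj_pt D) v (c : K) : line z v -> line z (fun f => c * v f).
Proof.
case: z => q L [u [Du u0 /= ->]] [c' ->].
by exists (c * c'); apply: funext => f; rewrite mulrA.
Qed.

Lemma line_nz (z : proj_pt D) : exists2 v, line z v & v <> (fun=> 0).
Proof.
case: z => q L [u [Du u0 /= ->]]; exists u => //; exists 1.
by apply: funext => f; rewrite mul1r.
Qed.

Lemma line_ratio (z : proj_pt D) v w : line z v -> w <> (fun=> 0) -> line z w ->
  exists c : K, v = (fun f => c * w f).
Proof.
case: z => q L [u [Du u0 /= ->]] [c ->] w0 [c' E]; move: w0; rewrite E => w0.
have c'0 : c' != 0.
  by apply/eqP => c0; apply: w0; apply: funext => f; rewrite c0 mul0r.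
by exists (c / c'); apply: funext => f; rewrite mulrA divfK.
Qed.

Lemma line_slope (z : proj_pt D) v : step_set z -> line z v -> v del = n' z * v rho.
Proof.
move=> [_ [w lw wr]] lv.
have w0 : w <> (fun=> 0) by move=> E; rewrite E eqxx in wr.
have [c ->] := line_ratio lv w0 lw.
by rewrite (line_dquot _ lw wr); field.
Qed.

Lemma step_set_open z : step_set z -> nb z step_set.
Proof.
move=> [Uz hv]; have [hU hf] := HU; have [rr rd _] := hf _ Uz.
apply: (nbS HPX) (nbI HPX (proj_cts_base HG HX (hU _ Uz)) (proj_line_open HG rr hv)).
by move=> y [].
Qed.

Lemma step_slope_reg z : step_set z -> reg (n' : PX -> K) z.
Proof.
move=> [Uz hv]; have [hU hf] := HU; have [rr rd _] := hf _ Uz.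
by apply: (proj_reg_gen HG); right; exists rho, del.
Qed.

Lemma line_value (z : proj_pt D) v b (b1 b2 : X -> K) : step_set z -> line z v ->
  (forall v, D (bs z) v -> v b = b1 (bs z) * v rho + b2 (bs z) * v del) ->
  v b = (b1 (bs z) + b2 (bs z) * n' z) * v rho.
Proof.
move=> sz lv /(_ _ (line_focal lv)) ->; rewrite (line_slope sz lv); ring.
Qed.

(** On D both da and db are combinations of d rho and d del, so every fiber coordinate db/da is a
    fractional linear function of the single slope d del / d rho. *)
Lemma dquot_formula (q : X) (a b : X -> K) : U q -> reg a q -> reg b q ->
  exists a1 a2 b1 b2, [/\ (reg a1 q /\ reg a2 q), (reg b1 q /\ reg b2 q),
    nb q [set q' | forall z : PX, step_set z -> bs z = q' ->
      dquot b a z = (b1 q' + b2 q' * n' z) / (a1 q' + a2 q' * n' z)] &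
    forall z : PX, step_set z -> bs z = q -> (exists2 v, line z v & v a != 0) ->
      a1 q + a2 q * n' z != 0].
Proof.
move=> Uq ra rb; have [_ hf] := HU; have [_ _ e] := hf _ Uq.
have [a1 [a2 [ra1 ra2 ea]]] := e a ra.
have [b1 [b2 [rb1 rb2 eb]]] := e b rb.
exists a1, a2, b1, b2; split=> //; last first.
  move=> z sz bz [v lv va]; apply: contraNneq va => E.
  by rewrite (@line_value z v a a1 a2) // ?bz ?E ?mul0r //; apply: (nb_in HX ea).
apply: (nbS HX) (nbI HX ea eb) => q' [/= ha hb] z sz bz.
have [_ [w lw wr]] := sz.
have va v : line z v -> v a = (a1 q' + a2 q' * n' z) * v rho.
  by move=> lv; rewrite (@line_value z v a a1 a2) ?bz.
have vb v : line z v -> v b = (b1 q' + b2 q' * n' z) * v rho.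
  by move=> lv; rewrite (@line_value z v b b1 b2) ?bz.
(* Where da vanishes on the line both sides are 0: [dquot] by its default value, and the fraction
   because the inverse of 0 is 0. *)
have [E|/eqP NE] := eqVneq (a1 q' + a2 q' * n' z) 0.
  rewrite E invr0 mulr0 /dquot; case: xgetP => // c _ [v [lv]].
  by rewrite (va v lv) E mul0r eqxx.
have wa : w a != 0 by rewrite va // mulf_neq0 //; apply/eqP.
rewrite (line_dquot _ lw wa) vb // va //; field; rewrite wr andbT; exact/eqP.
Qed.

(* The value at a line of the quotient of a function with differential
   b1 d rho + b2 d del by one with differential a1 d rho + a2 d del. *)
Definition five (a b c d e : PX -> K) (i : 'I_5) : PX -> K :=
  nth (fun=> 0) [:: a; b; c; d; e] i.

Definition frac5 (w : 'rV[K]_5) : K :=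
  (w 0 (inord 0) + w 0 (inord 1) * w 0 (inord 4)) /
  (w 0 (inord 2) + w 0 (inord 3) * w 0 (inord 4)).

Lemma frac5E a b c d e y : frac5 (tuple_map (five a b c d e) y) =
  (a y + b y * e y) / (c y + d y * e y).
Proof. by rewrite /frac5 !mxE /five !inordK. Qed.

Lemma frac5_reg (w : 'rV[K]_5) : w 0 (inord 2) + w 0 (inord 3) * w 0 (inord 4) != 0 ->
  greg frac5 w.
Proof.
move=> h; have hc i := greg_coord HG w i.
by apply: (greg_mul HG); [|apply: (greg_inv HG) => //];
  apply: (greg_add HG) => //; apply: (greg_mul HG).
Qed.

Lemma five_all (P : (PX -> K) -> Prop) a b c d e :
  P a -> P b -> P c -> P d -> P e -> forall i, P (five a b c d e i).
Proof. by move=> ? ? ? ? ?; do 5?[case=> [[|i]] //= hi]; case: i hi => [|[|[|[|[|]]]]]. Qed.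

Lemma dquot_frac (z : PX) (a b : X -> K) : step_set z -> reg a (bs z) -> reg b (bs z) ->
  (exists2 v, line z v & v a != 0) ->
  exists a1 a2 b1 b2 : X -> K, [/\ (reg a1 (bs z) /\ reg a2 (bs z)),
    (reg b1 (bs z) /\ reg b2 (bs z)),
    greg frac5 (tuple_map (five (b1 \o bs) (b2 \o bs) (a1 \o bs) (a2 \o bs) n') z) &
    nb (bs z) [set q' | forall y : PX, step_set y -> bs y = q' ->
      dquot b a y =
      frac5 (tuple_map (five (b1 \o bs) (b2 \o bs) (a1 \o bs) (a2 \o bs) n') y)]].
Proof.
move=> sz ra rb hv; have [Uz _] := sz.
have [a1 [a2 [b1 [b2 [h1 h2 h3 h4]]]]] := dquot_formula Uz ra rb.
exists a1, a2, b1, b2; split=> //.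
  by apply: frac5_reg; rewrite !mxE /five !inordK //=; apply: h4.
by apply: (nbS HX) h3 => q' /= hq y sy by'; rewrite frac5E (hq y) //= by'.
Qed.

Lemma expands_comp (Y : gspace G) (HY : space_laws Y) (E : distribution Y)
    (Etan : forall q v, E q v -> tangent q v)
    (r n : Y -> K) k (g : 'I_k -> Y -> K) F f q :
  (forall i, reg (g i) q /\ expands E r n (g i) q) -> greg F (tuple_map g q) ->
  nb q [set y | f y = F (tuple_map g y)] -> expands E r n f q.
Proof.
move=> hg hF hn.
have /choice[c1 /choice[c2 hc]] := fun i => (hg i).2.
exists (fun y => \sum_i gpd F (tuple_map g y) i * c1 i y),
  (fun y => \sum_i gpd F (tuple_map g y) i * c2 i y).
have hgr i : reg (g i) q by case: (hg i).
have hpd i : reg (fun y => gpd F (tuple_map g y) i) q.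
  exact: (reg_comp HY hgr (gpd_reg HG i hF)).
split.
- by apply: (reg_sum HG HY) => i _; apply: (reg_mul HG HY) => //; case: (hc i).
- by apply: (reg_sum HG HY) => i _; apply: (reg_mul HG HY) => //; case: (hc i).
have h1 := nb_forall HY (fun i => reg_near HY (hgr i)).
have h2 := reg_cts HY hgr (greg_near HG hF).
have h3 := nb_open HY hn.
have h4 : nb q [set y | forall i v, E y v -> v (g i) = c1 i y * v r + c2 i y * v n].
  by apply: (nb_forall HY) => i; case: (hc i).
apply: (nbS HY) (nbI HY (nbI HY h1 h2) (nbI HY h3 h4)) => y [[k1 k2] [k3 k4]] v Ev.
rewrite (tan_comp (Etan _ _ Ev) k1 k2 k3) !mulr_suml -big_split /=.
by apply: eq_bigr => i _; rewrite (k4 i) //; ring.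
Qed.

Lemma proj_focal_tangent (z : PX) v : proj_distribution z v -> tangent z v.
Proof. by case. Qed.

Lemma proj_focal_scale (z : PX) v (c : K) : proj_distribution z v ->
  proj_distribution z (fun f => c * v f).
Proof.
move=> [tv lv]; split; first exact: tan_scale.
by rewrite pushforward_scale; apply: line_scale.
Qed.

(** A focal vector projects into the line z itself, on which d del = n' d rho. The differential of a
    function from the base is therefore a multiple of d rho alone. *)
Lemma expands_base z g : step_set z -> reg g (bs z) ->
  expands (@proj_distribution G X D) (rho \o bs) n' (g \o bs) z.
Proof.
move=> sz rg; have [Uz _] := sz; have [hU hf] := HU.
have [rr rd e] := hf _ Uz; have [g1 [g2 [rg1 rg2 eg]]] := e g rg.
exists (fun y => g1 (bs y) + g2 (bs y) * n' y), (fun=> 0); split.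
- apply: (reg_add HG HPX); first exact: (proj_reg_base HG rg1).
  apply: (reg_mul HG HPX); first exact: (proj_reg_base HG rg2).
  exact: step_slope_reg.
- exact: (reg_cst HG HPX).
apply: (nbS HPX) (nbI HPX (step_set_open sz) (proj_cts_base HG HX
  (nbI HX eg (nbI HX (reg_near HX rg) (reg_near HX rr))))) => y [sy [/= h [h' h'']]] v [tv lv].
have := @line_value y _ g g1 g2 sy lv h.
by rewrite !pushforwardE // mul0r addr0.
Qed.

Lemma expands_slope z : step_set z ->
  expands (@proj_distribution G X D) (rho \o bs) n' n' z.
Proof.
move=> sz; exists (fun=> 0), (fun=> 1); split; try exact: (reg_cst HG HPX).
by apply: (nb_refl HPX) => y v _; rewrite mul0r add0r mul1r.
Qed.

Lemma step_coframe :
  coframe (@proj_distribution G X D : distribution PX) (rho \o bs) n' step_set.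
Proof.
split=> [z sz|z sz]; first exact: step_set_open.
have [Uz _] := sz; have [hU hf] := HU; have [rr rd e] := hf _ Uz.
split; [exact: (proj_reg_base HG) | exact: step_slope_reg |].
move=> f [k [h [F [hg hF hn]]]].
apply: (@expands_comp PX HPX _ proj_focal_tangent _ _ _ h F f z) => // i.
split; first exact: (proj_reg_gen HG).
case: (hg i) => [[g rg ->]|[a [b [ra rb hv ->]]]]; first exact: expands_base.
have [a1 [a2 [b1 [b2 [[h1 h2] [h3 h4] h5 h6]]]]] := dquot_frac sz ra rb hv.
apply: (@expands_comp PX HPX _ proj_focal_tangent _ _ _ _ frac5 _ z _ h5).
  move=> j; move: j; apply: (five_all (P := fun g : PX -> K => reg g z /\
    expands (@proj_distribution G X D : distribution PX) (rho \o bs) n' g z)).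
  all: try by split; [exact: (proj_reg_base HG) | exact: expands_base].
  by split; [exact: step_slope_reg | exact: expands_slope].
apply: (nbS HPX) (nbI HPX (step_set_open sz) (proj_cts_base HG HX h6)) => y [sy hy].
exact: hy.
Qed.

(** By [dquot_frac] every generator of the functions near z is either a function on the base or a
    fraction in n' with coefficients from the base, so v kills all of them. *)
Lemma step_kill (z : PX) v : step_set z -> tangent z v ->
  pushforward (X := PX) (Y := X) bs z v = (fun=> 0) -> v n' = 0 -> v = (fun=> 0).
Proof.
move=> sz tv pv vn; apply: funext => f.
have [rf|nf] := pselect (reg f z); last by rewrite (tan_nreg tv nf).
have [k [h [F [hg hF hn]]]] := rf.
have vb g : reg g (bs z) -> v (g \o bs) = 0.
  by move=> rg; have := congr1 (fun u : tvec X => u g) pv; rewrite pushforwardE.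
have hz i : v (h i) = 0.
  case: (hg i) => [[g rg ->]|[a [b [ra rb hv ->]]]]; first exact: vb.
  have [a1 [a2 [b1 [b2 [[h1 h2] [h3 h4] h5 h6]]]]] := dquot_frac sz ra rb hv.
  rewrite (tan_comp tv _ h5).
  - apply: big1 => j _; rewrite (_ : v _ = 0) ?mulr0 //; move: j.
    by apply: (five_all (P := fun g => v g = 0)) => //; apply: vb.
  - apply: (five_all (P := fun g => reg g z)).
    all: try exact: (proj_reg_base HG).
    exact: step_slope_reg.
  - apply: (nbS HPX) (nbI HPX (step_set_open sz) (proj_cts_base HG HX h6)) => y [sy hy].
    exact: hy.
rewrite (tan_comp tv (fun i => proj_reg_gen HG (hg i)) hF hn).
by apply: big1 => i _; rewrite hz mulr0.
Qed.

(** * Lifting a focal curve by one level *)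

Section StepCurve.
Variables (T : gspace G) (N : set T) (o : T) (t : T -> K) (d : forall s : T, tvec T).
Hypothesis pc : param_curve N o t d.
Let HT : space_laws T := manifold_laws HG (pc_manifold pc).
Variables (gam : T -> X) (R Dp Np : {poly K}) (z0 : PX).
Hypothesis gam_reg : forall s, N s -> regular_map gam s.
Hypothesis gam_focal : forall s, N s ->
  D (gam s) (pushforward (X := T) (Y := X) gam s (d s)).
Hypothesis gam_U : forall s, N s -> U (gam s).
Hypothesis gam_rho : forall s, N s -> rho (gam s) = R.[t s].
Hypothesis gam_del : forall s, N s -> del (gam s) = Dp.[t s].
Hypothesis gam_o : gam o = bs z0.
Hypothesis z0U : step_set z0.
Hypothesis hNp : Dp^`() = Np * R^`().
Hypothesis hNp0 : Np.[0] = n' z0.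
Variables (a : nat) (Q : {poly K}).
Hypothesis hR : R^`() = 'X^a * Q.
Hypothesis hQ : Q.[0] != 0.

(** Along the curve rho has derivative t^a Q(t); removing the zeros of Q leaves o as its only
    possible zero. *)
Let N' : set T := [set s | N s /\ Q.[t s] != 0].
Let w s := pushforward (X := T) (Y := X) gam s (d s).

Let N'sub s : N' s -> N s. Proof. by case. Qed.

Let N'open s : N' s -> nb s N'.
Proof.
move=> [Ns Qs]; have rt := pc_reg pc Ns.
exact: (nbI HT (pc_open pc Ns) (nb_neq0 HG HT (reg_horner HG HT Q rt) Qs)).
Qed.

Let N'o : N' o.
Proof. by split; [exact: (pc_o pc) | rewrite (pc_to pc)]. Qed.

Let w_poly s f (P : {poly K}) : N s -> reg f (gam s) ->
  (forall s, N s -> f (gam s) = P.[t s]) -> w s f = P^`().[t s].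
Proof.
move=> Ns rf hf; rewrite /w pushforwardE //.
have rt := pc_reg pc Ns; have td := pc_tan pc Ns.
rewrite (tan_near HG HT td (g := fun s => P.[t s])).
- by rewrite (tan_horner HG HT td) // (pc_unit pc Ns) mulr1.
- exact: (reg_horner HG HT).
- by apply: (nbS HT) (pc_open pc Ns) => s' Ns' /=; apply: hf.
Qed.

Let w_rho s : N s -> w s rho = R^`().[t s].
Proof.
by move=> Ns; apply: w_poly => //; have [_ /(_ _ (gam_U Ns))[]] := HU.
Qed.

Let w_del s : N s -> w s del = Np.[t s] * R^`().[t s].
Proof.
move=> Ns; rewrite -hornerM -hNp; apply: w_poly => //.
by have [_ /(_ _ (gam_U Ns))[]] := HU.
Qed.

Let w_rho_neq0 s : N' s -> s <> o -> w s rho != 0.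
Proof.
move=> [Ns Qs] so; rewrite w_rho // hR hornerM hornerXn mulf_neq0 // expf_eq0.
apply/negP => /andP[_ /eqP ts]; apply: so; exact: (pc_inj pc).
Qed.

(** Away from o the velocity is nonzero and spans the required line. At o it may vanish, so the line
    is the prescribed z0; this contains the velocity, because the slope of z0 is Np(0) and d del =
    Np d rho along the curve. *)
Let lift_ex s : exists z : PX, N' s ->
  [/\ bs z = gam s, line z (w s) & s = o -> z = z0].
Proof.
have [N's|nN] := pselect (N' s); last by exists z0.
have [so|so] := pselect (s = o).
  exists z0 => _; split=> //; first by rewrite so gam_o.
  have [Uz [v0 lv vr]] := z0U.
  have Ns := N'sub N's.
  have Dw := gam_focal Ns.
  have Dv := line_focal lv.
  suff -> : w s = (fun f => w s rho / v0 rho * v0 f).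
    exact: line_scale.
  apply: funext => f; have [rf|nf] := pselect (reg f (bs z0)); last first.
    rewrite (tan_nreg (Dtan Dv) nf) mulr0; apply: (tan_nreg (Dtan Dw)).
    by rewrite so gam_o.
  have [_ hf] := HU; have [_ _ /(_ f rf)[f1 [f2 [_ _ /(nb_in HX) e]]]] := hf _ Uz.
  rewrite (e _ Dv) (e (w s)) /=; last by rewrite -gam_o -so.
  rewrite w_del // -w_rho // so (pc_to pc) hNp0 (line_slope z0U lv).
  by field.
have wr := w_rho_neq0 N's so.
have isl : is_line D (gam s) [set u | exists c : K, u = fun f => c * w s f].
  exists (w s); split=> //; first exact: gam_focal (N'sub N's).
  by move=> E; rewrite E eqxx in wr.
exists (ProjPt isl) => _; split=> //.
by exists 1; apply: funext => f; rewrite mul1r.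
Qed.

(** As a quotient of velocities the slope may be 0/0 at o, but it equals Np(t) on all of N2. This
    makes the lift regular across o, the other fiber coordinates being fractions in the slope. *)
Lemma step_curve : exists (N2 : set T) (gam' : T -> PX),
  [/\ N2 `<=` N, param_curve N2 o t d, gam' o = z0 &
   forall s, N2 s -> [/\ bs (gam' s) = gam s /\ step_set (gam' s),
     n' (gam' s) = Np.[t s], regular_map gam' s &
     proj_distribution (gam' s) (pushforward (X := T) (Y := PX) gam' s (d s))]].
Proof.
have /choice[gam' hgam] := lift_ex.
have gb s : N' s -> bs (gam' s) = gam s by move=> /hgam[].
have gl s : N' s -> line (gam' s) (w s) by move=> /hgam[].
have go : gam' o = z0 by case: (hgam o N'o) => _ _; apply.
have gU s : N' s -> step_set (gam' s).
  move=> N's; have [->|so] := pselect (s = o); first by rewrite go.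
  split; first by rewrite gb //; apply: gam_U; apply: N'sub.
  by exists (w s); [apply: gl | apply: w_rho_neq0].
have gn s : N' s -> n' (gam' s) = Np.[t s].
  move=> N's; have [->|so] := pselect (s = o); first by rewrite go (pc_to pc).
  have wr := w_rho_neq0 N's so.
  by rewrite (line_dquot _ (gl _ N's) wr) w_del ?w_rho ?mulfK // -?w_rho //; apply: N'sub.
have gbase s g : N' s -> reg g (gam s) -> reg (g \o bs \o gam') s.
  move=> N's rg; have [_ hr] := gam_reg (N'sub N's).
  by apply: (reg_eq HT) (hr _ rg) _; apply: (nbS HT) (N'open N's) => y N'y /=; rewrite gb.
have gslope s : N' s -> reg (n' \o gam') s.
  move=> N's; apply: (reg_eq HT) (reg_horner HG HT Np (pc_reg pc (N'sub N's))) _.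
  by apply: (nbS HT) (N'open N's) => y N'y /=; rewrite gn.
have ggen s (h : PX -> K) : N' s -> proj_generator (gam' s) h -> reg (h \o gam') s.
  move=> N's [[g rg ->]|[a' [b [ra rb hv ->]]]].
    by apply: gbase => //; rewrite -gb.
  have [a1 [a2 [b1 [b2 [[h1 h2] [h3 h4] h5 h6]]]]] := dquot_frac (gU _ N's) ra rb hv.
  rewrite gb // in h1 h2 h3 h4 h6.
  have [hc _] := gam_reg (N'sub N's).
  pose fv := five (b1 \o bs) (b2 \o bs) (a1 \o bs) (a2 \o bs) n'.
  have E y : tuple_map (fun i => fv i \o gam') y = tuple_map fv (gam' y).
    by apply/rowP => i; rewrite !mxE.
  have hfv i : reg (fv i \o gam') s.
    move: i; apply: (five_all (P := fun f => reg (f \o gam') s)).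
    - exact: gbase.
    - exact: gbase.
    - exact: gbase.
    - exact: gbase.
    - exact: gslope.
  have h5' : greg frac5 (tuple_map (fun i => fv i \o gam') s) by rewrite E.
  apply: (reg_eq HT) (reg_comp HT hfv h5') _.
  apply: (nbS HT) (nbI HT (N'open N's) (hc _ h6)) => y [N'y /= hy].
  by rewrite E (hy (gam' y)) ?gb //; apply: gU.
have greg' s : N' s -> regular_map gam' s.
  move=> N's.
  have hc M : nb (gam' s) M -> nb s (gam' @^-1` M).
    move=> [k [h [O [h1 h2 h3]]]].
    have E y : tuple_map (fun i => h i \o gam') y = tuple_map h (gam' y).
      by apply/rowP => i; rewrite !mxE.
    have := @reg_cts _ _ HT k (fun i => h i \o gam') s O.
    rewrite E => /(_ (fun i => ggen _ _ N's (h1 i)) h2).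
    by apply: (nbS HT) => y; rewrite /= E; apply: h3.
  split=> // f [k [h [F [h1 h2 h3]]]].
  have E y : tuple_map (fun i => h i \o gam') y = tuple_map h (gam' y).
    by apply/rowP => i; rewrite !mxE.
  have := @reg_comp _ _ HT k (fun i => h i \o gam') F s.
  rewrite E => /(_ (fun i => ggen _ _ N's (h1 i)) h2) hF.
  by apply: (reg_eq HT) hF _; apply: (nbS HT) (hc _ h3) => y /= ->; rewrite E.
exists N', gam'; split=> //.
  by apply: (param_curve_sub pc) => //; apply: N'open.
move=> s N's; have [td rm] := (pc_tan pc (N'sub N's), greg' s N's).
split=> //; [by split; [exact: gb|exact: gU] | exact: gn |].
split; first exact: (pushforward_tangent HPX).
suff -> : pushforward (X := PX) (Y := X) bs (gam' s)
   (pushforward (X := T) (Y := PX) gam' s (d s)) = w s by exact: gl.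
apply: funext => f; rewrite /w /pushforward gb //; case: asboolP => // rf.
rewrite asboolT; last by apply: (proj_reg_base HG); rewrite gb.
apply: (tan_near HG HT td); first by case: (gam_reg (N'sub N's)) => _; apply.
by apply: (nbS HT) (N'open N's) => y N'y /=; rewrite gb.
Qed.

End StepCurve.
End Step.
End Frames.

(** * The tower of coframes *)

Section Tower.
Variables (G : geometry) (HG : geometry_laws G).
Local Notation K := (gK G).
Variables (S : gspace G) (HS : space_laws S).

(** The one existence statement about curves that is asked of a category. Both coordinates are
    prescribed in terms of the same parameter t, and T need not be the line. *)
Definition base_curves (p : S) (U : set S) (x y : S -> K) :=
  forall P Q : {poly K}, P.[0] = x p -> Q.[0] = y p ->
  exists (T : gspace G) (N : set T) (o : T) (t : T -> K)
    (d : forall s : T, tvec T) (gam : T -> S),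
    [/\ param_curve N o t d, gam o = p &
      forall s, N s -> [/\ regular_map gam s, U (gam s),
        x (gam s) = P.[t s] & y (gam s) = Q.[t s]]].

Hypothesis HB : forall p : S, exists (U : set S) (x y : S -> K),
  [/\ U p, coframe (@tangent G S : distribution S) x y U & base_curves p U x y].

Lemma monster_laws k : space_laws (monster S k).
Proof. by elim: k => [|k IH] //; apply: proj_laws. Qed.

Lemma monster_tangent k (q : monster S k) v :
  focal (d := monster S k) q v -> tangent q v.
Proof. by case: k q v => [//|k] q v []. Qed.

Lemma monster_scale k (q : monster S k) v (c : K) :
  focal (d := monster S k) q v -> focal (d := monster S k) q (fun f => c * v f).
Proof.
by case: k q v => [|k] q v; [apply: tan_scale | apply: (proj_focal_scale (D := _))].
Qed.

Definition fiber_vector k : forall q : monster S k, tvec (monster S k) -> Prop :=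
  match k with
  | 0 => fun _ _ => False
  | k'.+1 => fun q v =>
      pushforward (X := monster S k'.+1) (Y := monster S k') (@base _ _ _) q v
      = (fun=> 0)
  end.

Lemma vertical_fiber k (z : monster S k.+1) v : @vertical G S k z ->
  line z v -> fiber_vector (base z) v.
Proof. by case: k z v => [//|k] z v; apply. Qed.

(* Level i carries a retained coordinate [r i] and a new one [n i], the level
   i+1 has [r i.+1] = [r i] and [n i.+1] = d[n i]/d[r i], or, if [inv i.+1],
   the same with [r i] and [n i] exchanged.  Near p the focal distribution is
   given by these equations; inversions occur at least where p lies on the
   divisor at infinity, and then [n i] vanishes on that divisor. *)
Record tower k (p : monster S k) (U : set (monster S k))
    (r n : nat -> monster S k -> K) (inv : nat -> bool) : Prop := Tower {
  tw_p : U p ;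
  tw_frame : coframe (focal (d := monster S k)) (r k) (n k) U ;
  tw_reg : forall q i, U q -> (i <= k)%N -> reg (r i) q /\ reg (n i) q ;
  tw_r : forall i, (i < k)%N -> r i.+1 = if inv i.+1 then n i else r i ;
  tw_d : forall q v i, U q -> focal (d := monster S k) q v -> (i < k)%N ->
    v (if inv i.+1 then r i else n i) = n i.+1 q * v (r i.+1) ;
  tw_kill : forall q v, U q -> tangent q v -> v (r k) = 0 -> v (n k) = 0 ->
    (forall i, (i < k)%N ->
      v (if inv i.+1 then r i else n i) = n i.+1 q * v (r i.+1)) ->
    v = (fun=> 0) ;
  tw_infty : forall q i, U q -> (2 <= i <= k)%N -> inv i ->
    infinity i q -> n i q = 0 ;
  tw_not_infty : forall i, (2 <= i <= k)%N -> ~~ inv i -> ~ infinity i p ;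
  tw_fiber : forall q v, U q -> fiber_vector q v -> v (r k) = 0 ;
  tw_curve : forall R N : nat -> {poly K},
    (forall i, (i <= k)%N -> (R i).[0] = r i p /\ (N i).[0] = n i p) ->
    (forall i, (i < k)%N -> R i.+1 = if inv i.+1 then N i else R i) ->
    (forall i, (i < k)%N ->
       (if inv i.+1 then R i else N i)^`() = N i.+1 * (R i.+1)^`()) ->
    (forall i, (i <= k)%N -> exists a Q, (R i)^`() = 'X^a * Q /\ Q.[0] != 0) ->
    exists (T : gspace G) (O : set T) (o : T) (t : T -> K)
      (d : forall s : T, tvec T) (gam : T -> monster S k),
      [/\ param_curve O o t d, gam o = p &
        forall s, O s -> [/\ regular_map gam s,
          focal (d := monster S k) (gam s)
            (pushforward (X := T) (Y := monster S k) gam s (d s)), U (gam s) &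
          forall i, (i <= k)%N ->
            r i (gam s) = (R i).[t s] /\ n i (gam s) = (N i).[t s]]]
}.

Lemma coframe_kill (X : gspace G) (HX : space_laws X) (D : distribution X) r n U q v :
  coframe D r n U -> U q -> D q v -> tangent q v -> v r = 0 -> v n = 0 -> v = (fun=> 0).
Proof.
move=> [_ h] Uq Dv tv vr vn; apply: funext => f.
have [rf|nf] := pselect (reg f q); last by rewrite (tan_nreg tv nf).
have [_ _ /(_ f rf)[f1 [f2 [_ _ /(nb_in HX) /= ->]]]] := h q Uq; last by [].
by rewrite vr vn !mulr0 addr0.
Qed.

Lemma tower0 (p : monster S 0) : exists U r n inv, @tower 0 p U r n inv.
Proof.
have [U [x [y [Up hc hb]]]] := HB p.
exists U, (fun=> x), (fun=> y), (fun=> false); split=> //.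
- by move=> q i Uq _; have [_ /(_ q Uq)[]] := hc.
- move=> q v Uq tv vx vy _.
  exact: (coframe_kill HS hc Uq tv).
- by move=> i /andP[i2] /(leq_trans i2).
move=> R N hRN _ _ _.
have [hR hN] := hRN 0%N (leqnn _).
have [T [O [o [t [d [gam [h1 h2 h3]]]]]]] := hb _ _ hR hN.
exists T, O, o, t, d, gam; split=> // s Os; have [k1 k2 k3 k4] := h3 s Os.
split=> //; last by case.
apply: (pushforward_tangent HS) => //; exact: (pc_tan h1).
Qed.

Lemma towerS k : (forall p : monster S k, exists U r n inv, tower p U r n inv) ->
  forall p : monster S k.+1, exists U r n inv, tower p U r n inv.
Proof.
move=> IH p; set X := monster S k; set D := focal (d := X).
have HX : space_laws X := monster_laws k.
have HX1 : space_laws (monster S k.+1) := monster_laws k.+1.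
have Dtan := @monster_tangent k; have Dscale := @monster_scale k.
have [U [r [n [inv tw]]]] := IH (base p).
(* The new level is inverted exactly when d r_k vanishes on the line p. In that case d n_k does not,
   by the coframe property, and p lies in the affine chart with slope d r_k / d n_k. *)
have [b b1 b2] : exists2 b : bool, b -> forall v, line p v -> v (r k) = 0 &
    ~~ b -> exists2 v, line p v & v (r k) != 0.
  exists `[< forall v, line p v -> v (r k) = 0 >]; first by move/asboolP.
  by move/asboolP/existsNP => [v /not_implyP[lv /eqP vr]]; exists v.
pose rho := if b then n k else r k; pose del := if b then r k else n k.
have HU : coframe D rho del U.
  rewrite /rho /del; case: (b); last exact: (tw_frame tw).
  exact: (coframe_swap HX (tw_frame tw)).
have pU' : @step_set G X D rho U p.
  split; first exact: (tw_p tw).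
  have [hb|nb] := boolP b; last by have := b2 nb; rewrite /rho (negbTE nb).
  rewrite /rho hb; move/b1: hb => hb.
  have [v lv v0] := line_nz p; exists v => //; apply/eqP => vn.
  have Dv := line_focal Dscale lv.
  exact: v0 (coframe_kill HX (tw_frame tw) (tw_p tw) Dv (Dtan _ _ Dv) (hb v lv) vn).
pose bs := @base G X D.
pose r' i : monster S k.+1 -> K := if i == k.+1 then rho \o bs else r i \o bs.
pose n' i : monster S k.+1 -> K := if i == k.+1 then dquot (D := D) del rho else n i \o bs.
pose inv' i := if i == k.+1 then b else inv i.
have r'S : r' k.+1 = rho \o bs by rewrite /r' eqxx.
have n'S : n' k.+1 = dquot (D := D) del rho by rewrite /n' eqxx.
have r'i i : (i <= k)%N -> r' i = r i \o bs.
  by move=> ik; rewrite /r' ltn_eqF // ltnS.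
have n'i i : (i <= k)%N -> n' i = n i \o bs.
  by move=> ik; rewrite /n' ltn_eqF // ltnS.
have inv'S : inv' k.+1 = b by rewrite /inv' eqxx.
have inv'i i : (i <= k)%N -> inv' i = inv i.
  by move=> ik; rewrite /inv' ltn_eqF // ltnS.
have cof := step_coframe HG HX Dscale HU.
exists (@step_set G X D rho U), r', n', inv'; split=> //.
- by rewrite r'S n'S.
- move=> q i sq; have [Uq _] := sq; rewrite leq_eqVlt => /orP[/eqP->|ik].
    by rewrite r'S n'S; have [_ /(_ q sq)[]] := cof.
  rewrite r'i // n'i //; have [h1 h2] := tw_reg tw Uq ik.
  by split; apply: (proj_reg_base HG).
- move=> i; rewrite ltnS leq_eqVlt => /orP[/eqP->|ik].
    by rewrite r'S inv'S r'i // n'i // /rho; case: (b).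
  rewrite !r'i ?inv'i ?n'i ?(ltnW ik) // (tw_r tw ik).
  by case: (inv _).
- move=> q v i sq [tv lv]; have [Uq _] := sq.
  have Dv := line_focal Dscale lv.
  have pv f : reg f (bs q) -> v (f \o bs) =
      pushforward (X := monster S k.+1) (Y := X) bs q v f.
    by move=> rf; rewrite pushforwardE.
  rewrite ltnS leq_eqVlt => /orP[/eqP->|ik].
    have [_ /(_ _ Uq)[rr rd _]] := HU.
    rewrite inv'S r'i // n'i // r'S n'S.
    have -> : (if b then r k \o bs else n k \o bs) = del \o bs by rewrite /del; case: (b).
    by rewrite !pv //; exact: (line_slope _ sq lv).
  have [r1 r2] := tw_reg tw Uq (ltnW ik); have [r3 _] := tw_reg tw Uq ik.
  rewrite inv'i // r'i ?(ltnW ik) // (n'i i) ?(ltnW ik) // n'i // r'i //=.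
  have := tw_d tw Uq Dv ik; case: (inv _); by rewrite -!pv.
- move=> q v sq tv; have [Uq _] := sq; rewrite r'S n'S => vr vn hd.
  have pt := pushforward_tangent HX (proj_base_map HG HX q) tv.
  have pv f : reg f (bs q) -> v (f \o bs) =
      pushforward (X := monster S k.+1) (Y := X) bs q v f.
    by move=> rf; rewrite pushforwardE.
  apply: (step_kill HG HX Dscale HU sq tv _ vn).
  have [_ /(_ _ Uq)[rr rd _]] := HU.
  have pr : pushforward (X := monster S k.+1) (Y := X) bs q v rho = 0 by rewrite -pv.
  have pd : pushforward (X := monster S k.+1) (Y := X) bs q v del = 0.
    rewrite -pv //; have := hd k (leqnn _); rewrite inv'S r'i // n'i // r'S vr mulr0 /del.
    by case: (b).
  apply: (tw_kill tw Uq pt).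
  + by move: pr pd; rewrite /rho /del; case: (b).
  + by move: pr pd; rewrite /rho /del; case: (b).
  move=> i ik; have [r1 r2] := tw_reg tw Uq (ltnW ik); have [r3 _] := tw_reg tw Uq ik.
  have := hd i (ltnW ik).
  rewrite inv'i // r'i ?(ltnW ik) // (n'i i) ?(ltnW ik) // n'i // r'i //=.
  by case: (inv _); rewrite !pv.
(* A line on the new divisor at infinity is tangent to the fiber, where d r_k = 0 by [tw_fiber]; the
   inverted slope d r_k / d n_k is then 0. *)
- move=> q i sq /andP[i2]; have [Uq _] := sq; rewrite leq_eqVlt => /orP[/eqP->|ik].
    rewrite inv'S n'S /= eqxx /del /rho => hb; rewrite hb => vq.
    have [_ [v lv vr]] := sq; rewrite /rho hb in vr.
    rewrite (line_dquot _ lv vr).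
    by rewrite (tw_fiber tw Uq (vertical_fiber vq lv)) mul0r.
  rewrite inv'i // n'i //= ltn_eqF ?ltnS // => iv; apply: (tw_infty tw Uq) => //.
  by rewrite i2.
- move=> i /andP[i2]; rewrite leq_eqVlt => /orP[/eqP->|ik].
    rewrite inv'S /= eqxx => /b2[v lv vr] vq.
    by rewrite (tw_fiber tw (tw_p tw) (vertical_fiber vq lv)) eqxx in vr.
  rewrite inv'i //= ltn_eqF ?ltnS // => iv; apply: (tw_not_infty tw) => //.
  by rewrite i2.
- move=> q v sq /= pv; have [Uq _] := sq; have [_ /(_ _ Uq)[rr rd _]] := HU.
  rewrite r'S; have := congr1 (fun u : tvec X => u rho) pv.
  by rewrite pushforwardE.
move=> R N h1 h2 h3 h4.
have c1 i : (i <= k)%N -> (R i).[0] = r i (base p) /\ (N i).[0] = n i (base p).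
  by move=> ik; have := h1 i (leqW ik); rewrite r'i // n'i.
have c2 i : (i < k)%N -> R i.+1 = if inv i.+1 then N i else R i.
  by move=> ik; have := h2 i (ltnW ik); rewrite inv'i.
have c3 i : (i < k)%N -> (if inv i.+1 then R i else N i)^`() = N i.+1 * (R i.+1)^`().
  by move=> ik; have := h3 i (ltnW ik); rewrite inv'i.
(* This is the projection of the desired curve. It lifts through p because the derivative of the
   polynomial R_{k+1} has a finite order at 0. *)
have [T [O [o [t [d [gam [pc go hg]]]]]]] := tw_curve tw c1 c2 c3 (fun i ik => h4 i (leqW ik)).
have [a [Q [hQ1 hQ2]]] := h4 k.+1 (leqnn _).
have hr s : O s -> rho (gam s) = (R k.+1).[t s].
  move=> Os; have [_ _ _ /(_ k (leqnn _))[e1 e2]] := hg s Os.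
  by rewrite h2 // inv'S /rho; case: (b).
pose Dp := if b then R k else N k.
have hd s : O s -> del (gam s) = Dp.[t s].
  move=> Os; have [_ _ _ /(_ k (leqnn _))[e1 e2]] := hg s Os.
  by rewrite /del /Dp; case: (b).
have hDp : Dp^`() = N k.+1 * (R k.+1)^`().
  by have := h3 k (leqnn _); rewrite inv'S.
have hN0 : (N k.+1).[0] = dquot (D := D) del rho p.
  by have [_ ->] := h1 k.+1 (leqnn _); rewrite n'S.
have A1 s : O s -> regular_map gam s by move=> /hg[].
have A2 s : O s -> D (gam s) (pushforward (X := T) (Y := X) gam s (d s)) by move=> /hg[].
have A3 s : O s -> U (gam s) by move=> /hg[].
have [O' [gam' [OO pc' go' hg']]] :=
  step_curve HG HX Dtan Dscale HU pc A1 A2 A3 hr hd go pU' hDp hN0 hQ1 hQ2.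
exists T, O', o, t, d, gam'; split=> // s Os.
have [[e1 e2] e3 e4 e5] := hg' s Os.
split=> // i; rewrite leq_eqVlt => /orP[/eqP->|ik].
  by rewrite r'S n'S e3; split=> //; rewrite -hr -?e1 //; apply: OO.
by have [_ _ _ /(_ i ik)] := hg s (OO _ Os); rewrite -e1 r'i // n'i.
Qed.

Lemma tower_exists k (p : monster S k) : exists U r n inv, tower p U r n inv.
Proof. by elim: k p => [|k IH] p; [apply: tower0 | apply: towerS]. Qed.

End Tower.

(** * Nonholonomic order and brackets *)

Section Nord.
Variables (G : geometry) (HG : geometry_laws G).
Local Notation K := (gK G).
Variables (X : gspace G) (HX : space_laws X) (D : distribution X).
Hypothesis Dtan : forall q v, D q v -> tangent q v.
Variable p : X.

(* The nonholonomic order of f at p is at least m: f and all A_1 ... A_j f with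
   j < m and A_i sections of D vanish at p. *)
Fixpoint nord (m : nat) (f : X -> K) : Prop :=
  reg f p /\ (if m is m'.+1 then
    f p = 0 /\ forall A, section_of D p A -> nord m' (fun q => A q f) else True).

Lemma nord_reg m f : nord m f -> reg f p.
Proof. by case: m => [|m] []. Qed.

Lemma nord_value m f : nord m.+1 f -> f p = 0.
Proof. by move=> [_ []]. Qed.

Lemma section_tan A : section_of D p A ->
  nb p [set q | tangent q (A q) /\ forall f, reg f q -> reg (fun y => A y f) q].
Proof. by apply: (nbS HX) => q [/Dtan h1 h2]. Qed.

Lemma section_reg A f : section_of D p A -> reg f p -> reg (fun q => A q f) p.
Proof. by move=> /(nb_in HX)[_]; apply. Qed.

Lemma nord0 f : reg f p -> nord 0 f.
Proof. by []. Qed.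

Lemma nord_near m f g : nb p [set q | g q = f q] -> nord m f -> nord m g.
Proof.
elim: m f g => [|m IH] f g hfg [rf h].
  by split=> //; apply: (reg_eq HX rf).
have [f0 hA] := h; split; first exact: (reg_eq HX rf).
split; first by rewrite (nb_in HX hfg).
move=> A sA; apply: IH (hA A sA).
apply: (nbS HX) (nbI HX (section_tan sA) (nb_open HX hfg)) => q [[tA _] hq] /=.
exact: (tan_near_nreg HG HX tA).
Qed.

Lemma nord_zero m : nord m (fun=> 0).
Proof.
elim: m => [|m IH]; split=> //; try exact: (reg_cst HG HX).
split=> // A sA; apply: nord_near IH.
by apply: (nbS HX) (section_tan sA) => q [tA _] /=; rewrite (tan_cst HG HX tA).
Qed.

Lemma nord_le m m' f : (m' <= m)%N -> nord m f -> nord m' f.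
Proof.
elim: m m' f => [|m IH] [|m'] f //; first by move=> _ /nord_reg.
move=> le [rf [f0 hA]]; split=> //; split=> // A sA; exact: IH (hA A sA).
Qed.

Lemma nord_pred m f A : section_of D p A -> nord m f -> nord m.-1 (fun q => A q f).
Proof.
move=> sA; case: m => [|m] [rf h]; first by split=> //; apply: section_reg.
by case: h => _; apply.
Qed.

Lemma nord_add m f g : nord m f -> nord m g -> nord m (fun q => f q + g q).
Proof.
elim: m f g => [|m IH] f g [rf hf] [rg hg].
  by split=> //; apply: (reg_add HG HX).
have [f0 hfA] := hf; have [g0 hgA] := hg.
split; first exact: (reg_add HG HX).
split=> [|A sA]; first by rewrite f0 g0 addr0.
apply: nord_near (IH _ _ (hfA A sA) (hgA A sA)).
apply: (nbS HX) (nbI HX (section_tan sA) (nbI HX (reg_near HX rf) (reg_near HX rg))).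
by move=> q [[tA _] [rfq rgq]] /=; rewrite (tan_add HG HX tA).
Qed.

Lemma nord_mul a b f g : nord a f -> nord b g -> nord (a + b) (fun q => f q * g q).
Proof.
move Em : (a + b)%N => m; elim: m a b f g Em => [|m IH] a b f g Em hf hg.
  by split=> //; apply: (reg_mul HG HX); [apply: nord_reg hf|apply: nord_reg hg].
have rf := nord_reg hf; have rg := nord_reg hg.
split; first exact: (reg_mul HG HX).
split=> [|A sA].
  case: a Em hf => [|a] Em hf; last by rewrite (nord_value hf) mul0r.
  by case: b Em hg => [|b] // Em hg; rewrite (nord_value hg) mulr0.
(* Differentiating f costs one order of f if a > 0. If a = 0 it costs nothing, and the order of g
   alone suffices; the term with A g is symmetric. *)
have h1 : nord m (fun q => A q f * g q).
  case: a Em hf => [|a] Em hf.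
    rewrite add0n in Em.
    have := nord_pred sA hf => /= h.
    have hg' : nord m g by apply: nord_le hg; rewrite Em.
    exact: (IH 0%N m).
  by apply: (IH a b) => //; [move: Em; rewrite addSn => -[] | exact: (nord_pred sA hf)].
have h2 : nord m (fun q => f q * A q g).
  case: b Em hg => [|b] Em hg.
    rewrite addn0 in Em.
    have := nord_pred sA hg => /= h.
    have hf' : nord m f by apply: nord_le hf; rewrite Em.
    by apply: (IH m 0%N) => //; rewrite addn0.
  by apply: (IH a b) => //; [move: Em; rewrite addnS => -[] | exact: (nord_pred sA hg)].
apply: nord_near (nord_add h1 h2).
apply: (nbS HX) (nbI HX (section_tan sA) (nbI HX (reg_near HX rf) (reg_near HX rg))).
by move=> q [[tA _] [rfq rgq]] /=; rewrite (tan_mul HG HX tA).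
Qed.

Lemma nord_mulr m f g : reg f p -> nord m g -> nord m (fun q => f q * g q).
Proof. by move=> rf hg; have := nord_mul (nord0 rf) hg. Qed.

Lemma nord_exp s e : nord 1 s -> nord e (fun q => s q ^+ e).
Proof.
move=> hs; elim: e => [|e IH].
  split=> //; apply: (reg_eq HX) (reg_cst HG HX 1 p) _.
  by apply: (nb_refl HX) => q /=; rewrite expr0.
rewrite -add1n; apply: nord_near (nord_mul hs IH).
by apply: (nb_refl HX) => q /=; rewrite exprS.
Qed.

Lemma nord_sum m (I : Type) (s : seq I) (F : I -> X -> K) :
  (forall i, nord m (F i)) -> nord m (fun q => \sum_(i <- s) F i q).
Proof.
move=> h; elim: s => [|a s IH].
  by apply: nord_near (nord_zero m); apply: (nb_refl HX) => q /=; rewrite big_nil.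
apply: nord_near (nord_add (h a) IH).
by apply: (nb_refl HX) => q /=; rewrite big_cons.
Qed.

End Nord.

(** * Vector fields, their brackets and the stalks of the growth sheaves *)

Section Fields.
Variables (G : geometry) (HG : geometry_laws G).
Local Notation K := (gK G).
Variables (X : gspace G) (HX : space_laws X).

Lemma tangentD (q : X) (u v : tvec X) : tangent q u -> tangent q v ->
  tangent q (fun f => u f + v f).
Proof.
move=> hu hv.
have := @tan_lin G X q 2 (fun=> 1) (fun i => if i == 0 then u else v).
rewrite (_ : (fun f => _) = (fun f => u f + v f)); last first.
  by apply: funext => f; rewrite big_ord_recl big_ord1 !mul1r.
by apply=> i; case: ifP.
Qed.

(** The first sum is the Hessian of F applied to A g and B g. By [gpd_sym] it is symmetric in A and
    B, so it cancels in the bracket and leaves the chain rule for a tangent vector. *)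
Lemma bracket_second (q : X) (A B : vfield X) n (g : 'I_n -> X -> K) F f :
  tangent q (A q) ->
  nb q [set y | tangent y (B y) /\ forall f, reg f y -> reg (fun z => B z f) y] ->
  (forall i, reg (g i) q) -> greg F (tuple_map g q) ->
  nb q [set y | f y = F (tuple_map g y)] ->
  A q (fun y => B y f) =
    \sum_i (\sum_l gpd (fun y => gpd F y i) (tuple_map g q) l * A q (g l)) * B q (g i) +
    \sum_i gpd F (tuple_map g q) i * A q (fun y => B y (g i)).
Proof.
move=> tA hB rg rF hf.
have rBg i : reg (fun y => B y (g i)) q by have [_ h] := nb_in HX hB; apply: h.
have rpd i : reg (fun y => gpd F (tuple_map g y) i) q.
  exact: (reg_comp HX rg (gpd_reg HG i rF)).
have E : nb q [set y | B y f = \sum_i gpd F (tuple_map g y) i * B y (g i)].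
  have h1 := nb_forall HX (fun i => reg_near HX (rg i)).
  have h2 := reg_cts HX rg (greg_near HG rF).
  apply: (nbS HX) (nbI HX (nbI HX hB (nb_open HX hf)) (nbI HX h1 h2)).
  by move=> y [[[tB _] hy] [k1 k2]] /=; apply: (tan_comp tB).
rewrite (tan_near_nreg HG HX tA E) (tan_sum HG HX tA); last first.
  by move=> i; apply: (reg_mul HG HX).
rewrite -big_split /=; apply: eq_bigr => i _.
rewrite (tan_mul HG HX tA) //; congr (_ * _ + _).
apply: (tan_comp tA rg (gpd_reg HG i rF)); exact: (nb_refl HX).
Qed.

Lemma bracket_section (p : X) (A B : vfield X) :
  section_of (@tangent G X) p A -> section_of (@tangent G X) p B ->
  section_of (@tangent G X) p (bracket A B).
Proof.
move=> hA hB; have hA' := nb_open HX hA; have hB' := nb_open HX hB.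
apply: (nbS HX) (nbI HX hA' hB') => q [nA nB].
have [tA rA] := nb_in HX nA; have [tB rB] := nb_in HX nB.
have breg f : reg f q -> bracket A B q f = A q (fun y => B y f) - B q (fun y => A y f).
  by move=> rf; rewrite /bracket asboolT.
split; last first.
  move=> f rf.
  have h : reg (fun y => A y (fun z => B z f) - B y (fun z => A z f)) q.
    by apply: (reg_sub HG HX); [apply: rA; apply: rB|apply: rB; apply: rA].
  apply: (reg_eq HX h); apply: (nbS HX) (reg_near HX rf) => y ry /=.
  by rewrite /bracket asboolT.
split=> [f nf|n g F f rg rF hf]; first by rewrite /bracket asboolF.
have rf : reg f q by apply: (reg_eq HX) (reg_comp HX rg rF) _.
rewrite breg //.
rewrite (bracket_second tA nB rg rF hf) (bracket_second tB nA rg rF hf).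
under [RHS]eq_bigr => i _ do rewrite breg // mulrBr.
rewrite [RHS]sumrB opprD addrACA -[RHS]add0r; congr (_ + _).
apply/eqP; rewrite subr_eq0; apply/eqP.
under eq_bigr => i _ do rewrite mulr_suml.
rewrite exchange_big; apply: eq_bigr => i _ /=; rewrite mulr_suml.
apply: eq_bigr => j _; rewrite (gpd_sym HG) //; ring.
Qed.

Lemma growth_section (D : distribution X) (Dtan : forall q v, D q v -> tangent q v)
  (p : X) h V : small_growth_stalk D h p V -> section_of (@tangent G X) p V.
Proof.
have DT A : section_of D p A -> section_of (@tangent G X) p A.
  by apply: (nbS HX) => q [/Dtan].
elim: h V => [|h IH] V /=; first exact: DT.
move=> [n [c [A [B [V' [rc sA sB sV' hV]]]]]].
have bs i := bracket_section (DT _ (sA i)) (IH _ (sB i)).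
apply: (nbS HX) (nbI HX (nbI HX (IH _ sV') (nb_open HX hV))
  (nbI HX (nb_forall HX bs) (nb_forall HX (fun i => reg_near HX (rc i))))).
move=> q [[[tV' rV'] hq] [hb hc]]; split.
  rewrite (_ : V q = (fun f => V' q f + \sum_i c i q * bracket (A i) (B i) q f)).
    by apply: tangentD => //; apply: tan_lin => i; case: (hb i).
  by apply: funext => f; rewrite (nb_in HX hq).
move=> f rf.
apply: (reg_eq HX) (reg_add HG HX (rV' f rf)
  (@reg_sum _ HG _ HX _ (index_enum _) xpredT (fun i y => c i y * bracket (A i) (B i) y f) q _)) _.
  by move=> i _; apply: (reg_mul HG HX); [exact: hc | case: (hb i) => _; apply].
by apply: (nbS HX) hq => y /= ->.
Qed.

End Fields.

(** * Polynomial curves determined from the top level downwards *)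

Section CurvePolys.
Variable K : fieldType.
Hypothesis char0 : forall n, n.+1%:R != 0 :> K.

Definition ordp (P : {poly K}) (a : nat) := exists Q, P = 'X^a * Q /\ Q.[0] != 0.

Lemma ordp_coef P a : ordp P a <-> (forall i, (i < a)%N -> P`_i = 0) /\ P`_a != 0.
Proof.
split=> [[Q [-> Q0]]|[h1 h2]].
  split=> [i ia|]; rewrite coefXnM; first by rewrite ia.
  by rewrite ltnn subnn -horner_coef0.
exists (drop_poly a P); split; last by rewrite horner_coef0 coef_drop_poly add0n.
rewrite mulrC; apply/polyP => i; rewrite coefMXn.
case: ifP => ia; first by rewrite h1.
by rewrite coef_drop_poly subnK // leqNgt ia.
Qed.

Lemma ordpM P Q a b : ordp P a -> ordp Q b -> ordp (P * Q) (a + b).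
Proof.
move=> [P1 [-> h1]] [Q1 [-> h2]]; exists (P1 * Q1); split.
  by rewrite exprD; ring.
by rewrite hornerM mulf_neq0.
Qed.

Definition primitive (P : {poly K}) : {poly K} :=
  \poly_(i < (size P).+1) (P`_i.-1 / i%:R *+ (i != 0)).

Lemma coef_primitive P i : (primitive P)`_i.+1 = P`_i / i.+1%:R.
Proof.
rewrite coef_poly ltnS; case: ltnP => h //=.
by rewrite nth_default // mul0r.
Qed.

Lemma primitive0 P : (primitive P).[0] = 0.
Proof. by rewrite horner_coef0 coef_poly. Qed.

Lemma deriv_primitive P : (primitive P)^`() = P.
Proof.
apply/polyP => i; rewrite coef_deriv coef_primitive -(mulr_natr (_ / _)).
by rewrite divfK.
Qed.

(** The coefficients are shifted by one place and divided by nonzero integers, so the order rises by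
    exactly one. *)
Lemma ordp_primitive P a : ordp P a -> ordp (primitive P) a.+1.
Proof.
move=> /ordp_coef[h1 h2]; apply/ordp_coef; split=> [[|i] ia|].
- by rewrite -horner_coef0 primitive0.
- by rewrite coef_primitive h1 // mul0r.
- by rewrite coef_primitive mulf_neq0 // invr_eq0.
Qed.

Variables (k : nat) (inv : nat -> bool) (rp np : nat -> K).
Hypothesis rpS : forall i, (i < k)%N -> rp i.+1 = if inv i.+1 then np i else rp i.

(** The order of N at t = 0 when N(0) = c and N - c has order mu. *)
Definition next_weight (c : K) (mu : nat) := if c == 0 then mu else 0%N.

(* The curve whose coordinates at level k are r_k(p) + t and n_k(p) + t, descended
   to the lower levels by quadratures.  In a state, [csa] is the order of
   vanishing of R' and [csm] that of N - N(0). *)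
Record curve_state := CurveState {
  csR : {poly K} ; csN : {poly K} ; csa : nat ; csm : nat }.

(** The integrated coordinate satisfies d_i' = N_{i+1} R_{i+1}', of order w + [csa s]. Without
    inversion it is N_i, and R_i = R_{i+1}. With an inversion it is R_i, while N_i = R_{i+1} minus
    its constant has order [(csa s).+1]. *)
Definition curve_step (i : nat) (s : curve_state) : curve_state :=
  let w := next_weight (np i.+1) (csm s) in
  let P := primitive (csN s * (csR s)^`()) in
  if inv i.+1 then CurveState ((rp i)%:P + P) (csR s) (w + csa s) (csa s).+1
  else CurveState (csR s) ((np i)%:P + P) (csa s) (w + csa s).+1.

Fixpoint curve_rec (m : nat) : curve_state :=
  if m is m'.+1 then curve_step (k - m) (curve_rec m')
  else CurveState ((rp k)%:P + 'X) ((np k)%:P + 'X) 0 1.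

Definition curve_at i := curve_rec (k - i).

Lemma curve_at_top : curve_at k = CurveState ((rp k)%:P + 'X) ((np k)%:P + 'X) 0 1.
Proof. by rewrite /curve_at subnn. Qed.

Lemma curve_atS i : (i < k)%N -> curve_at i = curve_step i (curve_at i.+1).
Proof.
move=> ik; rewrite /curve_at -(subnSK ik) /= subnSK // subKn //; exact: ltnW.
Qed.

Lemma curve_ind (P : nat -> Prop) : P k -> (forall i, (i < k)%N -> P i.+1 -> P i) ->
  forall i, (i <= k)%N -> P i.
Proof.
move=> hk hS i ik; rewrite -(subKn ik); elim: (k - i)%N => [|m IH]; first by rewrite subn0.
have [h|h] := ltnP m k; last by have -> : (k - m.+1 = k - m)%N by lia.
by apply: hS; [lia | rewrite subnSK].
Qed.

Lemma curve_at_values i : (i <= k)%N ->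
  [/\ (csR (curve_at i)).[0] = rp i, (csN (curve_at i)).[0] = np i,
     ordp (csR (curve_at i))^`() (csa (curve_at i)) &
     ordp (csN (curve_at i) - (np i)%:P) (csm (curve_at i))].
Proof.
apply: (curve_ind (P := fun i => [/\ (csR (curve_at i)).[0] = rp i, (csN (curve_at i)).[0] = np i,
     ordp (csR (curve_at i))^`() (csa (curve_at i)) &
     ordp (csN (curve_at i) - (np i)%:P) (csm (curve_at i))])).
  rewrite curve_at_top /= !hornerD !hornerC hornerX !addr0; split=> //.
    by exists 1; rewrite derivD derivC derivX add0r expr0 mul1r hornerC oner_eq0.
  exists 1; rewrite hornerC oner_eq0; split=> //; by rewrite mulr1 addrAC subrr add0r expr1.
move=> {}i ik [h1 h2 h3 h4]; rewrite curve_atS //.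
set s := curve_at i.+1 in h1 h2 h3 h4 *.
have hw : ordp (csN s) (next_weight (np i.+1) (csm s)).
  rewrite /next_weight; case: eqP => [E|/eqP E]; first by move: h4; rewrite E subr0.
  by exists (csN s); rewrite expr0 mul1r h2.
have hP := ordp_primitive (ordpM hw h3).
rewrite /curve_step; have := rpS ik; case: (inv i.+1) => rE /=.
  rewrite hornerD hornerC primitive0 addr0 h1 rE; split=> //.
    by rewrite derivD derivC add0r deriv_primitive; apply: ordpM.
  suff -> : csR s - (np i)%:P = primitive (csR s)^`() by exact: ordp_primitive.
  apply/polyP => -[|j]; rewrite coefB coefC /=.
    by rewrite -!horner_coef0 primitive0 h1 rE subrr.
  by rewrite subr0 coef_primitive coef_deriv -(mulr_natr (csR s)`_j.+1) mulfK.
rewrite hornerD hornerC primitive0 addr0 h1 rE; split=> //.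
by rewrite addrAC subrr add0r.
Qed.

Lemma curve_at_weight i : (i <= k)%N ->
  ordp (csN (curve_at i)) (next_weight (np i) (csm (curve_at i))).
Proof.
move=> ik; have [h1 h2 h3 h4] := curve_at_values ik.
rewrite /next_weight; case: eqP => [E|/eqP E]; first by move: h4; rewrite E subr0.
by exists (csN (curve_at i)); rewrite expr0 mul1r h2.
Qed.

Lemma curve_at_R i : (i < k)%N ->
  csR (curve_at i.+1) = if inv i.+1 then csN (curve_at i) else csR (curve_at i).
Proof. by move=> ik; rewrite (curve_atS ik) /curve_step; case: (inv _). Qed.

Lemma curve_at_deriv i : (i < k)%N ->
  (if inv i.+1 then csR (curve_at i) else csN (curve_at i))^`() =
  csN (curve_at i.+1) * (csR (curve_at i.+1))^`().
Proof.
move=> ik; rewrite (curve_atS ik) /curve_step; case: (inv _) => /=;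
by rewrite derivD derivC add0r deriv_primitive.
Qed.

End CurvePolys.

(** * The growth bounds *)

Section Numbers.
Variables (k : nat) (VO : nat -> nat).

Lemma b_num2 : b_num k VO 2 = 2.
Proof. by rewrite /b_num /vo_sum big_geq ?addn0 //; lia. Qed.

(** Passing from i to i+1 raises by one the coefficient of each VO_l already present, and
    VO_{k+3-i}, whose coefficient was 0, enters with coefficient 1. The successor is the growth of
    the summand i. This difference is what the last term of [om_bracket] costs. *)
Lemma b_numS i : (2 <= i)%N -> (i <= k)%N ->
  b_num k VO i.+1 = (b_num k VO i + (\sum_(k + 3 - i <= l < k.+1) VO l).+1)%N.
Proof.
move=> i2 ik; rewrite /b_num /vo_sum.
have -> : (k + 4 - i.+1 = k + 3 - i)%N by lia.
suff -> : (\sum_(k + 3 - i <= j < k.+1) (i.+1 + j - (k + 3)) * VO j =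
  \sum_(k + 4 - i <= j < k.+1) (i + j - (k + 3)) * VO j +
  \sum_(k + 3 - i <= l < k.+1) VO l)%N by lia.
have [h|h] := ltnP (k + 3 - i) k.+1; last by rewrite !big_geq //; lia.
have -> : (k + 4 - i = (k + 3 - i).+1)%N by lia.
have -> : (\sum_((k + 3 - i).+1 <= j < k.+1) (i + j - (k + 3)) * VO j =
  \sum_(k + 3 - i <= j < k.+1) (i + j - (k + 3)) * VO j)%N.
  by rewrite [RHS]big_ltn // (_ : i + (k + 3 - i) - (k + 3) = 0)%N //; lia.
rewrite -big_split /= big_nat_cond [RHS]big_nat_cond; apply: eq_bigr => j /andP[/andP[h1 h2] _].
by rewrite -[X in (_ = _ + X)%N]mul1n -mulnDl; congr (_ * _)%N; lia.
Qed.

Lemma b_num_lt i j : (2 <= i)%N -> (i <= j)%N -> (j <= k.+1)%N ->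
  (b_num k VO i <= b_num k VO j)%N.
Proof.
move=> i2; elim: j => [|j IH]; first by lia.
rewrite leq_eqVlt => /orP[/eqP->//|ij] jk.
by rewrite b_numS; [have := IH _ _; lia | lia | lia].
Qed.

(** For i at most h, b_i <= h forces e_{hi} = 0. The indices i > h contribute nothing on the left,
    since b_i is at least i. *)
Lemma e_num_count h : (2 <= h)%N ->
  (\sum_(2 <= i < k.+2) (b_num k VO i <= h) <=
   count (fun i => e_num k VO h i == 0) (index_iota 2 (minn h k.+1).+1))%N.
Proof.
move=> h2; rewrite -sum1_count [leqRHS]big_mkcond /=.
have hm : (2 <= (minn h k.+1).+1)%N by rewrite ltnS leq_min; lia.
rewrite (@big_cat_nat _ _ _ (minn h k.+1).+1) //=; last by rewrite ltnS geq_minr.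
rewrite [X in (_ + X)%N]big_nat_cond [X in (_ + X)%N]big1 ?addn0; last first.
  move=> i /andP[/andP[h3 h4] _]; apply/eqP; rewrite eqb0 -ltnNge /b_num; lia.
rewrite big_nat_cond [leqRHS]big_nat_cond; apply: leq_sum => i /andP[/andP[h3 h4] _].
case: (leqP (b_num k VO i) h) => //= h5.
by have -> : e_num k VO h i == 0%N by move: h5; rewrite /e_num /b_num; lia.
Qed.

End Numbers.

Section Growth.
Variables (G : geometry) (HG : geometry_laws G).
Local Notation K := (gK G).
Variables (S : gspace G) (HS : space_laws S).
Hypothesis HB : forall p : S, exists (U : set S) (x y : S -> K),
  [/\ U p, coframe (@tangent G S : distribution S) x y U & base_curves p U x y].
Variables (k : nat) (p : monster S k) (VO : nat -> nat).
Hypothesis hVO : forall j, (2 <= j <= k)%N -> vertical_order p j (VO j).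
Local Notation X := (monster S k).
Local Notation D := (focal (d := monster S k)).
Let HX : space_laws X := monster_laws HG HS k.
Let Dtan : forall q v, D q v -> tangent q v := @monster_tangent G S k.

(** Iterating d turns P(t) into the derivatives of P, whose values at 0 are the coefficients times
    factorials, and these are invertible in characteristic 0. *)
Lemma nord_curve (T : gspace G) (N : set T) o t d (P : {poly K}) m :
  param_curve N o t d ->
  nord (@tangent G T) o m (fun s => P.[t s]) -> forall i, (i < m)%N -> P`_i = 0.
Proof.
move=> pc; have HT := manifold_laws HG (pc_manifold pc).
have Ttan : forall (q : T) v, tangent q v -> tangent q v by [].
have sd : section_of (@tangent G T) o d.
  apply: (nbS HT) (pc_open pc (pc_o pc)) => s Ns; split; first exact: (pc_tan pc).
  by move=> f; apply: (pc_field pc).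
elim: m P => [|m IH] P // hP [_|i im].
  by have := nord_value hP; rewrite (pc_to pc) horner_coef0.
have [_ [_ /(_ _ sd) hd]] := hP.
have hd' : nord (@tangent G T) o m (fun s => P^`().[t s]).
  apply: (nord_near HG HT Ttan) hd.
  apply: (nbS HT) (pc_open pc (pc_o pc)) => s Ns /=.
  by rewrite (tan_horner HG HT (pc_tan pc Ns) _ (pc_reg pc Ns)) (pc_unit pc Ns) mulr1.
have := IH _ hd' i im; rewrite coef_deriv -(mulr_natr P`_i.+1) => /eqP.
by rewrite mulf_eq0 (negbTE (gchar0 HG i)) orbF => /eqP.
Qed.

Section WithTower.
Variables (U : set X) (r n : nat -> X -> K) (inv : nat -> bool).
Hypothesis tw : tower p U r n inv.
Let Up := tw_p tw.
Let Unb : nb p U. Proof. by have [h _] := tw_frame tw; apply: h. Qed.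

Let rp i := r i p.
Let np i := n i p.

Let rpS i : (i < k)%N -> rp i.+1 = if inv i.+1 then np i else rp i.
Proof. by move=> ik; rewrite /rp (tw_r tw ik) /np; case: (inv _). Qed.

Local Notation cs := (curve_at k inv rp np).
Local Notation wt i := (next_weight (np i) (csm (cs i))).

Let dd i := if inv i.+1 then r i else n i.

Let dd_reg q i : U q -> (i < k)%N -> reg (dd i) q.
Proof.
move=> Uq ik; have [h1 h2] := tw_reg tw Uq (ltnW ik).
by rewrite /dd; case: (inv _).
Qed.

Lemma section_dd A i : section_of D p A -> (i < k)%N ->
  nb p [set q | A q (dd i) = n i.+1 q * A q (r i.+1)].
Proof.
move=> sA ik; apply: (nbS HX) (nbI HX Unb sA) => q [Uq [Dq _]].
exact: (tw_d tw Uq Dq ik).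
Qed.

(** This is the recursion of [curve_step] with d/dt replaced by an arbitrary section A: in A d_i =
    n_{i+1} (A r_{i+1}) orders add up, and a function has one order more than its derivatives along
    D. At level k the bounds 0 and 1 hold trivially, and they are the orders with which the curve
    starts. *)
Lemma tower_nord i : (i <= k)%N ->
  (forall A, section_of D p A -> nord D p (csa (cs i)) (fun q => A q (r i))) /\
  nord D p (csm (cs i)) (fun q => n i q - np i).
Proof.
have HN := nord_near HG HX Dtan.
have hn j m : (j <= k)%N -> nord D p m (fun q => n j q - np j) ->
    nord D p (next_weight (np j) m) (n j).
  move=> jk h; rewrite /next_weight; case: eqP => [E|_].
    by apply: HN h; apply: (nb_refl HX) => q /=; rewrite E subr0.
  by apply: nord0; have [] := tw_reg tw Up jk.
have hc f m : reg f p -> (forall A, section_of D p A -> nord D p m (fun q => A q f)) ->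
    nord D p m.+1 (fun q => f q - f p).
  move=> rf hf; split; first exact: (reg_sub HG HX rf (reg_cst HG HX _ _)).
  rewrite subrr; split=> // A sA; apply: HN (hf A sA).
  apply: (nbS HX) (nbI HX (section_tan HX Dtan sA) (reg_near HX rf)) => q [[tA _] rq] /=.
  by rewrite (tan_sub HG HX tA) ?(tan_cst HG HX tA) ?subr0 //; apply: (reg_cst HG HX).
move: i; apply: curve_ind.
  have [h1 h2] := tw_reg tw Up (leqnn k).
  rewrite curve_at_top; split=> [A sA|]; first by split=> //; apply: (section_reg HX sA h1).
  by apply: (hc (n k) 0%N) => // A sA; split=> //; apply: (section_reg HX sA h2).
move=> i ik [h1 h2]; rewrite curve_atS //.
set s := cs i.+1 in h1 h2 *.
have hw := hn _ _ ik h2.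
have hd A : section_of D p A ->
    nord D p (next_weight (np i.+1) (csm s) + csa s) (fun q => A q (dd i)).
  move=> sA; apply: HN (nord_mul HG HX Dtan hw (h1 A sA)).
  by apply: (section_dd sA ik).
have [h3 h4] := tw_reg tw Up (ltnW ik).
rewrite /curve_step; have := hd; have := tw_r tw ik; rewrite /dd.
case: (inv i.+1) => rE hd' /=; split=> //.
- apply: (hc (n i) (csa s)) => // A sA.
  by rewrite -rE; apply: h1.
- by move=> A sA; rewrite -rE; apply: h1.
- exact: (hc (n i)).
Qed.

Lemma VO_le l : (2 <= l <= k)%N -> inv l -> (VO l <= wt l)%N.
Proof.
move=> hl il; have /andP[l2 lk] := hl.
have [[pI [a [ra _ ha] [hfoc _]]]|[_ ->]//] := hVO hl.
have [T [O [o [t [d [gam [pc go hg]]]]]]] := tw_curve tw (R := fun i => csR (cs i)) (N := fun i => csN (cs i))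
  (fun i ik => let: And4 a b _ _ := curve_at_values (gchar0 HG) rpS ik in conj a b)
  (fun i ik => curve_at_R inv rp np ik)
  (fun i ik => curve_at_deriv (gchar0 HG) inv rp np ik)
  (fun i ik => let: And4 _ _ c _ := curve_at_values (gchar0 HG) rpS ik in ex_intro _ _ c).
have HT := manifold_laws HG (pc_manifold pc).
have Oo := pc_o pc; have nO := pc_open pc Oo.
have Ttan : forall (q : T) v, tangent q v -> tangent q v by [].
have fc : focal_curve D p o gam.
  split=> //; first exact: (pc_manifold pc).
  - by apply: (nbS HT) nO => s /hg[].
  (* The curve is nonsingular because r_k - r_k(p) = t along it. *)
  - exists (d o); first exact: (pc_tan pc).
    have [[_ rg] _ Ug /(_ k (leqnn _))[E _]] := hg o Oo.
    move/(congr1 (fun u : tvec X => u (r k))).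
    have [rr _] := tw_reg tw Ug (leqnn k).
    rewrite pushforwardE // => E0.
    have ro := pc_reg pc Oo.
    have E1 : d o (r k \o gam) = (csR (cs k))^`().[t o].
      rewrite (tan_near HG HT (pc_tan pc Oo) (g := fun s => (csR (cs k)).[t s])).
      - by rewrite (tan_horner HG HT (pc_tan pc Oo)) // (pc_unit pc Oo) mulr1.
      - exact: (reg_horner HG HT).
      - by apply: (nbS HT) nO => s /hg[_ _ _ /(_ k (leqnn _))[]].
    move: E0; rewrite E1 curve_at_top /= derivD derivC derivX add0r hornerC.
    by move/eqP; rewrite oner_eq0.
  - apply: (nbS HT) nO => s Os v tv; rewrite (pc_span pc Os tv) pushforward_scale.
    by apply: monster_scale; have [] := hg s Os.
have [s [u [[rs s0 _] ru hs]]] := hfoc _ _ _ fc.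
have [rnl _] : reg (n l) p /\ True by have [] := tw_reg tw Up lk.
have [c [rc hc]] := ha (n l) rnl (nbS HX (fun q Uq => tw_infty tw Uq hl il) Unb).
have [[gc gr] _ _ _] := hg o Oo; rewrite go in gc gr.
(* The order of the local equation is given in terms of some local parameter s, that of n_l in terms
   of t. They are compared through the nonholonomic order on T itself: s vanishes at o, so any
   regular multiple of s^VO_l has order at least VO_l. *)
have hN : nord (@tangent G T) o (VO l) (fun y => (csN (cs l)).[t y]).
  have h1 : nord (@tangent G T) o 1 s by split=> //; split=> // A sA; apply: nord0; apply: (section_reg HT sA rs).
  have h2 := nord_mulr HG HT Ttan (gr c rc)
    (nord_mulr HG HT Ttan ru (nord_exp HG HT Ttan (VO l) h1)).
  apply: (nord_near HG HT Ttan) h2.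
  apply: (nbS HT) (nbI HT nO (nbI HT (gc _ hc) hs)) => y [Oy [/= h3 h4]].
  have [_ _ _ /(_ l lk)[_ <-]] := hg y Oy.
  by rewrite h3 /= in h4 *; rewrite h4 [u y * _]mulrC.
have /ordp_coef[_ hw] := curve_at_weight (gchar0 HG) rpS lk.
rewrite leqNgt; apply/negP => lw.
by rewrite (nord_curve pc hN lw) eqxx in hw.
Qed.

(** Each inverted level adds to [csa] the weight of n_{i+1}, which is at least VO_{i+1}. At a level
    that is not inverted p lies off the divisor, and VO_{i+1} = 0. *)
Lemma csa_ge i : (1 <= i)%N -> (i <= k)%N ->
  (\sum_(i.+1 <= l < k.+1) VO l <= csa (cs i))%N.
Proof.
move=> i1 ik; move: i1; move: i ik; apply: curve_ind; first by rewrite big_geq.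
move=> i ik IH i1; rewrite big_ltn // curve_atS // /curve_step.
have hl : (2 <= i.+1 <= k)%N by rewrite ltnS i1.
case E: (inv i.+1) => /=; first by apply: leq_add; [apply: VO_le | apply: IH].
have [[pI _]|[_ ->]] := hVO hl; last by rewrite add0n; apply: IH.
by case: (tw_not_infty tw hl (negbT E)).
Qed.

Lemma section_r_nord A i : section_of D p A -> (1 <= i)%N -> (i <= k)%N ->
  nord D p (\sum_(i.+1 <= l < k.+1) VO l) (fun q => A q (r i)).
Proof.
move=> sA i1 ik; apply: (nord_le (csa_ge i1 ik)).
by have [h _] := tower_nord ik; apply: h.
Qed.

(* The contact forms cutting out D.  By [om_bracket] a bracket with a section A
   costs one order for om_i V, unless om_{i+1} V, multiplied by A r_{i+2}, has a
   smaller order. *)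
Definition om i (V : vfield X) q := V q (dd i) - n i.+1 q * V q (r i.+1).

Lemma om_reg i V : (i < k)%N -> section_of (@tangent G X) p V -> reg (om i V) p.
Proof.
move=> ik sV; have [_ hV] := nb_in HX sV.
have [r1 r2] := tw_reg tw Up ik.
apply: (reg_sub HG HX); first by apply: hV; apply: dd_reg.
by apply: (reg_mul HG HX) => //; apply: hV.
Qed.

(** Differentiating A d_i = n_{i+1} (A r_{i+1}) along B leaves the error term (A n_{i+1})(B r_{i+1})
    - (B n_{i+1})(A r_{i+1}). One of these two coordinates is r_{i+2} and the other is [dd i.+1],
    whose derivative along A is n_{i+2} (A r_{i+2}). Which is which decides the sign. *)
Lemma om_bracket i A B : (i.+1 < k)%N -> section_of D p A ->
  section_of (@tangent G X) p B ->
  nb p [set q | om i (bracket A B) q = A q (fun y => om i B y) +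
    (-1) ^+ (~~ inv i.+2) * (A q (r i.+2) * om i.+1 B q)].
Proof.
move=> ik sA sB.
have h1 := nb_open HX (section_dd sA (ltnW ik)).
have h2 := section_dd sA ik.
have h3 := nb_open HX sB.
apply: (nbS HX) (nbI HX (nbI HX Unb sA) (nbI HX (nbI HX h1 h2) h3)).
move=> q [[Uq [Dq rA]] [[e1 e2] e3]].
have tA := Dtan Dq; have [tB rB] := nb_in HX e3.
have [rr rn] := tw_reg tw Uq (ltnW ik); have rd := dd_reg Uq (ltnW ik).
rewrite /= /om /bracket !asboolT //.
rewrite (tan_near_nreg HG HX tB (g := fun y => n i.+1 y * A y (r i.+1)) e1).
rewrite (tan_mul HG HX tB) //; last exact: rA.
rewrite (tan_sub HG HX tA); last 2 first.
- exact: rB.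
- by apply: (reg_mul HG HX) => //; apply: rB.
rewrite (tan_mul HG HX tA) //; last exact: rB.
move: e2; rewrite /= /dd (tw_r tw ik).
by case: (inv i.+2) => /= e2; rewrite ?expr0 ?expr1 e2; ring.
Qed.

Lemma growth_nord h V : small_growth_stalk D h p V ->
  forall i, (i < k)%N -> nord D p (b_num k VO (k - i).+1 - h.+1) (om i V).
Proof.
have HN := nord_near HG HX Dtan.
elim: h V => [|h IH] V.
  move=> sV i ik; apply: HN (nord_zero HG HX Dtan p _).
  by apply: (nbS HX) (section_dd sV ik) => q /= e; rewrite /om e subrr.
move=> hV i ik; have sV := growth_section HG HX Dtan hV.
have [i1k|i1k] := ltnP i.+1 k; last first.
  (* For the top form, i = k-1, the bound is b_2 = 2, so only order 0 is claimed from Delta^2 on. *)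
  have -> : (k - i).+1 = 2 by lia.
  by rewrite b_num2 (_ : 2 - h.+2 = 0)%N //; apply: nord0; apply: om_reg.
case: hV => m [c [A [B [V' [rc sA sB sV' hV]]]]].
have h0 : nord D p (b_num k VO (k - i).+1 - h.+2) (om i V').
  by apply: nord_le (IH _ sV' i ik); lia.
have sB' j := growth_section HG HX Dtan (sB j).
have h1 j : nord D p (b_num k VO (k - i).+1 - h.+2) (om i (bracket (A j) (B j))).
  apply: HN (om_bracket i1k (sA j) (sB' j)) _.
  apply: (nord_add HG HX Dtan).
    have hp := nord_pred HX (sA j) (IH _ (sB j) i ik).
    by apply: nord_le hp; lia.
  apply: (nord_mulr HG HX Dtan); first exact: (reg_cst HG HX).
  have hr := @section_r_nord _ i.+2 (sA j) isT i1k.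
  have ho := IH _ (sB j) i.+1 i1k.
  apply: nord_le (nord_mul HG HX Dtan hr ho).
  (* The two factors have orders sum_{l >= i+3} VO_l and b_{k-i} - (h+1). By [b_numS] these add up
     to at least b_{k-i+1} - (h+2), as required. *)
  have -> : ((k - i).+1 = (k - i.+1).+1.+1)%N by lia.
  rewrite (@b_numS k VO (k - i.+1).+1); try lia.
  have -> : (k + 3 - (k - i.+1).+1 = i.+3)%N by lia.
  lia.
apply: HN (nord_add HG HX Dtan h0 (nord_sum HG HX Dtan (index_enum _)
  (fun j => nord_mulr HG HX Dtan (rc j) (h1 j)))).
apply: (nbS HX) hV => q /= hq; rewrite /om !hq mulrDr mulr_sumr opprD addrACA -sumrB.
by congr (_ + _); apply: eq_bigr => j _; rewrite mulrBr mulrCA.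
Qed.

(** By [tw_kill] a tangent vector at p is determined by its values on d r_k, d n_k and all om_i. On
    Delta^h only the om_i with b_{k-i+1} <= h survive, so more independent vectors than there are
    surviving forms would have a nontrivial combination killed by every form. *)
Lemma SG_bound h : (1 <= h)%N ->
  (SG p h <= 2 + \sum_(2 <= i < k.+2) (b_num k VO i <= h))%N.
Proof.
move=> h1; rewrite /SG; case: xgetP => // m _ [u [uE uI _]].
rewrite leqNgt; apply/negP => hm.
(* The forms that may be nonzero on Delta^h. As i runs over 0, ..., k-1, the index k-i+1 runs over
   k+1, ..., 2. *)
pose J : {set 'I_k} := finset (fun i : 'I_k => (b_num k VO (k - i).+1 <= h)%N).
have cJ : (#|J| = \sum_(2 <= i < k.+2) (b_num k VO i <= h))%N.
  rewrite -sum1_card big_mkcond /= (reindex_inj rev_ord_inj) /=.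
  rewrite -[2%N]add0n -[k.+2]addn2 big_addn addnK big_mkord.
  apply: eq_bigr => i _; rewrite inE /= (_ : (k - (k - i.+1)).+1 = i + 2)%N; first by case: leqP.
  by have := ltn_ord i; lia.
rewrite -cJ in hm.
have hu a : tangent p (u a) /\ forall i : 'I_k, i \notin J ->
    u a (dd i) = n i.+1 p * u a (r i.+1).
  have [V hV ->] := uE a.
  have [tV _] := nb_in HX (growth_section HG HX Dtan hV).
  split=> // i; rewrite inE -ltnNge => hi.
  have := growth_nord hV (ltn_ord i); rewrite prednK //.
  have -> : (b_num k VO (k - i).+1 - h = (b_num k VO (k - i).+1 - h).-1.+1)%N by lia.
  by move/nord_value/eqP; rewrite /om subr_eq0 => /eqP.
pose M : 'M[K]_(m, 2 + #|J|) := row_mx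
  (\matrix_(a < m, b < 2) (if b == 0 then u a (r k) else u a (n k)))
  (\matrix_(a < m, b < #|J|) (u a (dd (enum_val b)) -
     n (enum_val b).+1 p * u a (r (enum_val b).+1))).
have /rowV0Pn[c /sub_kermxP cM c0] : kermx M != 0.
  by rewrite -mxrank_eq0 mxrank_ker subn_eq0 -ltnNge (leq_ltn_trans (rank_leq_col _)).
have := cM; rewrite /M mul_mx_row -row_mx0 => /eq_row_mx[cM1 cM2].
pose v : tvec X := fun f => \sum_a c 0 a * u a f.
have tv : tangent p v by apply: tan_lin => a; case: (hu a).
have v0 : v = (fun=> 0).
  apply: (tw_kill tw Up tv).
  - have := congr1 (fun A : 'rV_2 => A 0 0) cM1; rewrite !mxE /v => E; rewrite -[RHS]E.
    by apply: eq_bigr => a _; rewrite !mxE.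
  - have := congr1 (fun A : 'rV_2 => A 0 1) cM1; rewrite !mxE /v => E; rewrite -[RHS]E.
    by apply: eq_bigr => a _; rewrite !mxE.
  move=> i ik; pose i' := Ordinal ik.
  apply/eqP; rewrite -subr_eq0 /v mulr_sumr -sumrB.
  have [iJ|iJ] := boolP (i' \in J).
    have := congr1 (fun A : 'rV_#|J| => A 0 (enum_rank_in iJ i')) cM2.
    rewrite !mxE => E; apply/eqP; rewrite -[RHS]E; apply: eq_bigr => a _.
    by rewrite !mxE enum_rankK_in // /dd /= mulrBr [n _ _ * (_ * _)]mulrCA.
  apply/eqP/big1 => a _; have [_ /(_ i' iJ)] := hu a.
  by rewrite /dd /= => ->; rewrite mulrCA subrr.
have hc := uI (fun a => c 0 a) (fun f => congr1 (fun w : tvec X => w f) v0).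
by move: c0; rewrite (_ : c = 0) ?eqxx //; apply/rowP => a; rewrite hc mxE.
Qed.

End WithTower.

Theorem growth_bounds :
  (forall h, (2 <= h)%N ->
     (SG p h <= 2 + count (fun i => e_num k VO h i == 0)
                          (index_iota 2 (minn h k.+1).+1))%N) /\
  (forall i, (2 <= i <= k.+1)%N -> forall beta, is_beta p i.+1 beta ->
     (b_num k VO i <= beta)%N).
Proof.
have [U [r [n [inv tw]]]] := tower_exists HG HS HB p.
split=> [h h2|i /andP[i2 ik] beta [b1 hb _]].
  apply: leq_trans (SG_bound tw (ltnW h2)) _; rewrite leq_add2l; exact: e_num_count.
(* The b_j are nondecreasing, so if beta < b_i then at most the i-2 numbers b_2, ..., b_{i-1} are <=
   beta, and the rank is at most i instead of i+1. *)
rewrite leqNgt; apply/negP => hlt.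
have := SG_bound tw b1; rewrite hb.
rewrite (@big_cat_nat _ _ _ i) //=; last exact: leqW.
rewrite [X in (_ + (_ + X))%N]big_nat_cond [X in (_ + (_ + X))%N]big1 ?addn0; last first.
  move=> j /andP[/andP[ij jk] _]; apply/eqP; rewrite eqb0 -ltnNge.
  by apply: leq_trans hlt _; apply: b_num_lt.
have : (\sum_(2 <= j < i) (b_num k VO j <= beta) <= \sum_(2 <= j < i) 1)%N.
  by apply: leq_sum => j _; apply: leq_b1.
rewrite sum_nat_const_nat muln1; lia.
Qed.

End Growth.

(** * Curves in a chart *)

Section CurveModel.
Variables (G : geometry) (HG : geometry_laws G).
Local Notation K := (gK G).

(** The data of [base_curves] in ambient coordinates: a piece W of a curve, a field xi and a
    parameter tau with xi tau = 1, and a map Gam into the chart image WS of S. [cm_xi_tan] makes xi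
    well defined on functions of W, and [cm_span] says that xi spans the tangent lines. *)
Record curve_model (mS : nat) (WS V : set 'rV[K]_mS) (X Y : 'rV[K]_mS -> K)
    (P Q : {poly K}) (a : 'rV[K]_mS) (m : nat) (W : set 'rV[K]_m)
    (xi : 'rV[K]_m -> 'rV[K]_m) (tau : 'rV[K]_m -> K)
    (Gam : 'I_mS -> 'rV[K]_m -> K) (o : 'rV[K]_m) : Prop := CurveModel {
  cm_model : gmodel (g := G) 1 W ;
  cm_xi_reg : forall s, W s -> forall i, greg (fun z => xi z 0 i) s ;
  cm_xi_tan : forall s, W s -> forall F, greg F s ->
    gnb s [set z | W z -> F z = 0] -> \sum_i gpd F s i * xi s 0 i = 0 ;
  cm_tau_reg : forall s, W s -> greg tau s ;
  cm_tau_xi : forall s, W s -> \sum_i gpd tau s i * xi s 0 i = 1 ;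
  cm_span : forall (s : model_space W) v, tangent s v -> forall i,
    v (fun y : model_space W => sval y 0 i) =
      xi (sval s) 0 i * v (fun y : model_space W => tau (sval y)) ;
  cm_Gam_reg : forall s, W s -> forall i, greg (Gam i) s ;
  cm_Gam_in : forall s, W s -> WS (tuple_map Gam s) /\ V (tuple_map Gam s) ;
  cm_XY : forall s, W s -> X (tuple_map Gam s) = P.[tau s] /\
    Y (tuple_map Gam s) = Q.[tau s] ;
  cm_o : W o ;
  cm_tau_o : tau o = 0 ;
  cm_Gam_o : tuple_map Gam o = a ;
  cm_inj : forall s, W s -> tau s = 0 -> s = o
}.

Lemma base_curves_model (S : gspace G) (HS : space_laws S) nS (U0 : set S) mS
    (e : S -> 'rV[K]_mS) WS (V : set 'rV[K]_mS) (X Y : 'rV[K]_mS -> K) (p : S) :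
  manifold_chart nS U0 e WS -> U0 p ->
  (forall P Q : {poly K}, P.[0] = X (e p) -> Q.[0] = Y (e p) ->
    exists m (W : set 'rV[K]_m) xi tau Gam o,
      curve_model WS V X Y P Q (e p) W xi tau Gam o) ->
  base_curves p (U0 `&` (e @^-1` V)) (X \o e) (Y \o e).
Proof.
move=> ch Up h P Q hP hQ.
have [m [W [xi [tau [Gam [o cm]]]]]] := h P Q hP hQ.
have hW := cm_model cm; have HM := model_laws HG hW.
have [gam hgam] := model_chart_map HG hW ch HS (cm_Gam_reg cm) (fun s Ws => (cm_Gam_in cm Ws).1).
pose o' : model_space W := exist _ o (cm_o cm).
pose t (s : model_space W) := tau (sval s).
pose d := model_field (W := W) xi.
exists (model_space W), setT, o', t, d, gam; split.
- split=> //.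
  + exact: (model_manifold HG hW).
  + by move=> s _; apply: (nbT HM).
  + exact: (cm_tau_o cm).
  + move=> [s Ws] _ ts; apply: eq_exist; exact: (cm_inj cm).
  + move=> s _; apply: (model_reg_sval HG); exact: (cm_tau_reg cm) (svalP s).
  + by move=> s _; apply: (model_field_tangent HG hW (cm_xi_tan cm)).
  + move=> s _; rewrite /d (model_fieldE HG (cm_xi_tan cm) (F := tau)).
    * exact: (cm_tau_xi cm) (svalP s).
    * exact: (cm_tau_reg cm) (svalP s).
    * exact: (nb_refl HM).
  + by move=> s f _; apply: (model_field_reg HG (cm_xi_reg cm) (cm_xi_tan cm)).
  move=> s v _ tv; apply: funext => f.
  have [rf|nf] := pselect (reg f s); last first.
    rewrite (tan_nreg tv nf) /d (tan_nreg (model_field_tangent HG hW (cm_xi_tan cm) s) nf).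
    by rewrite mulr0.
  have [F [hF hn]] := rf.
  rewrite /d (model_fieldE HG (cm_xi_tan cm) hF hn) mulr_sumr.
  have E (y : model_space W) : tuple_map (fun i (z : model_space W) => sval z 0 i) y = sval y.
    by apply/rowP => i; rewrite mxE.
  rewrite (tan_comp tv (g := fun i y => sval y 0 i) (F := F)).
  * rewrite E; apply: eq_bigr => i _; rewrite (cm_span cm tv) /t; ring.
  * move=> i; apply: (model_reg_sval HG (F := fun z => z 0 i)); exact: (greg_coord HG).
  * by rewrite E.
  * by apply: (nbS HM) hn => y /= ->; rewrite E.
- have [_ _ [einj _] _ _] := ch; have [U1 e1 _] := hgam o'.
  by apply: einj; rewrite ?inE // e1 (cm_Gam_o cm).
move=> s _; have [U1 e1 r1] := hgam s; have Ws := svalP s.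
have [x1 x2] := cm_XY cm Ws; have [_ w2] := cm_Gam_in cm Ws.
by split=> //=; rewrite ?e1 //; split=> //=; rewrite e1.
Qed.

End CurveModel.

(** * The weak Nullstellensatz *)

Module Nullstellensatz.
Import mpoly.
Local Open Scope ring_scope.

Section Generators.
Variables (n : nat) (K : fieldType).

Lemma mpoly_gen_ind (P : {mpoly K[n]} -> Prop) :
  (forall c, P c%:MP) -> (forall i, P 'X_i) ->
  (forall p q, P p -> P q -> P (p + q)) ->
  (forall p q, P p -> P q -> P (p * q)) -> forall p, P p.
Proof.
move=> hC hX hD hM; elim/mpolyind => [|c m p _ _ IH].
  by rewrite -mpolyC0; apply: hC.
apply: (hD) => //; rewrite -mul_mpolyC; apply: (hM) => //.
rewrite mpolyXE_id; apply: (big_ind P) => [|p' q' hp hq|i _].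
- by rewrite -mpolyC1.
- exact: hM.
elim: (m i) => [|k IHk]; first by rewrite expr0 -mpolyC1.
by rewrite exprS; apply: hM.
Qed.

Lemma mpoly_rmorph_eq (S : comNzRingType) (f g : {rmorphism {mpoly K[n]} -> S}) :
  (forall c, f c%:MP = g c%:MP) -> (forall i, f 'X_i = g 'X_i) -> f =1 g.
Proof.
move=> hC hX; elim/mpoly_gen_ind => // p q hp hq; first by rewrite !rmorphD hp hq.
by rewrite !rmorphM /= hp hq.
Qed.

End Generators.

Section Shear.
(* The substitution X_j := A_j + lambda_j Y, where A_j = X_j for j < n and
   A_n = 0; it makes a polynomial of degree d monic in Y, up to the value at
   lambda of its part of degree d. *)
Variables (n : nat) (K : fieldType) (lam : 'I_n.+1 -> K).

Definition shear_base (S : nzRingType) (a : 'I_n -> S) (j : 'I_n.+1) : S :=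
  if unlift ord_max j is Some i then a i else 0.

Definition shear_gen (j : 'I_n.+1) : {poly {mpoly K[n]}} :=
  (shear_base (fun i => 'X_i) j)%:P + (lam j)%:MP%:P * 'X.

Definition shear : {mpoly K[n.+1]} -> {poly {mpoly K[n]}} :=
  mmap (polyC \o @mpolyC n K) shear_gen.

Lemma shear_is_additive : additive shear.
Proof. exact: mmap_is_additive. Qed.

Lemma shear_is_multiplicative : multiplicative shear.
Proof. exact: mmap_is_multiplicative. Qed.

HB.instance Definition _ := GRing.isAdditive.Build _ _ shear shear_is_additive.
HB.instance Definition _ := GRing.isMultiplicative.Build _ _ shear shear_is_multiplicative.

Lemma shearC c : shear c%:MP = c%:MP%:P.
Proof. by rewrite /shear mmapC. Qed.

Lemma shearX j : shear 'X_j = shear_gen j.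
Proof. by rewrite /shear mmapX mmap1U. Qed.

Lemma shear_eval (S : comNzRingType) (iota : {rmorphism K -> S}) (a : 'I_n -> S) (y : S) F :
  (map_poly (mmap iota a) (shear F)).[y] =
  mmap iota (fun j => shear_base a j + iota (lam j) * y) F.
Proof.
pose f1 := horner_eval y \o map_poly (mmap iota a) \o shear.
pose f2 := mmap iota (fun j => shear_base a j + iota (lam j) * y).
suff : f1 =1 f2 by apply.
apply: mpoly_rmorph_eq => [c|j] /=.
  by rewrite shearC map_polyC /= /horner_eval hornerC /f2 !mmapC.
rewrite shearX /f2 mmapX mmap1U /shear_gen rmorphD rmorphM /= map_polyX !map_polyC /=.
rewrite /horner_eval hornerD hornerMX !hornerC mmapC; congr (_ + _).
rewrite /shear_base; case: (unlift _ _) => [i|]; last exact: rmorph0.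
by rewrite mmapX mmap1U.
Qed.

Let homog_top (P : {poly {mpoly K[n]}}) d (c : K) :=
  (size P <= d.+1)%N /\ P`_d = c%:MP.

Let homog_topM P Q d e c c' : homog_top P d c -> homog_top Q e c' ->
  homog_top (P * Q) (d + e) (c * c').
Proof.
move=> [h1 h2] [h3 h4]; split.
  by apply: (leq_trans (size_polyMleq _ _)); lia.
rewrite coefM (bigD1 (inord d)) //= inordK ?ltnS ?leq_addr // addKn h2 h4 -mpolyCM.
rewrite big1 ?addr0 // => i /eqP ij.
have [id|di] := ltnP i d.
  by rewrite [Q`_ _]nth_default ?mulr0 //; apply: (leq_trans h3); lia.
rewrite [P`_ _]nth_default ?mul0r //; apply: (leq_trans h1).
rewrite ltn_neqAle di andbT; apply/eqP => E; apply: ij; apply: val_inj.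
by rewrite /= inordK // ltnS leq_addr.
Qed.

Let homog_top_mnm (m : 'X_{1..n.+1}) : homog_top (shear 'X_[m]) (mdeg m) (\prod_i lam i ^+ m i).
Proof.
rewrite mdegE mpolyXE_id rmorph_prod /=.
apply: (big_ind3 homog_top).
- by split; rewrite ?size_polyC ?leq_b1 // coefC.
- by move=> P d c Q e c'; apply: homog_topM.
move=> i _; rewrite rmorphXn /= shearX.
elim: (m i) => [|k [h1 h2]]; first by rewrite !expr0; split; rewrite ?size_polyC ?leq_b1 // coefC.
rewrite !exprS -[k.+1]add1n; apply: homog_topM => //; split.
  apply: (leq_trans (size_polyD _ _)); rewrite geq_max size_polyC.
  rewrite (leq_trans (leq_b1 _)) //=; apply: (leq_trans (size_polyMleq _ _)).
  by rewrite size_polyX size_polyC; case: (_ != 0).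
by rewrite coefD coefC coefMX coefC add0r.
Qed.

Definition top_part (F : {mpoly K[n.+1]}) : {mpoly K[n.+1]} :=
  \sum_(m <- msupp F | mdeg m == (msize F).-1) F@_m *: 'X_[m].

Lemma top_part_neq0 F : F != 0 -> top_part F != 0.
Proof.
move=> F0; apply/eqP => /(congr1 (mcoeff (mlead F))); rewrite mcoeff0.
have -> : (top_part F)@_(mlead F) = F@_(mlead F).
  rewrite /top_part raddf_sum /= big_mkcond.
  rewrite (bigD1_seq (mlead F) (mlead_supp F0) (msupp_uniq F)) /=.
  rewrite -mlead_deg // eqxx mcoeffZ mcoeffX eqxx mulr1 big1 ?addr0 // => m hm.
  by case: ifP => // _; rewrite mcoeffZ mcoeffX (negbTE hm) mulr0.
by apply/eqP; rewrite -mcoeff_msupp; apply: mlead_supp.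
Qed.

Lemma shear_top F :
  (size (shear F) <= (msize F).-1.+1)%N /\
  (shear F)`_(msize F).-1 = ((top_part F).@[lam])%:MP.
Proof.
set d := (msize F).-1.
have hm m : m \in msupp F -> (mdeg m <= d)%N.
  by move=> /msize_mdeg_lt; rewrite /d; case: (msize F).
have E : shear F = \sum_(m <- msupp F) (F@_m)%:MP%:P * shear 'X_[m].
  rewrite {1}(mpolyE F) rmorph_sum; apply: eq_bigr => m _ /=.
  by rewrite -mul_mpolyC rmorphM /= shearC.
split.
  rewrite E big_seq; apply: (big_ind (fun P : {poly {mpoly K[n]}} => (size P <= d.+1)%N)).
  - by rewrite size_poly0.
  - move=> P Q hP hQ; apply: (leq_trans (size_polyD _ _)); by rewrite geq_max hP.
  move=> m /hm md; have [h1 _] := homog_top_mnm m.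
  rewrite mul_polyC; apply: (leq_trans (size_scale_leq _ _)).
  by apply: (leq_trans h1).
rewrite E coef_sum /top_part (raddf_sum (meval lam)) (raddf_sum (@mpolyC n K)) /= [RHS]big_mkcond.
rewrite big_seq [RHS]big_seq; apply: eq_bigr => m /hm md.
have [h1 h2] := homog_top_mnm m; rewrite coefCM.
case: eqP => [E1|/eqP ne].
  by rewrite /d -E1 h2 mevalZ mevalX -mpolyCM.
rewrite nth_default ?mulr0 //; apply: (leq_trans h1); by rewrite ltn_neqAle ne.
Qed.

End Shear.

Section Points.
Variable K : fieldType.
Hypothesis char0 : forall n, n.+1%:R != 0 :> K.

(** In characteristic 0 the integers below [size P] are distinct in K, too many to be all roots of
    P. *)
Lemma poly_nonroot (P : {poly K}) : P != 0 -> exists x, P.[x] != 0.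
Proof.
move=> P0; apply: contrapT => /forallNP h; case/negP: P0; apply/eqP.
apply: (roots_geq_poly_eq0 (rs := [seq (i%:R : K) | i <- iota 0 (size P)])).
- apply/allP => x _; apply/rootP; apply/eqP; apply/negPn/negP; exact: h.
- rewrite map_inj_uniq ?iota_uniq // => i j.
  wlog ij : i j / (i <= j)%N => [hw|] E.
    by case: (leqP i j) => [/hw|/ltnW/hw]; [exact|move=> h'; apply: esym; exact: h'].
  apply/eqP; rewrite eqn_leq ij /= leqNgt; apply/negP => ltij.
  have := char0 (j - i).-1; rewrite prednK ?subn_gt0 // natrB // -E subrr eqxx //.
- by rewrite size_map size_iota.
Qed.

Lemma mpoly_nonroot n (F : {mpoly K[n]}) : F != 0 -> exists a, F.@[a] != 0.
Proof.
elim: n F => [|n IH] F F0.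
  exists (fun=> 0); rewrite -(mpolyKC F) mevalC; apply: contra_neq F0 => E.
  by rewrite -(mpolyKC F) E mpolyC0.
(* For this lam the shear merely views F as a polynomial in its last variable. Substituting that
   variable back, by g below, inverts it, so the result is nonzero. *)
pose lam (j : 'I_n.+1) : K := (j == ord_max)%:R.
have sF0 : shear lam F != 0.
  pose g := horner_eval 'X_ord_max \o map_poly (mmap (@mpolyC n.+1 K) (fun i : 'I_n => 'X_(lift ord_max i))).
  pose g1 := g \o shear lam.
  have gK : g1 =1 idfun.
    apply: mpoly_rmorph_eq => [c|j]; rewrite /g1 /g /=.
      by rewrite shearC map_polyC /= /horner_eval hornerC mmapC.
    rewrite shearX /shear_gen rmorphD rmorphM /= map_polyX !map_polyC /= /horner_eval.
    rewrite hornerD hornerMX !hornerC mmapC /shear_base /lam.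
    case: unliftP => [i ->|->]; last by rewrite eqxx mulr1n rmorph0 add0r /= mpolyC1 mul1r.
    by rewrite mmapX mmap1U eq_sym (negbTE (neq_lift _ _)) mulr0n /= mpolyC0 mul0r addr0.
  apply: contra_neq F0 => E; transitivity (g (shear lam F)); first by have := gK F.
  by rewrite E /g /= map_poly0 /horner_eval horner0.
have [k hk] : exists k, (shear lam F)`_k != 0.
  by exists (size (shear lam F)).-1; rewrite -lead_coefE lead_coef_eq0.
have [a ha] := IH _ hk.
have [x hx] : exists x, (map_poly (meval a) (shear lam F)).[x] != 0.
  apply: poly_nonroot; apply: contra_neq ha => E.
  by rewrite -(coef_map (meval a)) E coef0.
exists (fun j => shear_base a j + lam j * x).
have E : (map_poly (meval a) (shear lam F)).[x] =
  F.@[fun j => shear_base a j + lam j * x] := shear_eval lam idfun a x F.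
by rewrite -E.
Qed.

End Points.

Section Companion.
(* Multiplication by X on R[X]/(f), for f monic of degree d.+1; its
   characteristic property is [C v = y v] for v = (1, y, ..., y^d) and f(y) = 0. *)
Definition companion (R : comNzRingType) d (f : {poly R}) : 'M[R]_d.+1 :=
  \matrix_(i, j) (if i == ord_max then - f`_j else (i.+1 == j)%:R).

Lemma map_companion (R S : comNzRingType) (phi : {rmorphism R -> S}) d f :
  map_mx phi (companion d f) = companion d (map_poly phi f).
Proof.
apply/matrixP => i j; rewrite !mxE; case: eqP => _; last exact: rmorph_nat.
by rewrite rmorphN coef_map.
Qed.

Variables (L : comNzRingType) (I : L -> Prop).
Hypothesis ID : forall x y, I x -> I y -> I (x + y).
Hypothesis IM : forall x y, I y -> I (x * y).

Lemma ideal_sum (J : Type) (s : seq J) (F : J -> L) : I 0 ->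
  (forall j, I (F j)) -> I (\sum_(j <- s) F j).
Proof.
move=> h0 h; elim/big_ind: _ => [|x y|j _]; [exact: h0|exact: ID|exact: h].
Qed.

Variables (d : nat) (f : {poly L}) (y : L).
Hypothesis f_size : (size f <= d.+2)%N.
Hypothesis f_monic : f`_d.+1 = 1.
Hypothesis If : I f.[y].

Let v : 'cV[L]_d.+1 := \col_i y ^+ i.

Let I0 : I 0. Proof. by rewrite -(mul0r f.[y]); apply: IM. Qed.

Let C := companion d f.

Let C_v i : I ((C *m v) i 0 - y * v i 0).
Proof.
rewrite !mxE; case: (eqVneq i ord_max) => [->|ne].
  have E : \sum_j C ord_max j * v j 0 = - (f.[y] - y ^+ d.+1).
    rewrite (horner_coef_wide _ f_size) [in RHS]big_ord_recr /= f_monic mul1r addrK -sumrN.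
    by apply: eq_bigr => j _; rewrite !mxE eqxx mulNr.
  rewrite E /= -exprS opprB addrAC subrr sub0r -mulN1r; exact: IM.
have id : (i.+1 < d.+1)%N.
  by rewrite ltnS ltn_neqAle -ltnS ltn_ord andbT; apply: contra_neq ne => E; exact: val_inj.
have E : \sum_j C i j * v j 0 = y * y ^+ i.
  rewrite (bigD1 (Ordinal id)) //= big1 ?addr0 => [|j jn]; rewrite !mxE (negbTE ne).
    by rewrite eqxx mul1r -exprS.
  rewrite (_ : (i.+1 == j) = false) ?mul0r //; apply/negbTE; apply: contra_neq jn => E.
  by apply: val_inj.
by rewrite E subrr.
Qed.

Lemma companion_eigen (g : {poly L}) i : I ((horner_mx C g *m v) i 0 - g.[y] * v i 0).
Proof.
elim/poly_ind: g i => [|g c IH] i.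
  by rewrite rmorph0 mul0mx horner0 mul0r subr0 mxE.
have E : horner_mx C (g * 'X + c%:P) *m v - (g * 'X + c%:P).[y] *: v =
   horner_mx C g *m (C *m v - y *: v) + y *: (horner_mx C g *m v - g.[y] *: v).
  rewrite rmorphD rmorphM /= horner_mx_X horner_mx_C hornerMXaddC mulmxDl -mulmxE.
  rewrite mul_scalar_mx mulmxBr -scalemxAr -mulmxA scalerBr scalerDl scalerA.
  by rewrite [g.[y] * y]mulrC opprD addrACA subrr addr0 addrA subrK.
have {}E := congr1 (fun A : 'cV[L]_d.+1 => A i 0) E.
rewrite [X in X = _]mxE [X in _ + X = _]mxE [X in - X]mxE in E.
rewrite E mxE; apply: ID.
  rewrite mxE; apply: ideal_sum => // j; apply: IM.
  by have := C_v j; rewrite [X in _ -> I X]mxE [X in _ -> I (_ + X)]mxE [X in _ -> I (_ - X)]mxE.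
rewrite mxE; apply: IM.
by have := IH i; rewrite [X in _ -> I X]mxE [X in _ -> I (_ + X)]mxE [X in _ -> I (_ - X)]mxE.
Qed.

(** Modulo I the vector v is an eigenvector of g(C) with eigenvalue g(y), so g(C) v has entries in
    I. Multiplying by the adjugate gives det(g(C)) v, and the first entry of v is 1. *)
Lemma companion_det (g : {poly L}) : I g.[y] -> I (\det (horner_mx C g)).
Proof.
move=> Ig; set M := horner_mx C g.
have hM i : I ((M *m v) i 0).
  have h := companion_eigen g i; rewrite -[X in I X](subrK (g.[y] * v i 0)).
  by apply: ID => //; rewrite mulrC; apply: IM.
have E : (\adj M *m (M *m v)) 0 0 = \det M.
  by rewrite mulmxA mul_adj_mx mul_scalar_mx !mxE expr0 mulr1.
by rewrite -E mxE; apply: ideal_sum => // j; apply: IM.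
Qed.

End Companion.

Section WeakNullstellensatz.
Variable K : closedFieldType.
Hypothesis char0 : forall n, n.+1%:R != 0 :> K.
Variables (L : comNzRingType) (iota : {rmorphism K -> L}) (I : L -> Prop).
Hypothesis ID : forall x y, I x -> I y -> I (x + y).
Hypothesis IM : forall x y, I y -> I (x * y).
Hypothesis I1 : ~ I 1.

Let I_unit c : c != 0 -> ~ I (iota c).
Proof.
move=> c0 h; apply: I1; rewrite -(rmorph1 iota) -(mulVf c0) rmorphM; exact: IM.
Qed.

(* The monic polynomial f obtained by a shear makes a_n integral over the
   other (sheared) variables, and a point c of these lifts to a root of f(c, Y)
   because the norm from L[Y]/(f), computed by the companion matrix of f,
   specializes at c. *)
Lemma weak_nullstellensatz n (a : 'I_n -> L) :
  exists c : 'I_n -> K, forall F, I (mmap iota a F) -> F.@[c] = 0.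
Proof.
elim: n a => [|n IH] a.
  exists (fun=> 0) => F; rewrite -(mpolyKC F) mmapC mevalC => h.
  by apply: contrapT => /eqP /I_unit; apply.
have [hF|/existsNP[F /not_implyP[IF /eqP F0]]] :=
    pselect (forall F, I (mmap iota a F) -> F = 0).
  by exists (fun=> 0) => F /hF ->; rewrite meval0.
(* A nonzero value of the top part makes the sheared F monic in Y up to a scalar; a nonzero last
   entry of lam makes the shear invertible. *)
have [lam hlam] : exists lam, (top_part F * 'X_ord_max).@[lam] != 0.
  apply: mpoly_nonroot => //; rewrite mulf_neq0 ?top_part_neq0 //.
  by rewrite -msize_poly_eq0 msizeX.
rewrite mevalM mevalXU mulf_eq0 negb_or in hlam.
have /andP[lF lm] := hlam.
pose y := iota (lam ord_max)^-1 * a ord_max.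
pose a' (i : 'I_n) := a (lift ord_max i) - iota (lam (lift ord_max i)) * y.
have aE : (fun j => shear_base a' j + iota (lam j) * y) = a.
  apply: funext => j; rewrite /shear_base; case: unliftP => [i ->|->].
    by rewrite /a' subrK.
  by rewrite add0r /y mulrA -rmorphM divff // rmorph1 mul1r.
have evE E : (map_poly (mmap iota a') (shear lam E)).[y] = mmap iota a E.
  by rewrite shear_eval aE.
have [c' hc'] := IH a'.
have [s1 s2] := shear_top lam F.
set d := (msize F).-1 in s1 s2; set u := (top_part F).@[lam] in lF s2.
(* In degree 0, F is a nonzero constant, and its image in I would be a unit. So the companion matrix
   has positive size. *)
case Ed : d => [|d'] in s1 s2.
  case: (I_unit lF); rewrite -(mmapC a iota u).
  have FC : F = (F@_0)%:MP by apply: msize1_polyC; move: Ed; rewrite /d; case: (msize F) => [|[]].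
  have sF : shear lam F = (u%:MP)%:P by rewrite (size1_polyC s1) s2.
  by rewrite -evE in IF; move: IF; rewrite sF map_polyC hornerC /= !mmapC.
pose f := (u^-1)%:MP%:P * shear lam F.
have f1 : f`_d'.+1 = 1 by rewrite coefCM s2 -mpolyCM mulVf.
have f2 : (size f <= d'.+2)%N by rewrite /f mul_polyC (leq_trans (size_scale_leq _ _)).
have If : I (map_poly (mmap iota a') f).[y].
  by rewrite rmorphM /= hornerM; apply: IM; rewrite evE.
(* The relations between the sheared coordinates, specialized at c' in all but the last variable.
   They form a proper ideal: if g specializes to a constant c, its norm lies in I as a polynomial in
   the first variables, hence vanishes at c', where its value is a power of c. *)
pose J (h : {poly K}) := exists2 g : {poly {mpoly K[n]}},
  I (map_poly (mmap iota a') g).[y] & map_poly (meval c') g = h.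
have J1 (h : {poly K}) : J h -> size h <> 1%N.
  move=> [g Ig hg] /eqP /size_poly1P[c c0 hc].
  have := companion_det ID IM (d := d') (f := map_poly (mmap iota a') f) (y := y).
  move=> /(_ _ _ If _ Ig) hN.
  have : I (mmap iota a' (\det (horner_mx (companion d' f) g))).
    rewrite -det_map_mx map_horner_mx map_companion; apply: hN.
      by apply: (leq_trans (size_poly _ _)).
    by rewrite coef_map /= f1 -mpolyC1 mmapC; exact: rmorph1.
  move/hc' => /eqP; rewrite -det_map_mx map_horner_mx hg hc horner_mx_C det_scalar.
  by rewrite expf_eq0 (negbTE c0) andbF.
have JD h1 h2 : J h1 -> J h2 -> J (h1 + h2).
  move=> [g1 i1 <-] [g2 i2 <-]; exists (g1 + g2); last exact: rmorphD.
  by rewrite rmorphD hornerD; apply: ID.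
have JM q h : J h -> J (q * h).
  move=> [g Ig <-]; exists (map_poly (@mpolyC n K) q * g).
    by rewrite rmorphM hornerM; apply: IM.
  rewrite rmorphM /= -map_poly_comp; congr (_ * _).
  by rewrite map_poly_id // => x _ /=; rewrite mevalC.
have Jf : J (map_poly (meval c') f) by exists f.
have f0 : map_poly (meval c') f != 0.
  apply/eqP => /(congr1 (fun P : {poly K} => P`_d'.+1)).
  by rewrite coef_map /= f1 meval1 coef0 => /eqP; rewrite oner_eq0.
(* A nonzero element of least degree divides every element of J, so any root of it is a common root;
   it has one because J contains no nonzero constant. *)
have [h [Jh h0 hmin]] : exists h, [/\ J h, h != 0 & forall h', J h' -> h' != 0 -> (size h <= size h')%N].
  pose S := fun m => `[< exists2 h, J h & h != 0 /\ size h = m >].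
  have exS : exists m, S m by exists (size (map_poly (meval c') f)); apply/asboolP; exists (map_poly (meval c') f).
  case: (ex_minnP exS) => m /asboolP[h Jh [h0 hm]] hmin; exists h; split=> // h' Jh' h'0.
  by rewrite hm; apply: hmin; apply/asboolP; exists h'.
have Jdvd h' : J h' -> h %| h'.
  move=> Jh'; rewrite /dvdp; apply: contraT => hr.
  have : J (h' %% h).
    rewrite (_ : h' %% h = h' + (- (h' %/ h)) * h); first by apply: JD => //; apply: JM.
    by rewrite {2}(divp_eq h' h) mulNr addrAC subrr add0r.
  by move/hmin/(_ hr); rewrite leqNgt ltn_modp h0.
have [rho hrho] : exists x, root h x by apply/closed_rootP/eqP/J1.
exists (fun j => shear_base c' j + lam j * rho) => E IE.
have <- : (map_poly (meval c') (shear lam E)).[rho] =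
  E.@[fun j => shear_base c' j + lam j * rho] := shear_eval lam idfun c' rho E.
apply/rootP.
apply: root_dvdp hrho; apply: Jdvd; exists (shear lam E) => //.
by rewrite evE.
Qed.

End WeakNullstellensatz.
End Nullstellensatz.

(** * Arcs on a zero locus *)

Module Arcs.
Import mpoly Nullstellensatz.
Local Open Scope ring_scope.

Section Arcs.
Variables (n : nat) (K : fieldType).
Implicit Types (F : {mpoly K[n]}) (e : 'I_n -> {poly K}).

Definition along e F : {poly K} := mmap (@polyC K) e F.

Lemma along_is_additive e : additive (along e).
Proof. exact: mmap_is_additive. Qed.
Lemma along_is_multiplicative e : multiplicative (along e).
Proof. exact: mmap_is_multiplicative. Qed.
HB.instance Definition _ e := GRing.isAdditive.Build _ _ (along e) (along_is_additive e).
HB.instance Definition _ e := GRing.isMultiplicative.Build _ _ (along e) (along_is_multiplicative e).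

Lemma alongC e c : along e c%:MP = c%:P. Proof. exact: mmapC. Qed.
Lemma alongX e i : along e 'X_i = e i. Proof. by rewrite /along mmapX mmap1U. Qed.

Lemma mderivXU (i j : 'I_n) : ('X_j : {mpoly K[n]})^`M(i) = ((i == j)%:R)%:MP.
Proof.
rewrite mderivX mnm1E eq_sym; case: eqP => [->|_]; last by rewrite scale0r mulr0n mpolyC0.
rewrite mulr1n scale1r mpolyC1 (_ : (U_(j) - U_(j) = 0)%MM) ?mpolyX0 //.
by apply/mnmP => k; rewrite mnmBE subnn mnm0E.
Qed.

Lemma along_at0 e F : (along e F).[0] = F.@[fun i => (e i).[0]].
Proof.
elim/mpoly_gen_ind: F => [c|i|p q hp hq|p q hp hq].
- by rewrite alongC hornerC mevalC.
- by rewrite alongX mevalXU.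
- by rewrite rmorphD hornerD hp hq mevalD.
- by rewrite rmorphM hornerM hp hq mevalM.
Qed.

Lemma along_deriv e F : (along e F)^`() = \sum_i along e F^`M(i) * (e i)^`().
Proof.
elim/mpoly_gen_ind: F => [c|j|p q hp hq|p q hp hq].
- by rewrite alongC derivC big1 // => i _; rewrite mderivC rmorph0 mul0r.
- rewrite alongX (bigD1 j) //= big1 ?addr0 => [|i ij]; rewrite mderivXU alongC.
    by rewrite eqxx mul1r.
  by rewrite (negbTE ij) mul0r.
- rewrite rmorphD derivD hp hq -big_split; apply: eq_bigr => i _ /=.
  by rewrite mderivD rmorphD mulrDl.
rewrite rmorphM /= derivM hp hq mulr_suml mulr_sumr -big_split; apply: eq_bigr => i _ /=.
rewrite mderivM rmorphD !rmorphM /=; ring.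
Qed.

(** Taylor expansion to first order in the perturbation c X^m; the quadratic remainder is divisible
    by X^(2m). *)
Lemma along_taylor e (c : 'I_n -> K) m F : exists G : {poly K},
  along (fun i => e i + (c i)%:P * 'X^m) F =
  along e F + 'X^m * (\sum_i along e F^`M(i) * (c i)%:P) + 'X^(m + m) * G.
Proof.
elim/mpoly_gen_ind: F => [a|j|p q [G1 hp] [G2 hq]|p q [G1 hp] [G2 hq]].
- exists 0; rewrite !alongC big1 => [|i _]; first by rewrite !mulr0 !addr0.
  by rewrite mderivC rmorph0 mul0r.
- exists 0; rewrite !alongX (bigD1 j) //= big1 ?addr0 => [|i ij]; rewrite mderivXU alongC.
    by rewrite eqxx mul1r mulr0 addr0 mulrC.
  by rewrite (negbTE ij) mul0r.
- exists (G1 + G2); rewrite !rmorphD /= hp hq.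
  under eq_bigr do rewrite mderivD rmorphD mulrDl.
  rewrite big_split /=; ring.
set P := along e p in hp *; set Q := along e q in hq *.
pose DP := \sum_i along e p^`M(i) * (c i)%:P; pose DQ := \sum_i along e q^`M(i) * (c i)%:P.
rewrite -/DP in hp; rewrite -/DQ in hq.
exists (P * G2 + Q * G1 + DP * DQ + 'X^m * (DP * G2 + DQ * G1) + 'X^(m + m) * (G1 * G2)).
rewrite !rmorphM /= hp hq -/P -/Q.
have -> : \sum_i along e (p * q)^`M(i) * (c i)%:P = DP * Q + P * DQ.
  rewrite /DP /DQ mulr_suml mulr_sumr -big_split; apply: eq_bigr => i _ /=.
  rewrite mderivM rmorphD !rmorphM /= -/P -/Q; ring.
rewrite exprD; ring.
Qed.

Lemma along_coef0 e F : (along e F)`_0 = F.@[fun i => (e i)`_0].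
Proof.
by rewrite -horner_coef0 along_at0; apply: meval_eq => i; rewrite horner_coef0.
Qed.

Variables (M : nat) (f : 'I_M -> {mpoly K[n]}) (s xi : 'I_n -> K).
Hypothesis fs : forall l, (f l).@[s] = 0.
Let J : 'M[K]_(M, n) := \matrix_(l, i) (f l)^`M(i).@[s].
Hypothesis rJ : \rank J = M.
Hypothesis Jxi : forall l, \sum_i (f l)^`M(i).@[s] * xi i = 0.

(** Newton iteration: adding c X^(m+2) to the arc changes the coefficient of X^(m+2) in f by J c and
    leaves the lower ones alone. As J has full row rank, c can be chosen to cancel that coefficient.
    The start s + xi X works because J xi = 0. *)
Lemma arcs m : exists e, [/\ forall i, (e i)`_0 = s i, forall i, (e i)`_1 = xi i &
  forall l j, (j < m.+2)%N -> (along e (f l))`_j = 0].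
Proof.
elim: m => [|m [e [e0 e1 he]]].
  exists (fun i => (s i)%:P + (xi i)%:P * 'X^1); split.
  - by move=> i; rewrite coefD coefC coefMXn addr0.
  - by move=> i; rewrite coefD coefC coefMXn coefC /= add0r.
  move=> l j j2; have [G ->] := along_taylor (fun i => (s i)%:P) xi 1 (f l).
  have ac F : along (fun i => (s i)%:P) F = (F.@[s])%:P.
    elim/mpoly_gen_ind: F => [c|i|p q hp hq|p q hp hq].
    - by rewrite alongC mevalC.
    - by rewrite alongX mevalXU.
    - by rewrite rmorphD /= hp hq mevalD polyCD.
    - by rewrite rmorphM /= hp hq mevalM polyCM.
  rewrite ac fs add0r (_ : \sum_i _ = 0) ?mulr0 ?add0r; last first.
    under eq_bigr do rewrite ac -polyCM.
    by rewrite -(raddf_sum (@polyC K)) Jxi.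
  by rewrite coefXnM j2.
have /row_fullP[B BJ] : row_full J^T by rewrite /row_full mxrank_tr rJ.
pose b : 'rV[K]_M := \row_l - (along e (f l))`_m.+2.
pose c : 'rV[K]_n := b *m B.
have cJ l : \sum_i (f l)^`M(i).@[s] * c 0 i = - (along e (f l))`_m.+2.
  have := congr1 (fun A : 'M[K]_M => (b *m A) 0 l) BJ.
  rewrite mulmx1 mulmxA -/c !mxE => <-; apply: eq_bigr => i _.
  by rewrite !mxE mulrC.
exists (fun i => e i + (c 0 i)%:P * 'X^(m.+2)); split.
- by move=> i; rewrite coefD coefMXn addr0.
- by move=> i; rewrite coefD coefMXn addr0.
move=> l j jm; have [G ->] := along_taylor e (c 0) m.+2 (f l).
rewrite !coefD !coefXnM.
have -> : (j < m.+2 + m.+2)%N by apply: (leq_trans jm); lia.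
case: ltnP => jm2; first by rewrite he // !addr0.
have -> : j = m.+2 by lia.
rewrite subnn addr0 [X in _ + X]coef_sum (_ : \sum_i _ = - (along e (f l))`_m.+2) ?subrr // -cJ.
apply: eq_bigr => i _; rewrite coefMC along_coef0; congr (_ * _).
by apply: meval_eq.
Qed.

End Arcs.

Section ZeroLocus.
Variables (K : closedFieldType) (n M : nat).
Hypothesis char0 : forall n, n.+1%:R != 0 :> K.
Variables (f : 'I_M -> {mpoly K[n]}) (s xi : 'I_n -> K) (H : {mpoly K[n]}).
Hypothesis fs : forall l, (f l).@[s] = 0.
Hypothesis rJ : \rank (\matrix_(l < M, i < n) (f l)^`M(i).@[s]) = M.
Hypothesis Jxi : forall l, \sum_i (f l)^`M(i).@[s] * xi i = 0.
Hypothesis HZ : forall z, (forall l, (f l).@[z] = 0) -> H.@[z] = 0.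

(* If the derivative of H along xi were nonzero, H would vanish to order exactly
   one on formal arcs with velocity xi that satisfy f = 0 to any given order.
   Then f and w H - 1 would generate a proper ideal, hence have a common zero. *)
Theorem zero_locus_tangent : \sum_i H^`M(i).@[s] * xi i = 0.
Proof.
apply: contrapT => /eqP D0; set D := \sum_i _ in D0.
have /choice[e he] := arcs fs rJ Jxi.
pose h m := along (e m) H.
have h0 m : (h m)`_0 = 0.
  have [e0 _ _] := he m; rewrite along_coef0 -[RHS](HZ fs).
  by apply: meval_eq.
have h1 m : (h m)`_1 = D.
  have [e0 e1 _] := he m.
  have := congr1 (fun P : {poly K} => P`_0) (along_deriv (e m) H).
  rewrite /= coef_deriv mulr1n => ->; rewrite coef_sum; apply: eq_bigr => i _.
  rewrite coefM big_ord1 subn0 coef_deriv mulr1n e1 along_coef0; congr (_ * _).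
  by apply: meval_eq.
have hE m : exists h', h m = 'X * h' /\ h'`_0 = D.
  exists (drop_poly 1 (h m)); rewrite coef_drop_poly h1; split=> //.
  rewrite -{1}(poly_take_drop 1 (h m)) expr1 mulrC (_ : take_poly 1 _ = 0) ?add0r //.
  by apply/polyP => j; rewrite coef_take_poly coef0; case: j => [|j] //=; rewrite h0.
have hn m : h m != 0.
  by apply: contra_neq D0 => E; rewrite -(h1 m) E coef0.
pose Fr := {fraction {poly K}}.
pose tf : {rmorphism {poly K} -> Fr} := @tofrac _.
pose io : {rmorphism K -> Fr} := tf \o polyC.
pose ge m (j : 'I_n.+1) : Fr :=
  if unlift ord_max j is Some i then tf (e m i) else (tf (h m))^-1.
pose ev m : {rmorphism {mpoly K[n.+1]} -> Fr} := mmap io (ge m).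
(* F belongs to I if, after multiplication by a power h^B with B independent of m, its value on the
   m-th arc is divisible by X^m for every m. The uniform B makes I proper: h has order exactly one
   on each arc, so h^B is not divisible by X^(B+1). *)
pose I (F : {mpoly K[n.+1]}) := exists B, forall m, exists G : {poly K},
  tf (h m) ^+ B * ev m F = tf (G * 'X^m).
have tfh m : tf (h m) != 0 by rewrite tofrac_eq0.
have bounded F : exists B, forall m, exists G : {poly K}, tf (h m) ^+ B * ev m F = tf G.
  elim/mpoly_gen_ind: F => [c|j|p q [B1 hp] [B2 hq]|p q [B1 hp] [B2 hq]].
  - by exists 0%N => m; exists c%:P; rewrite expr0 mul1r /ev /= mmapC.
  - exists 1%N => m; rewrite /ev /= mmapX mmap1U /ge expr1.
    case: unliftP => [i _|_]; first by exists (h m * e m i); rewrite rmorphM.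
    by exists 1; rewrite (divff (tfh m)) rmorph1.
  - exists (B1 + B2)%N => m; have [G1 k1] := hp m; have [G2 k2] := hq m.
    exists (h m ^+ B2 * G1 + h m ^+ B1 * G2).
    rewrite !rmorphD !rmorphM !rmorphXn /= -k1 -k2 exprD; ring.
  exists (B1 + B2)%N => m; have [G1 k1] := hp m; have [G2 k2] := hq m.
  by exists (G1 * G2); rewrite !rmorphM -k1 -k2 exprD; ring.
have ID x y : I x -> I y -> I (x + y).
  move=> [B1 hp] [B2 hq]; exists (B1 + B2)%N => m.
  have [G1 k1] := hp m; have [G2 k2] := hq m.
  exists (h m ^+ B2 * G1 + h m ^+ B1 * G2).
  rewrite (rmorphM tf) in k1; rewrite (rmorphM tf) in k2.
  have -> : tf ((h m ^+ B2 * G1 + h m ^+ B1 * G2) * 'X^m) =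
      tf (h m) ^+ B2 * (tf G1 * tf 'X^m) + tf (h m) ^+ B1 * (tf G2 * tf 'X^m).
    by rewrite (rmorphM tf) (rmorphD tf) !(rmorphM tf) !(rmorphXn tf) mulrDl !mulrA.
  rewrite -k1 -k2 rmorphD exprD; ring.
have IM x y : I y -> I (x * y).
  move=> [B2 hq]; have [B1 hp] := bounded x; exists (B1 + B2)%N => m.
  have [G1 k1] := hp m; have [G2 k2] := hq m.
  by exists (G1 * G2); rewrite -mulrA (rmorphM tf G1) -k1 -k2 rmorphM exprD; ring.
have I1 : ~ I 1.
  move=> [B hB]; have [G] := hB B.+1; rewrite rmorph1 mulr1 -rmorphXn => /eqP.
  rewrite tofrac_eq => /eqP /(congr1 (fun P : {poly K} => P`_B)).
  rewrite coefMXn ltnSn; have [h' [-> h'0]] := hE B.+1.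
  rewrite exprMn coefXnM ltnn subnn => E.
  have : h'`_0 ^+ B = 0.
    by rewrite -[RHS]E -!horner_coef0 horner_exp.
  by move/eqP; rewrite expf_eq0 h'0 (negbTE D0) andbF.
have [c hc] := weak_nullstellensatz char0 (@mpolyC n.+1 K) ID IM I1 (fun j => 'X_j).
have hc' F : I F -> F.@[c] = 0.
  move=> IF; apply: hc; rewrite (_ : mmap _ _ F = F) //.
  have : mmap (@mpolyC n.+1 K) (fun j => 'X_j) =1 idfun.
    apply: mpoly_rmorph_eq => [a|j] /=; first by rewrite mmapC.
    by rewrite mmapX mmap1U.
  exact.
pose lf : {rmorphism {mpoly K[n]} -> {mpoly K[n.+1]}} :=
  mmap (@mpolyC n.+1 K) (fun i => 'X_(lift ord_max i)).
have ev_lf m F : ev m (lf F) = tf (along (e m) F).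
  pose g1 : {rmorphism {mpoly K[n]} -> Fr} := ev m \o lf.
  pose g2 : {rmorphism {mpoly K[n]} -> Fr} := tf \o along (e m).
  suff : g1 =1 g2 by apply.
  apply: mpoly_rmorph_eq => [a|i].
    by rewrite /g1 /g2 /= !mmapC alongC.
  by rewrite /g1 /g2 /= mmapX mmap1U mmapX mmap1U alongX /ge liftK.
pose z (i : 'I_n) := c (lift ord_max i).
have c_lf F : (lf F).@[c] = F.@[z].
  pose g1 : {rmorphism {mpoly K[n]} -> K} := meval c \o lf.
  suff : g1 =1 meval z by apply.
  apply: mpoly_rmorph_eq => [a|i].
    by rewrite /g1 /= mmapC !mevalC.
  by rewrite /g1 /= mmapX mmap1U !mevalXU.
have z0 : H.@[z] = 0.
  apply: HZ => l; rewrite -c_lf; apply: hc'; exists 0%N => m.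
  have [_ _ ha] := he m.
  exists (drop_poly m (along (e m) (f l))); rewrite expr0 mul1r ev_lf; congr (tf _).
  rewrite -{1}(poly_take_drop m (along _ _)) (_ : take_poly m _ = 0) ?add0r //.
  by apply/polyP => j; rewrite coef_take_poly coef0; case: ltnP => // jm; apply: ha; lia.
(* The extra variable is sent to the inverse of h on every arc, so this element belongs to I. At c
   it would give 1 = 0, since H vanishes at the common zero z of the f_l. *)
have : (1 - 'X_ord_max * lf H).@[c] = 0.
  apply: hc'; exists 0%N => m; exists 0.
  rewrite mul0r rmorph0 expr0 mul1r rmorphB rmorphM rmorph1 ev_lf.
  have -> : ev m 'X_ord_max = (tf (h m))^-1 by rewrite /ev /= mmapX mmap1U /ge unlift_none.
  by rewrite (mulVf (tfh m)) subrr.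
rewrite mevalB mevalM c_lf z0 mulr0 subr0 meval1 => /eqP.
by rewrite oner_eq0.
Qed.

End ZeroLocus.
End Arcs.

(** * Rational functions *)

Module AlgebraicLaws.
Import mpoly Nullstellensatz.
Local Open Scope ring_scope.
Local Open Scope classical_set_scope.

Section Laws.
Variable K : fieldType.
Hypothesis char0 : forall n, n.+1%:R != 0 :> K.
Local Notation G := (algebraic_geometry K).
Implicit Types (m : nat).

Lemma pevalD m (P Q : {mpoly K[m]}) x : peval (P + Q) x = peval P x + peval Q x.
Proof. exact: mevalD. Qed.
Lemma pevalM m (P Q : {mpoly K[m]}) x : peval (P * Q) x = peval P x * peval Q x.
Proof. exact: mevalM. Qed.
Lemma pevalC m (c : K) (x : 'rV[K]_m) : peval c%:MP x = c.
Proof. exact: mevalC. Qed.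
Lemma pevalX m (x : 'rV[K]_m) i : peval 'X_i x = x 0 i.
Proof. exact: mevalXU. Qed.
Lemma peval1 m (x : 'rV[K]_m) : peval 1 x = 1.
Proof. exact: meval1. Qed.

Lemma pevalN m (P : {mpoly K[m]}) x : peval (- P) x = - peval P x.
Proof. exact: mevalN. Qed.

Definition pevalE := (pevalD, pevalN, pevalM, pevalC, pevalX, peval1).

Lemma peval_neq0 m (H : {mpoly K[m]}) : H != 0 -> exists x, peval H x != 0.
Proof.
move=> /(mpoly_nonroot char0)[a ha]; exists (\row_i a i).
by rewrite /peval (meval_eq (v2 := a)) // => i; rewrite mxE.
Qed.

Lemma zariskiT m (x : 'rV[K]_m) : zariski_nb x setT.
Proof. by exists 1; rewrite peval1 oner_eq0. Qed.

Lemma zariskiI m (x : 'rV[K]_m) A B : zariski_nb x A -> zariski_nb x B ->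
  zariski_nb x (A `&` B).
Proof.
move=> [H [h1 h2]] [H' [h1' h2']]; exists (H * H'); rewrite pevalM mulf_neq0 //; split=> // y.
by rewrite pevalM mulf_eq0 negb_or => /andP[/h2 ? /h2' ?].
Qed.

Lemma zariskiS m (x : 'rV[K]_m) A B : A `<=` B -> zariski_nb x A -> zariski_nb x B.
Proof. by move=> AB [H [h1 h2]]; exists H; split=> // y /h2 /AB. Qed.

Lemma zariski_in m (x : 'rV[K]_m) A : zariski_nb x A -> A x.
Proof. by move=> [H [h1 h2]]; apply: h2. Qed.

Lemma zariski_open m (x : 'rV[K]_m) A : zariski_nb x A -> zariski_nb x [set y | zariski_nb y A].
Proof. by move=> [H [h1 h2]]; exists H; split=> // y hy; exists H. Qed.

Lemma zariski_poly m (x : 'rV[K]_m) (H : {mpoly K[m]}) : peval H x != 0 ->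
  zariski_nb x [set y | peval H y != 0].
Proof. by move=> h; exists H. Qed.

Lemma quotient_near m (F : 'rV[K]_m -> K) x P Q : is_quotient_at F x P Q ->
  zariski_nb x [set y | is_quotient_at F y P Q].
Proof.
move=> [hQ hF]; apply: zariskiS (zariskiI (zariski_poly hQ) (zariski_open hF)) => y [h1 h2].
by split.
Qed.

Lemma rational_near m (F : 'rV[K]_m -> K) x : rational_at F x ->
  zariski_nb x [set y | rational_at F y].
Proof.
by move=> [P [Q /quotient_near]]; apply: zariskiS => y h; exists P, Q.
Qed.

Lemma quotient_eq m (F F' : 'rV[K]_m -> K) x P Q : is_quotient_at F x P Q ->
  zariski_nb x [set y | F' y = F y] -> is_quotient_at F' x P Q.
Proof.
by move=> [hQ hF] h; split=> //; apply: zariskiS (zariskiI h hF) => y [/= -> ->].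
Qed.

Lemma rational_eq m (F F' : 'rV[K]_m -> K) x : rational_at F x ->
  zariski_nb x [set y | F' y = F y] -> rational_at F' x.
Proof. by move=> [P [Q h]] hn; exists P, Q; apply: quotient_eq h hn. Qed.

Lemma quotient_poly m (P : {mpoly K[m]}) x : is_quotient_at (peval P) x P 1.
Proof.
split; first by rewrite peval1 oner_eq0.
by apply: zariskiS (zariskiT x) => y _ /=; rewrite peval1 divr1.
Qed.

Lemma quotient_add m (F F' : 'rV[K]_m -> K) x P Q P' Q' :
  is_quotient_at F x P Q -> is_quotient_at F' x P' Q' ->
  is_quotient_at (fun y => F y + F' y) x (P * Q' + P' * Q) (Q * Q').
Proof.
move=> [hQ hF] [hQ' hF']; split; first by rewrite pevalM mulf_neq0.
apply: zariskiS (zariskiI (zariskiI hF hF') (zariskiI (zariski_poly hQ) (zariski_poly hQ'))).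
move=> y [[/= -> ->] [h1 h2]]; rewrite !pevalE; field; exact/andP.
Qed.

Lemma quotient_mul m (F F' : 'rV[K]_m -> K) x P Q P' Q' :
  is_quotient_at F x P Q -> is_quotient_at F' x P' Q' ->
  is_quotient_at (fun y => F y * F' y) x (P * P') (Q * Q').
Proof.
move=> [hQ hF] [hQ' hF']; split; first by rewrite pevalM mulf_neq0.
apply: zariskiS (zariskiI (zariskiI hF hF') (zariskiI (zariski_poly hQ) (zariski_poly hQ'))).
move=> y [[/= -> ->] [h1 h2]]; rewrite !pevalE; field; exact/andP.
Qed.

Lemma quotient_val m (F : 'rV[K]_m -> K) x P Q :
  is_quotient_at F x P Q -> F x = peval P x / peval Q x.
Proof. by move=> [_ /zariski_in]. Qed.

Lemma quotient_inv m (F : 'rV[K]_m -> K) x P Q :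
  is_quotient_at F x P Q -> F x != 0 -> is_quotient_at (fun y => (F y)^-1) x Q P.
Proof.
move=> h Fx; have E := quotient_val h; have [hQ hF] := h; split.
  by apply: contra_neq Fx => P0; rewrite E P0 mul0r.
by apply: zariskiS hF => y /= ->; rewrite invf_div.
Qed.

Lemma rational_neq0 m (F : 'rV[K]_m -> K) x : rational_at F x -> F x != 0 ->
  zariski_nb x [set y | F y != 0].
Proof.
move=> [P [Q h]] Fx; have E := quotient_val h; have [hQ hF] := h.
have hP : peval P x != 0 by apply: contra_neq Fx => P0; rewrite E P0 mul0r.
apply: zariskiS (zariskiI (zariskiI (zariski_poly hP) (zariski_poly hQ)) hF).
by move=> y [[h1 h2] /= ->]; rewrite mulf_neq0 // invr_eq0.
Qed.

Lemma rational_cst m c (x : 'rV[K]_m) : rational_at (fun=> c) x.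
Proof.
exists c%:MP, 1; apply: quotient_eq (quotient_poly _ _) _.
by apply: zariskiS (zariskiT x) => y _ /=; rewrite pevalC.
Qed.

Lemma rational_coord m (x : 'rV[K]_m) i : rational_at (fun y => y 0 i) x.
Proof.
exists 'X_i, 1; apply: quotient_eq (quotient_poly _ _) _.
by apply: zariskiS (zariskiT x) => y _ /=; rewrite pevalX.
Qed.

Lemma rational_add m (F F' : 'rV[K]_m -> K) x : rational_at F x -> rational_at F' x ->
  rational_at (fun y => F y + F' y) x.
Proof. by move=> [P [Q h]] [P' [Q' h']]; do 2!eexists; apply: quotient_add h h'. Qed.

Lemma rational_mul m (F F' : 'rV[K]_m -> K) x : rational_at F x -> rational_at F' x ->
  rational_at (fun y => F y * F' y) x.
Proof. by move=> [P [Q h]] [P' [Q' h']]; do 2!eexists; apply: quotient_mul h h'. Qed.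

Lemma rational_inv m (F : 'rV[K]_m -> K) x : rational_at F x -> F x != 0 ->
  rational_at (fun y => (F y)^-1) x.
Proof. by move=> [P [Q h]] Fx; do 2!eexists; apply: quotient_inv h Fx. Qed.

Local Notation tmap g := (tuple_map (G := G) g).

Lemma rational_peval_comp m n (g : 'I_n -> 'rV[K]_m -> K) (P : {mpoly K[n]}) x :
  (forall i, rational_at (g i) x) -> rational_at (fun y => peval P (tmap g y)) x.
Proof.
move=> hg; elim/mpoly_gen_ind: P => [c|i|p q hp hq|p q hp hq].
- apply: rational_eq (rational_cst c x) _.
  by apply: zariskiS (zariskiT x) => y _ /=; rewrite pevalC.
- apply: rational_eq (hg i) _.
  by apply: zariskiS (zariskiT x) => y _ /=; rewrite pevalX mxE.
- apply: rational_eq (rational_add hp hq) _.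
  by apply: zariskiS (zariskiT x) => y _ /=; rewrite pevalD.
- apply: rational_eq (rational_mul hp hq) _.
  by apply: zariskiS (zariskiT x) => y _ /=; rewrite pevalM.
Qed.

Lemma zariski_cts m n (g : 'I_n -> 'rV[K]_m -> K) x O :
  (forall i, rational_at (g i) x) -> zariski_nb (tmap g x) O ->
  zariski_nb x [set y | O (tmap g y)].
Proof.
move=> hg [H [h1 h2]].
by apply: zariskiS (rational_neq0 (rational_peval_comp H hg) h1) => y /h2.
Qed.

Lemma rational_comp m n (g : 'I_n -> 'rV[K]_m -> K) F x :
  (forall i, rational_at (g i) x) -> rational_at F (tmap g x) ->
  rational_at (fun y => F (tmap g y)) x.
Proof.
move=> hg [P [Q [hQ hF]]].
apply: rational_eq (rational_mul (rational_peval_comp P hg)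
  (rational_inv (rational_peval_comp Q hg) hQ)) _.
exact: zariski_cts hg hF.
Qed.

(** Two presentations of F agree wherever both are valid, which is off the zeros of a nonzero
    polynomial. Over an infinite field this gives P Q' = P' Q identically, and differentiating that
    identity equates the two values of the quotient rule. *)
Lemma rational_pdE m (F : 'rV[K]_m -> K) x P Q i : is_quotient_at F x P Q ->
  rational_pd F x i = (peval P^`M(i) x * peval Q x - peval P x * peval Q^`M(i) x) / peval Q x ^+ 2.
Proof.
move=> h; rewrite /rational_pd; case: xgetP => [c _ [P' [Q' [h' ->]]]|]; last first.
  by move/(_ _ (ex_intro _ P (ex_intro _ Q (conj h erefl)))).
have [hQ [H [H1 H2]]] := h; have [hQ' [H' [H1' H2']]] := h'.
have neq0 (A : {mpoly K[m]}) : peval A x != 0 -> A != 0.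
  by apply: contra_neq => ->; rewrite /peval meval0.
have E : P * Q' = P' * Q.
  apply/eqP; rewrite -subr_eq0; apply: contraT => D0.
  have [y] : exists y, peval ((P * Q' - P' * Q) * (H * H' * (Q * Q'))) y != 0.
    by apply: peval_neq0; rewrite !mulf_neq0 // neq0.
  rewrite !pevalM !mulf_eq0 !negb_or => /andP[D1 /andP[/andP[k1 k2] /andP[k3 k4]]].
  move: D1; rewrite !pevalE; have := H2 y k1; rewrite /= (H2' y k2) => /eqP.
  by rewrite eqr_div // => /eqP E; rewrite E subrr eqxx.
have Ei := congr1 (fun A => peval A^`M(i) x) E.
rewrite /= !mderivM !pevalE in Ei.
have {}E := congr1 (fun A => peval A x) E; rewrite /= !pevalM in E.
apply/eqP; rewrite eqr_div ?expf_neq0 //; apply/eqP.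
move: (peval P x) (peval Q x) (peval P' x) (peval Q' x) (peval P^`M(i) x)
  (peval Q^`M(i) x) (peval P'^`M(i) x) (peval Q'^`M(i) x) E Ei => p q p' q' pi qi pi' qi' E Ei.
have -> : (pi' * q' - p' * qi') * q ^+ 2 =
  q * q' * (pi' * q + p' * qi) - q' * qi * (p' * q) - qi' * q * (p' * q) by ring.
rewrite -E -Ei; ring.
Qed.

Lemma quotient_pd m (F : 'rV[K]_m -> K) x P Q i : is_quotient_at F x P Q ->
  is_quotient_at (fun y => rational_pd F y i) x
    (P^`M(i) * Q - P * Q^`M(i)) (Q * Q).
Proof.
move=> h; split; first by have [hQ _] := h; rewrite pevalM mulf_neq0.
apply: zariskiS (quotient_near h) => y hy /=.
by rewrite (rational_pdE i hy) !pevalE expr2.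
Qed.

Lemma mderiv1 m (i : 'I_m) : (1 : {mpoly K[m]})^`M(i) = 0.
Proof. by rewrite -mpolyC1 mderivC. Qed.

Lemma rational_pd_poly m (P : {mpoly K[m]}) x i : rational_pd (peval P) x i = peval P^`M(i) x.
Proof.
rewrite (rational_pdE i (quotient_poly P x)) mderiv1 peval1 expr1n divr1 mulr1.
by rewrite /peval meval0 mulr0 subr0.
Qed.

Lemma rational_pd_eq m (F F' : 'rV[K]_m -> K) x i : rational_at F x ->
  zariski_nb x [set y | F' y = F y] -> rational_pd F' x i = rational_pd F x i.
Proof.
move=> [P [Q h]] hn.
by rewrite (rational_pdE i h) (rational_pdE i (quotient_eq h hn)).
Qed.

Lemma rational_pd_add m (F F' : 'rV[K]_m -> K) x i : rational_at F x -> rational_at F' x ->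
  rational_pd (fun y => F y + F' y) x i = rational_pd F x i + rational_pd F' x i.
Proof.
move=> [P [Q h]] [P' [Q' h']].
rewrite (rational_pdE i (quotient_add h h')) (rational_pdE i h) (rational_pdE i h').
rewrite !(mderivD, mderivM) !pevalE; field.
by have [-> _] := h; have [-> _] := h'.
Qed.

Lemma rational_pd_mul m (F F' : 'rV[K]_m -> K) x i : rational_at F x -> rational_at F' x ->
  rational_pd (fun y => F y * F' y) x i = rational_pd F x i * F' x + F x * rational_pd F' x i.
Proof.
move=> [P [Q h]] [P' [Q' h']].
rewrite (rational_pdE i (quotient_mul h h')) (rational_pdE i h) (rational_pdE i h').
rewrite (quotient_val h) (quotient_val h') !(mderivD, mderivM) !pevalE; field.
by have [-> _] := h; have [-> _] := h'.
Qed.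

Lemma rational_pd_cst m c (x : 'rV[K]_m) i : rational_pd (fun=> c) x i = 0.
Proof.
rewrite (_ : (fun=> c) = peval c%:MP); last by apply: funext => y; rewrite pevalC.
by rewrite rational_pd_poly mderivC /peval meval0.
Qed.

Lemma rational_pd_coord m (x : 'rV[K]_m) j i : rational_pd (fun y => y 0 j) x i = (j == i)%:R.
Proof.
rewrite (_ : (fun y : 'rV[K]_m => y 0 j) = peval 'X_j); last by apply: funext => y; rewrite pevalX.
by rewrite rational_pd_poly Arcs.mderivXU pevalC eq_sym.
Qed.

Lemma rational_pd_inv m (F : 'rV[K]_m -> K) x i : rational_at F x -> F x != 0 ->
  rational_pd (fun y => (F y)^-1) x i = - rational_pd F x i / F x ^+ 2.
Proof.
move=> [P [Q h]] Fx.
rewrite (rational_pdE i (quotient_inv h Fx)) (rational_pdE i h) (quotient_val h).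
field; have [-> _] := h.
by move: Fx; rewrite (quotient_val h) mulf_eq0 negb_or => /andP[-> _].
Qed.

Lemma rational_pd_peval_comp m n (g : 'I_n -> 'rV[K]_m -> K) (P : {mpoly K[n]}) x i :
  (forall j, rational_at (g j) x) ->
  rational_pd (fun y => peval P (tmap g y)) x i =
    \sum_l peval P^`M(l) (tmap g x) * rational_pd (g l) x i.
Proof.
move=> hg; elim/mpoly_gen_ind: P => [c|j|p q hp hq|p q hp hq].
- rewrite (_ : (fun y => _) = fun=> c); last by apply: funext => y; rewrite pevalC.
  rewrite rational_pd_cst big1 // => l _; rewrite mderivC.
  by rewrite /peval meval0 mul0r.
- rewrite (_ : (fun y => _) = g j); last by apply: funext => y; rewrite pevalX mxE.
  rewrite (bigD1 j) //= big1 ?addr0 => [|l lj]; rewrite Arcs.mderivXU pevalC.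
    by rewrite eqxx mul1r.
  by rewrite (negbTE lj) mul0r.
- rewrite (_ : (fun y => _) = fun y => peval p (tmap g y) + peval q (tmap g y)).
    rewrite rational_pd_add ?hp ?hq; try exact: rational_peval_comp.
    by rewrite -big_split; apply: eq_bigr => l _ /=; rewrite mderivD pevalD mulrDl.
  by apply: funext => y; rewrite pevalD.
- rewrite (_ : (fun y => _) = fun y => peval p (tmap g y) * peval q (tmap g y)).
    rewrite rational_pd_mul ?hp ?hq; try exact: rational_peval_comp.
    rewrite mulr_suml mulr_sumr -big_split; apply: eq_bigr => l _ /=.
    by rewrite mderivM !pevalE; ring.
  by apply: funext => y; rewrite pevalM.
Qed.

Lemma rational_pd_comp m n (g : 'I_n -> 'rV[K]_m -> K) F x i :
  (forall j, rational_at (g j) x) -> rational_at F (tmap g x) ->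
  rational_pd (fun y => F (tmap g y)) x i =
    \sum_l rational_pd F (tmap g x) l * rational_pd (g l) x i.
Proof.
move=> hg [P [Q h]]; have [hQ hF] := h.
have rP := rational_peval_comp P hg; have rQ := rational_peval_comp Q hg.
have E := @rational_pd_eq _ _ (fun y => F (tmap g y)) x i (rational_mul rP (rational_inv rQ hQ)).
rewrite E; last exact: zariski_cts hg hF.
rewrite rational_pd_mul //; last exact: rational_inv.
rewrite rational_pd_inv // !rational_pd_peval_comp //.
under [RHS]eq_bigr do rewrite (rational_pdE _ h).
move: (peval P _) (peval Q _) hQ => a b b0.
rewrite -sumrN !mulr_suml mulr_sumr -big_split; apply: eq_bigr => l _ /=.
by field.
Qed.

Lemma rational_pd_sym m (F : 'rV[K]_m -> K) x i j : rational_at F x ->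
  rational_pd (fun y => rational_pd F y i) x j = rational_pd (fun y => rational_pd F y j) x i.
Proof.
move=> [P [Q h]].
rewrite (rational_pdE j (quotient_pd i h)) (rational_pdE i (quotient_pd j h)).
rewrite !(mderivB, mderivD, mderivM) !pevalE (mderiv_comm i j P) (mderiv_comm i j Q).
by congr (_ / _); ring.
Qed.

Lemma algebraic_geometry_laws : geometry_laws G.
Proof.
split=> //.
- exact: zariskiT.
- exact: zariskiI.
- exact: zariskiS.
- exact: zariski_in.
- exact: zariski_open.
- by move=> m x i x0; apply: rational_neq0 => //; apply: rational_coord.
- exact: rational_near.
- exact: rational_eq.
- exact: zariski_cts.
- exact: rational_comp.
- exact: rational_cst.
- exact: rational_coord.
- exact: rational_add.
- exact: rational_mul.
- exact: rational_inv.
- move=> m F x i [P [Q h]]; do 2!eexists; exact: quotient_pd h.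
- exact: rational_pd_cst.
- by move=> m x j i; rewrite [LHS]rational_pd_coord.
- exact: rational_pd_add.
- exact: rational_pd_mul.
- exact: rational_pd_eq.
- exact: rational_pd_comp.
- exact: rational_pd_sym.
Qed.

End Laws.
End AlgebraicLaws.

(** * Algebraic curves with given coordinates *)

Module AlgebraicCurves.
Import mpoly Nullstellensatz AlgebraicLaws.
Local Open Scope ring_scope.
Local Open Scope classical_set_scope.

Section PolynomialMaps.
Variable K : fieldType.
Hypothesis char0 : forall n, n.+1%:R != 0 :> K.
Local Notation G := (algebraic_geometry K).

Lemma peval0 m (x : 'rV[K]_m) : peval 0 x = 0.
Proof. exact: meval0. Qed.

Lemma rational_poly m (P : {mpoly K[m]}) x : rational_at (peval P) x.
Proof. by exists P, 1; apply: quotient_poly. Qed.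

Lemma rational_sum m (I : Type) (s : seq I) (F : I -> 'rV[K]_m -> K) x :
  (forall i, rational_at (F i) x) -> rational_at (fun y => \sum_(i <- s) F i y) x.
Proof.
move=> h; elim: s => [|a s IH].
  apply: rational_eq (rational_cst 0 x) _.
  by apply: zariskiS (zariskiT x) => y _ /=; rewrite big_nil.
apply: rational_eq (rational_add (h a) IH) _.
by apply: zariskiS (zariskiT x) => y _ /=; rewrite big_cons.
Qed.

Lemma hadamard m (F : {mpoly K[m]}) a : exists A : 'I_m -> {mpoly K[m]},
  (forall z, peval F z - peval F a = \sum_i peval (A i) z * (z 0 i - a 0 i)) /\
  forall i, peval (A i) a = peval F^`M(i) a.
Proof.
elim/mpoly_gen_ind: F => [c|j|F F' [A [h1 h2]] [A' [h1' h2']]|F F' [A [h1 h2]] [A' [h1' h2']]].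
- exists (fun=> 0%:MP); split=> [z|i]; last by rewrite mderivC mpolyC0.
  by rewrite !pevalC subrr big1 // => i _; rewrite mul0r.
- exists (fun i => (i == j)%:R%:MP); split=> [z|i]; last by rewrite Arcs.mderivXU.
  rewrite !pevalX (bigD1 j) //= big1 ?addr0 => [|i /negbTE ij].
    by rewrite eqxx pevalC mul1r.
  by rewrite ij pevalC mul0r.
- exists (fun i => A i + A' i); split=> [z|i]; last by rewrite mderivD !pevalE h2 h2'.
  under eq_bigr do rewrite pevalD mulrDl.
  by rewrite big_split /= -h1 -h1' !pevalD; ring.
- exists (fun i => A i * F' + (peval F a)%:MP * A' i); split=> [z|i].
    rewrite !pevalM (_ : _ - _ = (peval F z - peval F a) * peval F' z
      + peval F a * (peval F' z - peval F' a)); last by ring.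
    rewrite h1 h1' mulr_suml mulr_sumr -big_split; apply: eq_bigr => i _ /=.
    by rewrite !pevalE; ring.
  by rewrite mderivM !pevalE h2 h2'; ring.
Qed.

Section Jacobian.
Variables (N : nat) (F : 'I_N -> {mpoly K[N]}).

Definition jacobian (z : 'rV[K]_N) : 'M[K]_N := \matrix_(l, i) peval (F l)^`M(i) z.

Lemma jacobian_det : exists D : {mpoly K[N]}, forall z, peval D z = \det (jacobian z).
Proof.
exists (\det (\matrix_(l, i) (F l)^`M(i))) => z; rewrite /peval -det_map_mx.
by congr (\det _); apply/matrixP => l i; rewrite !mxE.
Qed.

Lemma jacobian_adj i j : exists D : {mpoly K[N]}, forall z, peval D z = \adj (jacobian z) i j.
Proof.
exists ((\adj (\matrix_(l, i) (F l)^`M(i))) i j) => z.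
rewrite (_ : jacobian z = map_mx (meval (fun i => z 0 i)) (\matrix_(l, i) (F l)^`M(i))).
  by rewrite -map_mx_adj [RHS]mxE.
by apply/matrixP => l i'; rewrite !mxE.
Qed.

Lemma rational_invmx z i j : jacobian z \in unitmx ->
  rational_at (fun y => invmx (jacobian y) i j) z.
Proof.
move=> hz; have [D hD] := jacobian_det; have [A hA] := jacobian_adj i j.
have Dz : peval D z != 0 by rewrite hD -unitfE.
apply: rational_eq (rational_mul (rational_inv (rational_poly D z) Dz) (rational_poly A z)) _.
apply: zariskiS (zariski_poly Dz) => y /=; rewrite hD hA => Dy.
by rewrite /invmx unitmxE unitfE Dy mxE.
Qed.

End Jacobian.
End PolynomialMaps.

(** * The curve F(z) = w(t) over the parameter line *)

Section GraphCurve.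
Variable K : closedFieldType.
Hypothesis char0 : forall n, n.+1%:R != 0 :> K.
Local Notation G := (algebraic_geometry K).
Variables (N : nat) (F : 'I_N -> {mpoly K[N]}) (w : 'I_N -> {poly K}).
Variables (O : set 'rV[K]_N) (a : 'rV[K]_N).
Hypothesis hO : forall z, O z -> zariski_nb z O.
Hypothesis Oa : O a.
Hypothesis Fa : forall l, peval (F l) a = (w l).[0].
Hypothesis Ja : jacobian F a \in unitmx.

Local Notation gz := (fun (i : 'I_N) (s : 'rV[K]_(1 + N)) => s 0 (rshift 1 i)).
Local Notation zc := (tuple_map (G := G) gz).
Local Notation tc := (fun s : 'rV[K]_(1 + N) => s 0 (lshift N 0)).

Lemma lift_space (P : {mpoly K[N]}) : exists Q : {mpoly K[1 + N]},
  [/\ forall s, peval Q s = peval P (zc s),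
      forall s i, peval Q^`M(rshift 1 i) s = peval P^`M(i) (zc s) &
      forall s, peval Q^`M(lshift N 0) s = 0].
Proof.
elim/mpoly_gen_ind: P => [c|j|P P' [Q [h1 h2 h3]] [Q' [h1' h2' h3']]|P P' [Q [h1 h2 h3]] [Q' [h1' h2' h3']]].
- exists c%:MP; split=> [s|s i|s]; first by rewrite !pevalC.
    by rewrite !mderivC !peval0.
  by rewrite !mderivC !peval0.
- exists 'X_(rshift 1 j); split=> [s|s i|s]; first by rewrite !pevalX mxE.
    by rewrite !Arcs.mderivXU !pevalC (inj_eq (@rshift_inj _ _)).
  by rewrite Arcs.mderivXU pevalC eq_lrshift.
- exists (Q + Q'); split=> [s|s i|s].
  + by rewrite !pevalD h1 h1'.
  + by rewrite !mderivD !pevalD h2 h2'.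
  + by rewrite !mderivD !pevalD h3 h3' addr0.
- exists (Q * Q'); split=> [s|s i|s].
  + by rewrite !pevalM h1 h1'.
  + by rewrite !mderivM !pevalE h1 h1' h2 h2'.
  + by rewrite !mderivM !pevalE h3 h3' mul0r mulr0 addr0.
Qed.

Lemma lift_time (P : {poly K}) : exists Q : {mpoly K[1 + N]},
  [/\ forall s, peval Q s = P.[tc s],
      forall s (i : 'I_N), peval Q^`M(rshift 1 i) s = 0 &
      forall s, peval Q^`M(lshift N 0) s = P^`().[tc s]].
Proof.
elim/poly_ind: P => [|P c [Q [h1 h2 h3]]].
  exists 0; split=> [s|s i|s]; rewrite ?raddf0 ?peval0 ?deriv0 ?horner0 //.
exists (Q * 'X_(lshift N 0) + c%:MP); split=> [s|s i|s].
- by rewrite !pevalE h1 hornerMXaddC.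
- rewrite mderivD mderivC addr0 mderivM !pevalE h2 mul0r add0r.
  by rewrite Arcs.mderivXU pevalC eq_rlshift mulr0.
- rewrite mderivD mderivC addr0 mderivM !pevalE h1 h3.
  by rewrite Arcs.mderivXU pevalC eqxx mulr1 derivMXaddC hornerD hornerMX addrC.
Qed.

Lemma graph_equations : exists g : 'I_N -> {mpoly K[1 + N]}, forall l,
  [/\ forall s, peval (g l) s = peval (F l) (zc s) - (w l).[tc s],
      forall s i, peval (g l)^`M(rshift 1 i) s = jacobian F (zc s) l i &
      forall s, peval (g l)^`M(lshift N 0) s = - (w l)^`().[tc s]].
Proof.
have h l : exists g : {mpoly K[1 + N]},
  [/\ forall s, peval g s = peval (F l) (zc s) - (w l).[tc s],
      forall s i, peval g^`M(rshift 1 i) s = jacobian F (zc s) l i &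
      forall s, peval g^`M(lshift N 0) s = - (w l)^`().[tc s]].
  have [Q [h1 h2 h3]] := lift_space (F l); have [Q' [h1' h2' h3']] := lift_time (w l).
  exists (Q - Q'); split=> [s|s i|s].
  - by rewrite !pevalE h1 h1'.
  - by rewrite mderivB !pevalE h2 h2' subr0 mxE.
  - by rewrite mderivB !pevalE h3 h3' add0r.
by have /choice[g hg] := h; exists g.
Qed.

(* By Hadamard's lemma F(z) - F(a) = A(z) (z - a), so a is the only zero of
   F - F(a) on the set [E != 0], where E = det A. *)
Lemma isolated_point : exists E : {mpoly K[N]}, peval E a != 0 /\
  forall z, peval E z != 0 -> (forall l, peval (F l) z = peval (F l) a) -> z = a.
Proof.
have /choice[A hA] := fun l => hadamard (F l) a.
pose M z : 'M[K]_N := \matrix_(l, i) peval (A l i) z.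
have hE z : peval (\det (\matrix_(l, i) A l i)) z = \det (M z).
  rewrite /peval -det_map_mx; congr (\det _); by apply/matrixP => l i; rewrite !mxE.
exists (\det (\matrix_(l, i) A l i)); split.
  rewrite hE (_ : M a = jacobian F a) -?unitfE //.
  by apply/matrixP => l i; rewrite !mxE; have [_ ->] := hA l.
move=> z; rewrite hE -unitfE => Mz hz.
have E0 : M z *m (z - a)^T = 0.
  apply/matrixP => l j; rewrite !mxE ord1.
  have [h _] := hA l; have := h z; rewrite hz subrr => e0.
  rewrite [RHS]e0.
  by apply: eq_bigr => i _; rewrite !mxE.
have := congr1 (mulmx (invmx (M z))) E0; rewrite mulKmx // mulmx0 => /(congr1 trmx).
by rewrite trmxK trmx0 => /eqP; rewrite subr_eq0 => /eqP.
Qed.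

Local Notation dw := (fun t : K => \col_l (w l)^`().[t]).

(** Where the Jacobian of F is invertible, the curve of pairs (t, z) with F(z) = w(t) is etale over
    the t-line, and d/dt lifts to (1, J^{-1} w'(t)). Removing the zeros of E from [isolated_point]
    leaves (0, a) as the only point over t = 0. *)
Lemma graph_curve (WS V : set 'rV[K]_N) (X Y : 'rV[K]_N -> K) (P Q : {poly K}) :
  (forall z t, O z -> jacobian F z \in unitmx -> (forall l, peval (F l) z = (w l).[t]) ->
    [/\ WS z, V z, X z = P.[t] & Y z = Q.[t]]) ->
  exists m (W : set 'rV[K]_m) xi tau Gam o,
    curve_model (G := G) WS V X Y P Q a W xi tau Gam o.
Proof.
move=> hXY; have [g hg] := graph_equations.
have hg1 l := let: And3 h _ _ := hg l in h.
have hg2 l := let: And3 _ h _ := hg l in h.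
have hg3 l := let: And3 _ _ h := hg l in h.
have [D hD] := jacobian_det F; have [E [Ea hE]] := isolated_point.
pose O' : set 'rV[K]_(1 + N) :=
  [set s | [/\ O (zc s), peval D (zc s) != 0 & peval E (zc s) != 0]].
pose W : set 'rV[K]_(1 + N) := [set s | O' s /\ forall l, peval (g l) s = 0].
pose xi s : 'rV[K]_(1 + N) := row_mx (const_mx 1) (invmx (jacobian F (zc s)) *m dw (tc s))^T.
have WJ s : W s -> jacobian F (zc s) \in unitmx.
  by move=> [[_ Ds _] _]; rewrite unitmxE -hD unitfE.
have Wg s l : W s -> peval (F l) (zc s) = (w l).[tc s].
  by move=> [_ /(_ l)]; rewrite hg1 => /eqP; rewrite subr_eq0 => /eqP.
have O'nb s : O' s -> zariski_nb s O'.
  move=> [h1 h2 h3]; apply: (@zariski_cts _ _ _ gz s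
    [set z | [/\ O z, peval D z != 0 & peval E z != 0]]).
    by move=> i; apply: rational_coord.
  apply: zariskiS (zariskiI (hO h1) (zariskiI (zariski_poly h2) (zariski_poly h3))).
  by move=> z [? []].
have xi0 s : xi s 0 (lshift N 0) = 1 by rewrite row_mxEl mxE.
have xiN s i : xi s 0 (rshift 1 i) = (invmx (jacobian F (zc s)) *m dw (tc s)) i 0.
  by rewrite row_mxEr mxE.
have gxi s l : W s -> \sum_i peval (g l)^`M(i) s * xi s 0 i = 0.
  move=> Ws; rewrite big_split_ord /= big_ord1 hg3 xi0 mulr1.
  apply/eqP; rewrite addrC subr_eq0; apply/eqP.
  transitivity ((jacobian F (zc s) *m (invmx (jacobian F (zc s)) *m dw (tc s))) l 0).
    by rewrite mxE; apply: eq_bigr => i _; rewrite hg2 xiN.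
  by rewrite mulKVmx ?WJ // mxE.
pose o : 'rV[K]_(1 + N) := row_mx 0 a.
have oz : zc o = a by apply/rowP => i; rewrite mxE row_mxEr.
have ot : tc o = 0 by rewrite row_mxEl mxE.
have rJ s : W s -> \rank (\matrix_(l < N, i < 1 + N) peval (g l)^`M(i) s) = N.
  move=> Ws; rewrite (_ : \matrix_(l, i) _ = row_mx (\col_l peval (g l)^`M(lshift N 0) s)
      (jacobian F (zc s))).
    apply/eqP; rewrite eqn_leq rank_leq_row /= -{1}(mxrank_unit (WJ _ Ws)).
    rewrite -{1}[jacobian F (zc s)](_ : row_mx (\col_l peval (g l)^`M(lshift N 0) s)
      (jacobian F (zc s)) *m col_mx 0 1%:M = _) ?mxrankM_maxl //.
    by rewrite mul_row_col mulmx0 mulmx1 add0r.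
  apply/matrixP => l i; case: (split_ordP i) => j ->; rewrite mxE.
    by rewrite row_mxEl mxE ord1.
  by rewrite row_mxEr hg2.
have hW : jacobian_model 1 W by exists N, g, O'; split.
exists (1 + N)%N, W, xi, (fun s => tc s), gz, o; split.
- exact: hW.
- move=> s Ws i; case: (split_ordP i) => j ->.
    apply: rational_eq (rational_cst 1 s) _.
    by apply: zariskiS (zariskiT s) => y _ /=; rewrite ord1 xi0.
  have [D' hD'] := choice (fun l => lift_time (w l)^`()).
  have hJ l : rational_at (fun s => invmx (jacobian F (zc s)) j l) s.
    apply: (rational_comp (g := gz) (F := fun z => invmx (jacobian F z) j l)) => [i'|].
      exact: rational_coord.
    by apply: rational_invmx; apply: WJ.
  apply: rational_eq (rational_sum _ (fun l => rational_mul (hJ l) (rational_poly (D' l) s))) _.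
  apply: zariskiS (zariskiT s) => y _ /=; rewrite xiN mxE; apply: eq_bigr => l _.
  by have [-> _ _] := hD' l; rewrite !mxE.
(* [zero_locus_tangent] needs a polynomial that vanishes on the whole zero locus of g, not only near
   s. So the numerator P1 is multiplied by R, which is nonzero at s and vanishes wherever the
   presentation of H, its vanishing or membership in W is not guaranteed. As P1(s) = 0, the factor R
   only scales the derivative. *)
- move=> s Ws H [P1 [Q1 h]] [k [ks hk]].
  have [Q1s [h' [h's hh']]] := h.
  have [[Os Ds Es] gs] := Ws; have [o1 [o1s ho1]] := hO Os.
  have [R0 [hR0 _ _]] := lift_space (o1 * (D * E)).
  pose R := Q1 * h' * (k * R0).
  have Rs : peval R s != 0 by rewrite !pevalM hR0 !pevalM !mulf_neq0.
  have P1s : peval P1 s = 0.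
    have := hk _ ks Ws; rewrite (quotient_val h) => /eqP.
    by rewrite mulf_eq0 invr_eq0 (negbTE Q1s) orbF => /eqP.
  have := @Arcs.zero_locus_tangent K (1 + N) N char0 g (fun i => s 0 i)
    (fun i => xi s 0 i) (P1 * R) gs (rJ _ Ws) (fun l => gxi _ l Ws).
  have hz : forall z, (forall l, (g l).@[z] = 0) -> (P1 * R).@[z] = 0.
    move=> z hz; pose z' : 'rV[K]_(1 + N) := \row_i z i.
    have zE (A : {mpoly K[1 + N]}) : A.@[z] = peval A z'.
      by apply: meval_eq => i; rewrite mxE.
    rewrite zE pevalM; apply/eqP; rewrite mulf_eq0.
    case: (eqVneq (peval R z') 0) => [|R0z]; first by rewrite orbT.
    rewrite orbF; move: R0z; rewrite !pevalM hR0 !pevalM !mulf_eq0 !negb_or.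
    move=> /andP[/andP[q1 q2] /andP[q3 /andP[q4 /andP[q5 q6]]]].
    have Wz : W z'.
      split=> [|l]; last by rewrite -zE.
      by split=> //; apply: ho1.
    have := hk _ q3 Wz; rewrite (hh' _ q2) => /eqP.
    by rewrite mulf_eq0 invr_eq0 (negbTE q1) orbF.
  move=> /(_ hz) E0.
  apply: (mulfI Rs); rewrite mulr0 -[RHS](mul0r (peval Q1 s)^-1) -{2}E0 mulr_sumr mulr_suml.
  apply: eq_bigr => i _; rewrite /= (rational_pdE char0 i h) P1s mul0r subr0.
  rewrite -/(peval _ s) mderivM !pevalE P1s mul0r addr0.
  by move: (peval Q1 s) (peval P1^`M(i) s) (peval R s) Q1s => q p r q0; field.
- by move=> s _; apply: rational_coord.
- move=> s _; rewrite big_split_ord /= big_ord1 xi0 big1 ?addr0 => [|i _].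
    by rewrite (rational_pd_coord char0) eqxx mulr1.
  by rewrite (rational_pd_coord char0) eq_lrshift mul0r.
(* Applying v to the equations g_l = 0 gives J v(z) = v(t) w'(t). With J invertible, v is therefore
   v(t) times xi. *)
- move=> s v tv i.
  have gK l : \sum_i peval (g l)^`M(i) (sval s) *
      v (fun y : model_space (G := G) W => sval y 0 i) = 0.
    have HG := algebraic_geometry_laws char0; have HM := @model_laws _ HG 1 _ W hW.
    have E0 (y : model_space (G := G) W) :
        tuple_map (G := G) (fun i (y : model_space (G := G) W) => sval y 0 i) y = sval y.
      by apply/rowP => i'; rewrite mxE.
    rewrite -[RHS](tan_cst HG HM tv 0).
    rewrite (tan_comp tv (g := fun i y => sval y 0 i) (F := peval (g l))).
    - by rewrite E0; apply: eq_bigr => i' _ /=; rewrite (rational_pd_poly char0).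
    - move=> i'; apply: (model_reg_sval HG (F := fun z => z 0 i')); exact: rational_coord.
    - exact: rational_poly.
    - by apply: (nb_refl HM) => -[y Wy] /=; rewrite E0; case: Wy.
  case: (split_ordP i) => j ->; first by rewrite ord1 xi0 mul1r.
  pose vz : 'cV[K]_N := \col_i v (fun y : model_space (G := G) W => sval y 0 (rshift 1 i)).
  pose vt := v (fun y : model_space (G := G) W => sval y 0 (lshift N 0)).
  have Ez : jacobian F (zc (sval s)) *m vz = vt *: dw (tc (sval s)).
    apply/colP => l; have := gK l; rewrite big_split_ord /= big_ord1 hg3.
    rewrite mulNr addrC => /eqP; rewrite subr_eq0 => /eqP e1.
    rewrite !mxE mulrC -e1; apply: eq_bigr => i' _; by rewrite hg2 !mxE.
  have := congr1 (mulmx (invmx (jacobian F (zc (sval s))))) Ez.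
  rewrite mulKmx ?(WJ _ (svalP s)) // -scalemxAr => /colP/(_ j).
  by rewrite xiN mxE => ->; rewrite mxE mulrC.
- by move=> s _ i; apply: rational_coord.
- move=> s Ws; have [|//] := hXY (zc s) (tc s) _ (WJ _ Ws) (fun l => Wg _ _ Ws).
  by have [[]] := Ws.
- move=> s Ws; have [|//] := hXY (zc s) (tc s) _ (WJ _ Ws) (fun l => Wg _ _ Ws).
  by have [[]] := Ws.
- split=> [|l]; last by rewrite hg1 oz ot Fa subrr.
  by rewrite /O' /= oz hD -unitfE -unitmxE.
- exact: ot.
- exact: oz.
- move=> s Ws s0; rewrite -[s]hsubmxK; congr row_mx.
    by apply/rowP => i; rewrite ord1 !mxE.
  have <- : zc s = a.
    by apply: hE => [|l]; [have [[]] := Ws|rewrite (Wg _ _ Ws) s0 Fa].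
  by apply/rowP => i; rewrite !mxE.
Qed.

End GraphCurve.

Section AlgebraicCurves.
Variable K : closedFieldType.
Hypothesis char0 : forall n, n.+1%:R != 0 :> K.
Local Notation G := (algebraic_geometry K).

(** Provides linear forms whose differentials complete those of the equations to a basis; they serve
    as coordinates on the surface near p. *)
Lemma complement_rows (n r : nat) (J : 'M[K]_(r, n + r)) : \rank J = r ->
  exists B : 'M[K]_(n, n + r), col_mx B J \in unitmx.
Proof.
move=> rJ; have E : \rank (J^C)%MS = n by rewrite mxrank_compl rJ addnK.
exists (castmx (E, erefl) (row_base (J^C)%MS)).
rewrite -row_full_unit -sub1mx.
have /submx_trans -> // : (1%:M <= J^C + J)%MS.
  by rewrite addsmxC sub1mx addsmx_compl_full.
by rewrite -addsmxE addsmxS // eqmx_cast eq_row_base.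
Qed.

(** F consists of two linear forms followed by the equations f of S. The inverse Jacobian expresses
    every differential on S through the two forms, as v kills the f_l. Taking w = 0 in the slots of
    f keeps the graph curve on S. *)
Lemma algebraic_curves (S : gspace G) (HS : is_manifold 2 S) (p : S) :
  exists (U : set S) (x y : S -> gK G),
  [/\ U p, coframe (@tangent G S : distribution S) x y U & base_curves p U x y].
Proof.
have HG := algebraic_geometry_laws char0.
have HL := manifold_laws HG HS.
have [U [m [e [W [Up ch]]]]] := HS p.
have [[r [f [O [mr hO WE rJ]]]] hU [_ eW] hn hr] := ch.
subst m.
have Wp : W (e p) by rewrite -eW; exists p.
have [B hB] := complement_rows (rJ _ Wp).
pose X (j : 'I_2) : {mpoly K[2 + r]} := \sum_i (B j i)%:MP * 'X_i.
pose F (l : 'I_(2 + r)) := match fintype.split l with inl j => X j | inr l => f l end.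
have FX j : F (lshift r j) = X j.
  by rewrite /F (_ : fintype.split _ = inl j) //; apply: (unsplitK (inl j)).
have Ff l : F (rshift 2 l) = f l.
  by rewrite /F (_ : fintype.split _ = inr l) //; apply: (unsplitK (inr l)).
have Ja : jacobian F (e p) \in unitmx.
  rewrite (_ : jacobian F (e p) = col_mx B (\matrix_(l, i) peval (f l)^`M(i) (e p))) //.
  apply/matrixP => l i; case: (split_ordP l) => j ->; rewrite mxE ?FX ?Ff.
    rewrite col_mxEu /X raddf_sum /peval raddf_sum (bigD1 i) //= big1 ?addr0 => [|i' ii'].
      by rewrite mderivM mderivC mul0r add0r Arcs.mderivXU eqxx rmorphM /= !mevalC mulr1.
    by rewrite mderivM mderivC mul0r add0r Arcs.mderivXU eq_sym (negbTE ii') rmorphM /= !mevalC mulr0.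
  by rewrite col_mxEd mxE.
pose V : set 'rV[K]_(2 + r) := [set z | jacobian F z \in unitmx].
have hV z : V z -> zariski_nb z V.
  have [D hD] := jacobian_det F.
  rewrite /V /= unitmxE unitfE -hD => Dz; apply: zariskiS (zariski_poly Dz) => y /=.
  by rewrite hD unitmxE unitfE.
have hc q i : U q -> reg (fun q' => e q' 0 i) q.
  move=> Uq; apply/(hr _ Uq); exists (fun z => z 0 i); split; first exact: rational_coord.
  exact: (nb_refl HL).
have E q : tuple_map (G := G) (fun i q' => e q' 0 i) q = e q by apply/rowP => i; rewrite mxE.
have he H q : U q -> rational_at H (e q) -> reg (fun q' => H (e q')) q.
  by move=> Uq hH; apply/(hr _ Uq); exists H; split=> //; apply: (nb_refl HL).
exists (U `&` (e @^-1` V)), (peval (X 0) \o e), (peval (X 1) \o e); split=> //.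
- split=> [q [Uq Vq]|q [Uq Vq]].
    apply: (nbI HL); first exact: hU.
    have := reg_cts HL (g := fun i q' => e q' 0 i) (fun i => hc q i Uq) (O := V).
    by rewrite E => /(_ (hV _ Vq)); apply: (nbS HL) => y /=; rewrite E.
  split; [exact: he (rational_poly _ _)|exact: he (rational_poly _ _)|].
  move=> h /(hr _ Uq)[H [hH hh]].
  pose c j q' := \sum_i gpd (g := G) H (e q') i * invmx (jacobian F (e q')) i (lshift r j).
  have hcr j : reg (c j) q.
    apply: (he (fun z => \sum_i gpd (g := G) H z i * invmx (jacobian F z) i (lshift r j))) => //.
    apply: rational_sum => i; apply: rational_mul; first exact: (gpd_reg HG).
    exact: rational_invmx.
  exists (c 0), (c 1); split=> //.
  have nH : nb q [set y | rational_at H (e y)].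
    have := reg_cts HL (g := fun i q' => e q' 0 i) (fun i => hc q i Uq)
      (O := [set z | rational_at H z]).
    by rewrite E => /(_ (rational_near hH)); apply: (nbS HL) => y /=; rewrite E.
  have nV : nb q [set y | V (e y)].
    have := reg_cts HL (g := fun i q' => e q' 0 i) (fun i => hc q i Uq) (O := V).
    by rewrite E => /(_ (hV _ Vq)); apply: (nbS HL) => y /=; rewrite E.
  apply: (nbS HL) (nbI HL (nbI HL nH nV) (nbI HL (hU _ Uq) (nb_open HL hh))).
  move=> y [[Hy Vy] [Uy hy]] v tv.
  have vP (H' : 'rV[K]_(2 + r) -> K) h' : rational_at H' (e y) ->
      nb y [set z | h' z = H' (e z)] ->
      v h' = \sum_i rational_pd H' (e y) i * v (fun q' => e q' 0 i).
    move=> hH' hh'; rewrite (tan_comp tv (g := fun i q' => e q' 0 i) (F := H')).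
    - by rewrite E.
    - by move=> i; apply: hc.
    - by rewrite E.
    - by apply: (nbS HL) hh' => z /= ->; rewrite E.
  pose ve : 'cV[K]_(2 + r) := \col_i v (fun q' => e q' 0 i).
  have Jv : jacobian F (e y) *m ve = \col_l v (peval (F l) \o e).
    apply/colP => l; rewrite !mxE (vP (peval (F l))).
    - by apply: eq_bigr => i _; rewrite !mxE (rational_pd_poly char0).
    - exact: rational_poly.
    - exact: (nb_refl HL).
  have vf l : v (peval (f l) \o e) = 0.
    rewrite -(tan_cst HG HL tv 0); apply: (tan_near_nreg HG HL tv).
    apply: (nbS HL) (hU _ Uy) => z Uz /=.
    have : W (e z) by rewrite -eW; exists z.
    by rewrite WE => -[_ ->].
  have vE i : v (fun q' => e q' 0 i) =
      invmx (jacobian F (e y)) i (lshift r 0) * v (peval (X 0) \o e) +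
      invmx (jacobian F (e y)) i (lshift r 1) * v (peval (X 1) \o e).
    have := congr1 (mulmx (invmx (jacobian F (e y)))) Jv.
    rewrite mulKmx // => /colP/(_ i); rewrite mxE => ->.
    rewrite mxE big_split_ord /= [X in _ + X]big1 => [|l _]; last by rewrite mxE Ff vf mulr0.
    rewrite addr0 big_ord_recl big_ord1 !mxE !FX.
    by congr (_ + invmx _ _ (lshift _ _) * v (peval (X _) \o e)); apply: val_inj.
  rewrite (vP H) // /c !mulr_suml -big_split; apply: eq_bigr => i _ /=.
  by rewrite vE; ring.
apply: (base_curves_model HG HL (X := peval (X 0)) (Y := peval (X 1)) ch Up) => P Q P0 Q0.
pose w (l : 'I_(2 + r)) : {poly K} :=
  match fintype.split l with inl j => if j == 0 then P else Q | inr _ => 0 end.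
have wX j : w (lshift r j) = if j == 0 then P else Q.
  by rewrite /w (_ : fintype.split _ = inl j) //; apply: (unsplitK (inl j)).
have wf l : w (rshift 2 l) = 0.
  by rewrite /w (_ : fintype.split _ = inr l) //; apply: (unsplitK (inr l)).
rewrite WE in Wp; have [Op fp] := Wp.
apply: (graph_curve char0 (F := F) (w := w) hO Op) => //.
- move=> l; case: (split_ordP l) => j ->; rewrite ?FX ?Ff ?wX ?wf ?horner0 //.
  case: (eqVneq j 0) => [->|j0]; first by rewrite P0.
  suff -> : j = 1 by rewrite Q0.
  by apply: val_inj; case: j j0 => -[|[|]].
- move=> z t Oz Jz Fz; split=> //.
  + rewrite WE; split=> // l; have := Fz (rshift 2 l); by rewrite Ff wf horner0.
  + by rewrite -FX Fz wX.
  + by rewrite -FX Fz wX.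
Qed.

End AlgebraicCurves.
End AlgebraicCurves.

From mathcomp Require Import reals topology normedtype derive landau.
Import numFieldNormedType.Exports.

(** * Differentiable functions *)

Section Differentiability.
Variable K : numFieldType.

Lemma differentiable_near0 (V W : normedModType K) (g : V -> W) (x : V) :
  (\near x, g x = 0) -> differentiable g x.
Proof.
move=> hg.
have h : continuous (\0 : V -> W) /\ g \o shift x = cst (g x) + \0 +o_ 0 id.
  split; first exact: cst_continuous.
  apply/eqaddoP => e e0; rewrite [\forall x \near _, _ <= _](near_shift x) sub0r.
  near=> y; rewrite !fctE /= subrK (near hg y) // (nbhs_singleton hg) addr0 subrr normr0.
  by rewrite mulr_ge0 // ltW.
apply/diff_locallyP.
have -> : 'd g x = \0 :> (V -> W) by apply/diff_unique; case: h.
exact: h.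
Unshelve. all: by end_near. Qed.

Lemma differentiable_near_eq (V W : normedModType K) (f g : V -> W) (x : V) :
  (\near x, g x = f x) -> differentiable f x -> differentiable g x.
Proof.
move=> hg hf; rewrite (_ : g = f + (g - f)); last by rewrite addrC subrK.
apply: differentiableD => //; apply: differentiable_near0.
by apply: filterS hg => y; rewrite !fctE => ->; rewrite subrr.
Qed.

Implicit Types (m n l : nat).

Lemma differentiable_tuple_map m n (g : 'I_n -> 'rV[K]_m -> K) x :
  (forall i, differentiable (g i) x) -> differentiable (tuple_map (G := smooth_geometry K) g) x.
Proof.
move=> hg.
have -> : tuple_map (G := smooth_geometry K) g =
    \sum_(i < n) (fun y => g i y *: (delta_mx 0 i : 'rV[K]_n)).
  apply: funext => y; apply/rowP => j; rewrite fct_sumE !mxE summxE.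
  rewrite (bigD1 j) //= big1 ?addr0 => [|i ij]; rewrite !mxE ?eqxx ?mulr1 //.
  by rewrite eq_sym (negbTE ij) andbF mulr0.
by apply: differentiable_sum => i; apply: differentiableZl.
Qed.

Lemma diff_coord n (x : 'rV[K]_n) (i : 'I_n) (v : 'rV[K]_n) :
  'd (fun N : 'rV[K]_n => N 0 i) x v = v 0 i.
Proof.
have @f : {linear 'rV[K]_n -> K}.
  by exists (fun N : 'rV[K]_n => N 0 i); do 2![eexists]; do ?[constructor];
     rewrite ?mxE // => ? *; rewrite ?mxE //; move=> ?; rewrite !mxE.
rewrite (_ : (fun N : 'rV[K]_n => N 0 i) = f) // diff_lin //.
exact: coord_continuous.
Qed.

Local Notation tmap g := (tuple_map (G := smooth_geometry K) g).

Lemma diff_tuple_map m n (g : 'I_n -> 'rV[K]_m -> K) x v :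
  (forall i, differentiable (g i) x) ->
  'd (tuple_map (G := smooth_geometry K) g) x v = \row_i 'd (g i) x v.
Proof.
move=> hg; have ht := differentiable_tuple_map hg.
apply/rowP => i; rewrite mxE -(diff_coord (tmap g x) i).
rewrite -[LHS]/(('d (fun N : 'rV[K]_n => N 0 i) (tmap g x) \o 'd (tmap g) x) v).
rewrite -(diff_comp ht (differentiable_coord _ _ _)).
by rewrite (_ : _ \o _ = g i) //; apply: funext => y; rewrite /= mxE.
Qed.

Lemma partialE m (F : 'rV[K]_m -> K) x i : differentiable F x ->
  partial F x i = 'd F x (delta_mx 0 i).
Proof. by move=> h; rewrite /partial deriveE. Qed.

Lemma dupto_differentiable l m (F : 'rV[K]_m -> K) U x :
  differentiable_upto l F U -> U x -> differentiable F x.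
Proof. by case: l => [|l] [h _]; apply: h. Qed.

Lemma dupto_le l m (F : 'rV[K]_m -> K) U :
  differentiable_upto l.+1 F U -> differentiable_upto l F U.
Proof.
elim: l F => [|l IH] F [h1 h2]; split=> // i; apply: IH; exact: h2.
Qed.

Lemma dupto_sub l m (F : 'rV[K]_m -> K) U V : V `<=` U ->
  differentiable_upto l F U -> differentiable_upto l F V.
Proof.
move=> VU; elim: l F => [|l IH] F [h1 h2]; split=> //.
- by move=> x /VU; apply: h1.
- by move=> x /VU; apply: h1.
- by move=> i; apply: IH; apply: h2.
Qed.

Lemma open_near m (U : set 'rV[K]_m) x (P : set 'rV[K]_m) : open U -> U x ->
  (forall y, U y -> P y) -> \near x, P x.
Proof. by move=> oU Ux h; apply: filterS h _; apply: open_nbhs_nbhs. Qed.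

Lemma dupto_ext l m (F F' : 'rV[K]_m -> K) U : open U ->
  (forall x, U x -> F' x = F x) ->
  differentiable_upto l F U -> differentiable_upto l F' U.
Proof.
move=> oU; elim: l F F' => [|l IH] F F' hF [h1 h2].
  split=> // x Ux; apply: (differentiable_near_eq _ (h1 x Ux)).
  exact: open_near hF.
split=> [x Ux|i].
  apply: (differentiable_near_eq _ (h1 x Ux)); exact: open_near hF.
apply: (IH (fun x => partial F x i)); last exact: h2.
by move=> x Ux; apply: near_eq_derive; apply: open_near hF.
Qed.

Lemma dupto_cst l m (c : K) (U : set 'rV[K]_m) : differentiable_upto l (fun=> c) U.
Proof.
elim: l c => [|l IH] c; split=> //; try by move=> x _; apply: differentiable_cst.
move=> i; rewrite (_ : (fun x => _) = (fun=> 0)); first exact: IH.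
by apply: funext => x; rewrite /partial derive_cst.
Qed.

Lemma partial_coord m j i (x : 'rV[K]_m) :
  partial (fun y : 'rV[K]_m => y 0 j) x i = (j == i)%:R.
Proof.
by rewrite partialE ?diff_coord ?mxE ?eqxx //; apply: differentiable_coord.
Qed.

Lemma dupto_coord l m j (U : set 'rV[K]_m) :
  differentiable_upto l (fun y : 'rV[K]_m => y 0 j) U.
Proof.
case: l => [|l]; split=> //; try by move=> x _; apply: differentiable_coord.
move=> i; rewrite (_ : (fun x => _) = (fun=> (j == i)%:R)); first exact: dupto_cst.
by apply: funext => x; rewrite partial_coord.
Qed.

Lemma partialD m (F F' : 'rV[K]_m -> K) x i :
  differentiable F x -> differentiable F' x ->
  partial (fun y => F y + F' y) x i = partial F x i + partial F' x i.
Proof. by move=> h h'; rewrite /partial (@deriveD _ _ _ F F') //; apply: diff_derivable. Qed.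

Lemma partialM m (F F' : 'rV[K]_m -> K) x i :
  differentiable F x -> differentiable F' x ->
  partial (fun y => F y * F' y) x i = partial F x i * F' x + F x * partial F' x i.
Proof.
move=> h h'; rewrite /partial (@deriveM _ _ F F'); try exact: diff_derivable.
by rewrite addrC; congr (_ + _); rewrite /GRing.scale /= mulrC.
Qed.

Lemma dupto_add l m (F F' : 'rV[K]_m -> K) U : open U ->
  differentiable_upto l F U -> differentiable_upto l F' U ->
  differentiable_upto l (fun y => F y + F' y) U.
Proof.
move=> oU; elim: l F F' => [|l IH] F F' h h'; split=> //.
- by move=> x Ux; apply: differentiableD; [exact: dupto_differentiable h Ux|exact: dupto_differentiable h' Ux].
- by move=> x Ux; apply: differentiableD; [exact: dupto_differentiable h Ux|exact: dupto_differentiable h' Ux].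
move=> i; apply: (dupto_ext oU _ (IH _ _ (h.2 i) (h'.2 i))) => x Ux.
by apply: partialD; [exact: dupto_differentiable h Ux|exact: dupto_differentiable h' Ux].
Qed.

Lemma dupto_mul l m (F F' : 'rV[K]_m -> K) U : open U ->
  differentiable_upto l F U -> differentiable_upto l F' U ->
  differentiable_upto l (fun y => F y * F' y) U.
Proof.
move=> oU; elim: l F F' => [|l IH] F F' h h'; split=> //.
- by move=> x Ux; apply: differentiableM; [exact: dupto_differentiable h Ux|exact: dupto_differentiable h' Ux].
- by move=> x Ux; apply: differentiableM; [exact: dupto_differentiable h Ux|exact: dupto_differentiable h' Ux].
move=> i; apply: (dupto_ext oU _ (dupto_add oU (IH _ _ (h.2 i) (dupto_le h'))
  (IH _ _ (dupto_le h) (h'.2 i)))) => x Ux.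
by apply: partialM; [exact: dupto_differentiable h Ux|exact: dupto_differentiable h' Ux].
Qed.

Lemma partialV m (F : 'rV[K]_m -> K) x i : differentiable F x -> F x != 0 ->
  partial (fun y => (F y)^-1) x i = -1 * (partial F x i * ((F x)^-1 * (F x)^-1)).
Proof.
move=> h F0; rewrite /partial deriveV //; last exact: diff_derivable.
by rewrite /GRing.scale /= mulN1r mulNr mulrC -expr2 exprVn.
Qed.

Lemma dupto_inv l m (F : 'rV[K]_m -> K) U : open U -> (forall x, U x -> F x != 0) ->
  differentiable_upto l F U -> differentiable_upto l (fun y => (F y)^-1) U.
Proof.
move=> oU F0; elim: l => [|l IH] h; split=> //.
- by move=> x Ux; apply: differentiableV; [exact: dupto_differentiable h Ux|exact: F0].
- by move=> x Ux; apply: differentiableV; [exact: dupto_differentiable h Ux|exact: F0].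
have hV := IH (dupto_le h).
move=> i; apply: (dupto_ext oU _ (dupto_mul oU (dupto_cst l (-1) U)
  (dupto_mul oU (h.2 i) (dupto_mul oU hV hV)))) => x Ux.
by apply: partialV; [exact: dupto_differentiable h Ux|exact: F0].
Qed.

Lemma dupto_sum l m (I : Type) (s : seq I) (F : I -> 'rV[K]_m -> K) U : open U ->
  (forall i, differentiable_upto l (F i) U) ->
  differentiable_upto l (fun y => \sum_(i <- s) F i y) U.
Proof.
move=> oU h; elim: s => [|a s IH].
  by apply: (dupto_ext oU _ (dupto_cst l 0 U)) => x _; rewrite big_nil.
by apply: (dupto_ext oU _ (dupto_add oU (h a) IH)) => x _; rewrite big_cons.
Qed.

Lemma partial_comp m n (g : 'I_n -> 'rV[K]_m -> K) F x i :
  (forall j, differentiable (g j) x) -> differentiable F (tmap g x) ->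
  partial (fun y => F (tmap g y)) x i = \sum_j partial F (tmap g x) j * partial (g j) x i.
Proof.
move=> hg hF; have ht := differentiable_tuple_map hg.
rewrite partialE; last exact: (differentiable_comp ht hF).
have -> : 'd (fun y => F (tmap g y)) x = 'd F (tmap g x) \o 'd (tmap g) x :> (_ -> _).
  exact: (diff_comp ht hF).
rewrite /= diff_tuple_map // (row_sum_delta (\row_j _)) linear_sum.
by apply: eq_bigr => j _; rewrite linearZ /= mxE !partialE // mulrC.
Qed.

Lemma dupto_comp l m n (g : 'I_n -> 'rV[K]_m -> K) F U V : open U ->
  (forall j, differentiable_upto l (g j) U) -> differentiable_upto l F V ->
  (forall x, U x -> V (tmap g x)) ->
  differentiable_upto l (fun y => F (tmap g y)) U.
Proof.
move=> oU; elim: l F => [|l IH] F hg hF UV; split=> //.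
- move=> x Ux; apply: (differentiable_comp (differentiable_tuple_map _)).
    by move=> j; apply: dupto_differentiable (hg j) Ux.
  by apply: dupto_differentiable hF (UV _ Ux).
- move=> x Ux; apply: (differentiable_comp (differentiable_tuple_map _)).
    by move=> j; apply: dupto_differentiable (hg j) Ux.
  by apply: dupto_differentiable hF (UV _ Ux).
move=> i; apply: (dupto_ext oU _ (dupto_sum (index_enum _) oU
  (F := fun j x => partial F (tmap g x) j * partial (g j) x i) _)).
  move=> x Ux; apply: partial_comp.
    by move=> j; apply: dupto_differentiable (hg j) Ux.
  by apply: dupto_differentiable hF (UV _ Ux).
move=> j; apply: dupto_mul => //; last by have [_] := hg j; apply.
apply: (IH (fun z => partial F z j)) => //; last exact: hF.2.
by move=> j'; apply: dupto_le.
Qed.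

End Differentiability.

(** * Symmetry of second partial derivatives *)

Section Schwarz.
(* R embeds in K = R or C by [iota], and [rho] is a real linear functional on
   K: composed with [rho], a function on K^m becomes real on the real planes
   x + iota s a + iota t b, where the mean value theorem applies. *)
Variables (R : realType) (K : numFieldType) (iota : R -> K).

Record real_line : Prop := RealLine {
  iotaD : forall s t, iota (s + t) = iota s + iota t ;
  iotaV : forall s, iota s^-1 = (iota s)^-1 ;
  iota_eq0 : forall s, iota s = 0 -> s = 0 ;
  iota_cvg : iota s @[s --> (0 : R)] --> (0 : K)
}.

Record real_part (rho : K -> R) : Prop := RealPart {
  rhoB : forall x y, rho (x - y) = rho x - rho y ;
  rhoZ : forall s x, rho (iota s * x) = s * rho x ;
  rho_cts : continuous rho
}.

Hypothesis HI : real_line.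

Lemma iota_dnbhs : iota s @[s --> (0 : R)^'] --> (0 : K)^'.
Proof.
move=> A hA.
have h : \forall s \near (0 : R), iota s != 0 -> A (iota s) := iota_cvg HI hA.
apply: filterS h => s h s0; apply: h.
by apply: contra_neq s0 => /(iota_eq0 HI).
Qed.

Variable (rho : K -> R).
Hypothesis HR : real_part rho.

(** The limit over increments in K is restricted to the real ones through [iota_dnbhs], and rho
    passes inside the difference quotient because it is real linear and continuous. *)
Lemma line_derive m (H : 'rV[K]_m -> K) (z v : 'rV[K]_m) (s : R) :
  differentiable H (z + iota s *: v) ->
  is_derive s 1 (fun s' => rho (H (z + iota s' *: v))) (rho ('D_v H (z + iota s *: v))).
Proof.
move=> dH; have dd : derivable H (z + iota s *: v) v by exact: diff_derivable.
set w := z + iota s *: v in dH dd *.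
have h : h^-1 *: ((fun s' => rho (H (z + iota s' *: v))) (h *: 1 + s) - rho (H w)) @[h --> (0 : R)^']
    --> rho ('D_v H w).
  have c1 : k^-1 *: (H (k *: v + w) - H w) @[k --> (0 : K)^'] --> 'D_v H w by exact: dd.
  have c3 : rho y @[y --> 'D_v H w] --> rho ('D_v H w) by exact: (rho_cts HR).
  have c2 := cvg_comp _ _ (cvg_comp _ _ iota_dnbhs c1) c3.
  apply: cvg_trans c2; apply: near_eq_cvg; near=> h => /=.
  change (rho ((iota h)^-1 * (H (iota h *: v + w) - H w)) =
    h^-1 * (rho (H (z + iota (h * 1 + s) *: v)) - rho (H w))).
  rewrite -(iotaV HI) (rhoZ HR) (rhoB HR) mulr1.
  by rewrite (iotaD HI) scalerDl /w addrCA.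
by apply: DeriveDef; [apply/cvg_ex; exists (rho ('D_v H w)) | apply: cvg_lim].
Unshelve. all: by end_near. Qed.

Lemma near_plane m (x a b : 'rV[K]_m) (P : set 'rV[K]_m) : nbhs x P ->
  exists2 e : R, 0 < e & forall s t, `|s| < e -> `|t| < e ->
    P (x + iota s *: a + iota t *: b).
Proof.
move=> hP.
have c1 : iota st.1 @[st --> ((0 : R), (0 : R))] --> (0 : K).
  by apply: (cvg_comp _ _ _ (iota_cvg HI)); exact: cvg_fst.
have c2 : iota st.2 @[st --> ((0 : R), (0 : R))] --> (0 : K).
  by apply: (cvg_comp _ _ _ (iota_cvg HI)); exact: cvg_snd.
have c : x + iota st.1 *: a + iota st.2 *: b @[st --> ((0 : R), (0 : R))] --> x.
  have : x + iota st.1 *: a + iota st.2 *: b @[st --> ((0 : R), (0 : R))] -->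
      x + 0 *: a + 0 *: b.
    by apply: cvgD; [apply: cvgD; [exact: cvg_cst | exact: cvgZr_tmp] | exact: cvgZr_tmp].
  by rewrite !scale0r !addr0.
have /nbhs_ballP[e /= e0 he] := c _ hP.
exists e => // s t hs ht; apply: (he (s, t)).
by split; rewrite /= /ball /= sub0r normrN.
Qed.

(** The mean value theorem is applied to the second difference over a square of side h, first in the
    direction a and then in the direction b. *)
Lemma box_mvt m (F : 'rV[K]_m -> K) (x a b : 'rV[K]_m) (U : set 'rV[K]_m) (e h : R) :
  (forall y, U y -> differentiable F y) ->
  (forall y, U y -> differentiable (fun z => 'D_a F z) y) ->
  (forall s t, `|s| < e -> `|t| < e -> U (x + iota s *: a + iota t *: b)) ->
  0 < h -> h < e ->
  exists c d, [/\ `|c| < e, `|d| < e, `|c| <= h, `|d| <= h &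
    rho (F (x + iota h *: a + iota h *: b)) - rho (F (x + iota 0 *: a + iota h *: b))
    - (rho (F (x + iota h *: a + iota 0 *: b)) - rho (F (x + iota 0 *: a + iota 0 *: b)))
    = h ^+ 2 * rho ('D_b (fun z => 'D_a F z) (x + iota c *: a + iota d *: b))].
Proof.
move=> dF dF' hU h0 he.
pose u (s : R) := rho (F (x + iota h *: b + iota s *: a)) - rho (F (x + iota 0 *: b + iota s *: a)).
pose u' (s : R) := rho ('D_a F (x + iota h *: b + iota s *: a)) - rho ('D_a F (x + iota 0 *: b + iota s *: a)).
have e0 : 0 < e by apply: lt_trans he.
have U1 s t : `|s| < e -> `|t| < e -> U (x + iota t *: b + iota s *: a).
  by move=> hs ht; rewrite addrAC; apply: hU.
have hh : `|h| < e by rewrite gtr0_norm.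
have h00 : `|0 : R| < e by rewrite normr0.
have du (s : R) : `|s| < e -> is_derive s 1 u (u' s).
  move=> hs; apply: is_deriveB.
    by apply: line_derive => //; apply: dF; apply: U1.
  by apply: line_derive => //; apply: dF; apply: U1.
have inh (s : R) : s \in `[0, h]%R -> `|s| <= h /\ `|s| < e.
  rewrite in_itv /= => /andP[s0 sh]; rewrite ger0_norm //; split=> //.
  exact: le_lt_trans he.
have inho (s : R) : s \in `]0, h[%R -> `|s| <= h /\ `|s| < e.
  by move=> /subset_itv_oo_cc; apply: inh.
have [c /inho[ch ce] hc] : exists2 c, c \in `]0, h[%R & u h - u 0 = u' c * (h - 0).
  apply: MVT => // [s /inho[_ hs]|]; first exact: du.
  apply: derivable_within_continuous => s /inh[_ hs].
  by have [] := du s hs.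
pose w (t : R) := rho ('D_a F (x + iota c *: a + iota t *: b)).
pose w' (t : R) := rho ('D_b (fun z => 'D_a F z) (x + iota c *: a + iota t *: b)).
have dw (t : R) : `|t| < e -> is_derive t 1 w (w' t).
  by move=> ht; apply: line_derive => //; apply: dF'; apply: hU.
have [d /inho[dh de] hd] : exists2 d, d \in `]0, h[%R & w h - w 0 = w' d * (h - 0).
  apply: MVT => // [s /inho[_ hs]|]; first exact: dw.
  apply: derivable_within_continuous => s /inh[_ hs].
  by have [] := dw s hs.
exists c, d; split=> //.
have E s t : x + iota s *: a + iota t *: b = x + iota t *: b + iota s *: a by rewrite addrAC.
have abr (p q r s : R) : p - q - (r - s) = (p - r) - (q - s) by ring.
rewrite abr !E -/(u h) -[rho _ - rho _]/(u 0) hc subr0.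
have -> : u' c = w h - w 0 by rewrite /u' /w !E.
have {}hd : w h - w 0 = w' d * h by rewrite hd subr0.
rewrite hd -[x + iota d *: b + iota c *: a]E -/(w' d).
by move: (w' d) => z; rewrite expr2 [RHS]mulrC mulrA.
Qed.

(** The second difference over a square is symmetric in a and b, so [box_mvt] makes the two mixed
    derivatives agree at two points as close to x as desired. Their continuity at x does the
    rest. *)
Lemma schwarz_part m (F : 'rV[K]_m -> K) (x a b : 'rV[K]_m) (U : set 'rV[K]_m) :
  nbhs x U ->
  (forall y, U y -> differentiable F y) ->
  (forall y, U y -> differentiable (fun z => 'D_a F z) y) ->
  (forall y, U y -> differentiable (fun z => 'D_b F z) y) ->
  {for x, continuous (fun y => 'D_b (fun z => 'D_a F z) y)} ->
  {for x, continuous (fun y => 'D_a (fun z => 'D_b F z) y)} ->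
  rho ('D_b (fun z => 'D_a F z) x) = rho ('D_a (fun z => 'D_b F z) x).
Proof.
move=> hU dF da db cab cba.
set A := fun y => 'D_b (fun z => 'D_a F z) y in cab *.
set B := fun y => 'D_a (fun z => 'D_b F z) y in cba *.
apply/eqP; rewrite -subr_eq0 -normr_le0; apply/ler_addgt0Pr => e e0; rewrite add0r.
have e2 : 0 < e / 2 by rewrite divr_gt0.
have ra : \forall y \near x, `|rho (A x) - rho (A y)| < e / 2.
  have : rho (A y) @[y --> x] --> rho (A x).
    by apply: (cvg_comp _ _ cab); exact: (rho_cts HR).
  by move/cvgrPdist_lt; apply.
have rb : \forall y \near x, `|rho (B x) - rho (B y)| < e / 2.
  have : rho (B y) @[y --> x] --> rho (B x).
    by apply: (cvg_comp _ _ cba); exact: (rho_cts HR).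
  by move/cvgrPdist_lt; apply.
have [e1 e10 h1] := near_plane a b (filterI hU (filterI ra rb)).
have [e1' e10' h2] := near_plane b a (filterI hU (filterI ra rb)).
pose e3 := Order.min e1 e1'; pose h := e3 / 2.
have e30 : 0 < e3 by rewrite lt_min e10.
have h0 : 0 < h by rewrite divr_gt0.
have he : h < e3 by rewrite /h ltr_pdivrMr // ltr_pMr // ltr1n.
have i1 (s : R) : `|s| < e3 -> `|s| < e1 by rewrite lt_min => /andP[].
have i2 (s : R) : `|s| < e3 -> `|s| < e1' by rewrite lt_min => /andP[].
have U1 s t : `|s| < e3 -> `|t| < e3 -> U (x + iota s *: a + iota t *: b).
  by move=> hs ht; case: (h1 s t (i1 _ hs) (i1 _ ht)).
have U2 s t : `|s| < e3 -> `|t| < e3 -> U (x + iota s *: b + iota t *: a).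
  by move=> hs ht; case: (h2 s t (i2 _ hs) (i2 _ ht)).
have [c [d [hc hd _ _ E1]]] := box_mvt dF da U1 h0 he.
have [c' [d' [hc' hd' _ _ E2]]] := box_mvt dF db U2 h0 he.
have [_ [k1 _]] := h1 c d (i1 _ hc) (i1 _ hd).
have [_ [_ k2]] := h2 c' d' (i2 _ hc') (i2 _ hd').
have EE : rho (A (x + iota c *: a + iota d *: b)) = rho (B (x + iota c' *: b + iota d' *: a)).
  apply: (mulfI (x := h ^+ 2)); first by rewrite expf_neq0 // gt_eqF.
  refine (etrans (esym E1) (etrans _ E2)).
  have E s t : x + iota s *: a + iota t *: b = x + iota t *: b + iota s *: a by rewrite addrAC.
  have abr (p q r s : R) : p - q - (r - s) = (p - r) - (q - s) by ring.
  by rewrite abr !E.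
have aux (u v w : R) : `|u - w| < e / 2 -> `|v - w| < e / 2 -> `|u - v| <= e.
  move=> h3 h4; have h5 := ltrD h3 h4; rewrite -splitr in h5.
  by apply/ltW/(le_lt_trans _ h5); rewrite (distrC v w); apply: ler_distD.
exact: aux k1 (eq_ind_r (fun z => `|rho (B x) - z| < e / 2) k2 EE).
Qed.

End Schwarz.

(** * The smooth and the holomorphic geometry *)

Section SmoothLaws.
Variable K : numFieldType.
Local Notation G := (smooth_geometry K).
Local Notation tmap g := (tuple_map (G := G) g).

Lemma smooth_nbhs m (F : 'rV[K]_m -> K) x N : nbhs x N ->
  (forall l, differentiable_upto l F N°) -> smooth_at F x.
Proof.
move=> hN h; exists N°; split=> //; exact: open_interior.
Qed.

Lemma smooth_differentiable m (F : 'rV[K]_m -> K) x : smooth_at F x -> differentiable F x.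
Proof. by move=> [U [_ Ux h]]; apply: dupto_differentiable (h 0%N) Ux. Qed.

Lemma smooth_near m (F : 'rV[K]_m -> K) x : smooth_at F x -> \forall y \near x, smooth_at F y.
Proof. by move=> [U [oU Ux h]]; apply: (open_near oU Ux) => y Uy; exists U. Qed.

Lemma smooth_tmap_cts m n (g : 'I_n -> 'rV[K]_m -> K) x :
  (forall i, smooth_at (g i) x) -> {for x, continuous (tmap g)}.
Proof.
move=> hg; apply: differentiable_continuous; apply: differentiable_tuple_map => i.
exact: smooth_differentiable.
Qed.

Lemma smooth_eq m (F F' : 'rV[K]_m -> K) x :
  smooth_at F x -> (\forall y \near x, F' y = F y) -> smooth_at F' x.
Proof.
move=> [U [oU Ux h]] hF.
have hN : nbhs x (U `&` [set y | F' y = F y]).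
  by apply: filterI => //; apply: open_nbhs_nbhs.
apply: (smooth_nbhs hN) => l.
apply: (dupto_ext _ _ (dupto_sub _ (h l))); first exact: open_interior.
  by move=> y /interior_subset[].
by move=> y /interior_subset[].
Qed.

Lemma smooth_coord m (x : 'rV[K]_m) i : smooth_at (fun y => y 0 i) x.
Proof. by exists setT; split=> //; [exact: openT | move=> l; apply: dupto_coord]. Qed.

Lemma smooth_cst m (c : K) (x : 'rV[K]_m) : smooth_at (fun=> c) x.
Proof. by exists setT; split=> //; [exact: openT | move=> l; apply: dupto_cst]. Qed.

Lemma smooth_add m (F F' : 'rV[K]_m -> K) x :
  smooth_at F x -> smooth_at F' x -> smooth_at (fun y => F y + F' y) x.
Proof.
move=> [U [oU Ux h]] [V [oV Vx h']]; exists (U `&` V); split=> //; first exact: openI.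
move=> l; apply: dupto_add; first exact: openI.
- exact: dupto_sub (h l).
- exact: dupto_sub (h' l).
Qed.

Lemma smooth_mul m (F F' : 'rV[K]_m -> K) x :
  smooth_at F x -> smooth_at F' x -> smooth_at (fun y => F y * F' y) x.
Proof.
move=> [U [oU Ux h]] [V [oV Vx h']]; exists (U `&` V); split=> //; first exact: openI.
move=> l; apply: dupto_mul; first exact: openI.
- exact: dupto_sub (h l).
- exact: dupto_sub (h' l).
Qed.

Lemma near_neq0 m (F : 'rV[K]_m -> K) x : {for x, continuous F} -> F x != 0 ->
  \forall y \near x, F y != 0.
Proof.
move=> cF F0; have : \forall z \near F x, z != 0.
  exists `|F x|; first by rewrite /= normr_gt0.
  move=> z /=; apply: contraTneq => ->; by rewrite subr0 ltxx.
exact: cF.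
Qed.

Lemma smooth_inv m (F : 'rV[K]_m -> K) x :
  smooth_at F x -> F x != 0 -> smooth_at (fun y => (F y)^-1) x.
Proof.
move=> hF F0; have [U [oU Ux h]] := hF.
have hN : nbhs x (U `&` [set y | F y != 0]).
  apply: filterI; first exact: open_nbhs_nbhs.
  apply: near_neq0 => //; apply: differentiable_continuous; exact: smooth_differentiable.
apply: (smooth_nbhs hN) => l.
apply: dupto_inv; first exact: open_interior.
  by move=> y /interior_subset[].
by apply: dupto_sub (h l) => y /interior_subset[].
Qed.

Lemma smooth_comp m n (g : 'I_n -> 'rV[K]_m -> K) F x :
  (forall i, smooth_at (g i) x) -> smooth_at F (tmap g x) ->
  smooth_at (fun y => F (tmap g y)) x.
Proof.
move=> hg [V [oV Vx hV]].
have cg := smooth_tmap_cts hg.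
have /choice[U hU] := hg.
have hN : nbhs x ([set y | forall i, U i y] `&` [set y | V (tmap g y)]).
  apply: filterI; last by apply: cg; apply: open_nbhs_nbhs.
  suff : forall s : seq 'I_n, nbhs x [set y | forall i, i \in s -> U i y].
    move/(_ (enum 'I_n)); apply: filterS => y hy i; apply: hy; exact: mem_enum.
  elim=> [|a s IH]; first by apply: filterS filterT.
  have [oU Ux _] := hU a.
  apply: filterS (filterI (open_nbhs_nbhs (conj oU Ux)) IH) => y [h1 h2] i.
  by rewrite inE => /orP[/eqP->|/h2].
apply: (smooth_nbhs hN) => l.
apply: (dupto_comp (V := V)) => //; first exact: open_interior.
- by move=> j; have [_ _ h] := hU j; apply: dupto_sub (h l) => y /interior_subset[].
- by move=> y /interior_subset[].
Qed.

Lemma smooth_partial m (F : 'rV[K]_m -> K) x i :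
  smooth_at F x -> smooth_at (fun y => partial F y i) x.
Proof.
move=> [U [oU Ux h]]; exists U; split=> // l; exact: (h l.+1).2.
Qed.

Hypothesis partial_sym : forall m (F : 'rV[K]_m -> K) x i j, smooth_at F x ->
  partial (fun y => partial F y i) x j = partial (fun y => partial F y j) x i.

Lemma smooth_geometry_laws : geometry_laws G.
Proof.
split.
- by move=> n; rewrite pnatr_eq0.
- by move=> m x; apply: filterT.
- by move=> m x A B; apply: filterI.
- by move=> m x A B AB; apply: filterS.
- by move=> m x A; apply: nbhs_singleton.
- by move=> m x A; apply: nbhs_interior.
- move=> m x i x0; apply: (@near_neq0 _ (fun y : 'rV[K]_m => y 0 i)) => //.
  exact: coord_continuous.
- by move=> m F x; apply: smooth_near.
- by move=> m F F' x; apply: smooth_eq.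
- by move=> m n g x O hg hO; apply: (smooth_tmap_cts hg).
- by move=> m n g F x; apply: smooth_comp.
- exact: smooth_cst.
- exact: smooth_coord.
- exact: smooth_add.
- exact: smooth_mul.
- exact: smooth_inv.
- exact: smooth_partial.
- by move=> m c x i; rewrite /= /partial derive_cst.
- by move=> m x j i; rewrite [LHS]partial_coord.
- by move=> m F F' x i h h'; apply: partialD; apply: smooth_differentiable.
- by move=> m F F' x i h h'; apply: partialM; apply: smooth_differentiable.
- by move=> m F F' x i h h'; apply: near_eq_derive.
- move=> m n g F x i hg hF.
  exact: (partial_comp i (fun j => smooth_differentiable (hg j)) (smooth_differentiable hF)).
- exact: partial_sym.
Qed.

End SmoothLaws.

Lemma smooth_partial_sym (R : realType) (K : numFieldType) (iota : R -> K) :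
  real_line iota ->
  (forall z, (forall rho, real_part iota rho -> rho z = 0) -> z = 0) ->
  forall m (F : 'rV[K]_m -> K) x i j, smooth_at F x ->
  partial (fun y => partial F y i) x j = partial (fun y => partial F y j) x i.
Proof.
move=> HI sep m F x i j hF; apply/eqP; rewrite -subr_eq0; apply/eqP.
apply: sep => rho hr; rewrite (rhoB hr); apply/eqP; rewrite subr_eq0; apply/eqP.
have [U [oU Ux h]] := hF.
have dp i' : smooth_at (fun y => partial F y i') x by apply: smooth_partial.
have c2 i' j' : {for x, continuous (fun y => partial (fun z => partial F z i') y j')}.
  by apply: differentiable_continuous; apply: smooth_differentiable; apply: smooth_partial.
apply: (schwarz_part HI hr (U := U)) => //.
- exact: open_nbhs_nbhs.
- by move=> y Uy; apply: dupto_differentiable (h 0%N) Uy.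
- by move=> y Uy; exact: (@dupto_differentiable K 0 m (fun x => partial F x i) U y ((h 1%N).2 i) Uy).
- by move=> y Uy; exact: (@dupto_differentiable K 0 m (fun x => partial F x j) U y ((h 1%N).2 j) Uy).
- exact: c2.
- exact: c2.
Qed.

Lemma real_geometry_laws (R : realType) : geometry_laws (smooth_geometry R).
Proof.
apply: smooth_geometry_laws.
apply: (@smooth_partial_sym R R id) => [|z h].
  by split=> //; exact: cvg_id.
by apply: (h id); split=> // x; exact: cvg_id.
Qed.

Lemma complex_geometry_laws (R : realType) : geometry_laws (smooth_geometry (complex R)).
Proof.
apply: smooth_geometry_laws.
apply: (@smooth_partial_sym R (complex R) (real_complex R)) => [|z h].
  split.
  - exact: raddfD.
  - exact: fmorphV.
  - by move=> s [].
  (* A positive complex number is real, so its real part can serve as the radius. *)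
  apply/cvgrPdist_lt => e; rewrite ltcE => /andP[/eqP /= e1 e2].
  exists (complex.Re e) => // s /=; rewrite !sub0r !normrN.
  rewrite normc_def /= expr0n /= addr0 sqrtr_sqr ltcE /= e1 eqxx /= => h; exact: h.
have hb (rho : complex R -> R) : (forall x y, rho (x - y) = rho x - rho y) ->
    (forall s x, rho ((real_complex R s) * x) = s * rho x) ->
    (forall x, `|rho x| ^+ 2 <= complex.Re x ^+ 2 + complex.Im x ^+ 2) ->
    real_part (real_complex R) rho.
  move=> hB hZ hrho; split=> // x A /nbhs_normP[e /= e0 hA].
  apply/nbhs_normP; exists (e%:C)%C; first by rewrite /= ltcR.
  move=> y /= hy; apply: hA => /=; rewrite -ltcR; apply: le_lt_trans hy.
  rewrite -hB normc_def lecR -[leLHS]ger0_norm // -sqrtr_sqr.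
  exact: ler_wsqrtr.
have cRe : real_part (real_complex R) (@complex.Re R).
  apply: hb => [[a b] [c d] //|s [a b] /=|x]; first by rewrite mul0r subr0.
  by rewrite real_normK ?num_real // lerDl sqr_ge0.
have cIm : real_part (real_complex R) (@complex.Im R).
  apply: hb => [[a b] [c d] //|s [a b] /=|x]; first by rewrite mul0r addr0.
  by rewrite real_normK ?num_real // lerDr sqr_ge0.
by have := h _ cRe; have := h _ cIm; case: (z) => a b /= -> ->.
Qed.

(** * Curves in the smooth and holomorphic categories *)

Section SmoothCurves.
Variable K : numFieldType.
Local Notation G := (smooth_geometry K).
Hypothesis HG : geometry_laws G.

(** The model is the open part of the line that (P, Q) maps into the chart. A function vanishing on
    an open set has zero derivatives there, so [cm_xi_tan] is immediate. *)
Lemma smooth_curve_model (W : set 'rV[K]_2) (a : 'rV[K]_2) (P Q : {poly K}) :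
  open W -> W a -> P.[0] = a 0 0 -> Q.[0] = a 0 1 ->
  exists m (W' : set 'rV[K]_m) xi tau Gam o,
    curve_model (G := G) W setT (fun z => z 0 0) (fun z => z 0 1) P Q a W' xi tau Gam o.
Proof.
move=> oW Wa P0 Q0.
pose Gam (i : 'I_2) (z : 'rV[K]_1) := (if i == 0 then P else Q).[z 0 0].
have hG i s : smooth_at (Gam i) s.
  have hp (T : {poly K}) : smooth_at (fun z : 'rV[K]_1 => T.[z 0 0]) s.
    elim/poly_ind: T => [|T c IH].
      apply: (greg_eq HG (greg_cst HG 0 s)).
      by apply: (gnbS HG) (gnbT HG s) => y _ /=; rewrite horner0.
    apply: (greg_eq HG (greg_add HG (greg_mul HG IH (greg_coord HG s 0)) (greg_cst HG c s))).
    by apply: (gnbS HG) (gnbT HG s) => y _ /=; rewrite hornerMXaddC.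
  exact: hp.
have oW' : open [set z : 'rV[K]_1 | W (tuple_map (G := G) Gam z)].
  rewrite openE => z /= Wz; apply: (smooth_tmap_cts (fun i => hG i z)).
  exact: open_nbhs_nbhs.
exists 1%N, [set z : 'rV[K]_1 | W (tuple_map (G := G) Gam z)], (fun=> const_mx 1),
  (fun z => z 0 0), Gam, 0.
have Go : tuple_map (G := G) Gam 0 = a.
  by apply/rowP => i; rewrite !mxE /Gam mxE; case: i => -[|[|//]] h /=;
    rewrite ?P0 ?Q0; congr (a _ _); apply: val_inj.
split=> //.
- move=> s Ws i; apply: (greg_eq HG (greg_cst HG 1 s)).
  by apply: (gnbS HG) (gnbT HG s) => y _ /=; rewrite mxE.
- move=> s Ws F hF hn; apply: big1 => i _.
  rewrite (_ : gpd F s i = 0) ?mul0r //= -(gpd_cst HG 0 s i).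
  apply: (gpd_eq HG); first exact: (greg_cst HG).
  by apply: filterS2 hn (open_nbhs_nbhs (conj oW' Ws)) => y /= h1 h2; apply: h1.
- by move=> s _; apply: smooth_coord.
- by move=> s _; rewrite big_ord1 (gpd_coord HG) eqxx mxE mulr1.
- move=> s v tv i; rewrite mxE mul1r; congr v; apply: funext => y.
  by congr (sval y _ _); apply: val_inj; case: i => -[].
- by move=> s Ws i; apply: hG.
- by move=> s Ws; rewrite !mxE.
- by rewrite /= Go.
- by rewrite mxE.
- by move=> s Ws s0; apply/rowP => i; rewrite mxE -s0; congr (s _ _); apply: val_inj; case: i => -[].
Qed.

Lemma smooth_curves (S : gspace G) (HS : is_manifold 2 S) (p : S) :
  exists (U : set S) (x y : S -> gK G),
  [/\ U p, coframe (@tangent G S : distribution S) x y U & base_curves p U x y].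
Proof.
have HL := manifold_laws HG HS.
have [U [m [e [W [Up ch]]]]] := HS p.
have [[m2 oW] hU [_ eW] hn hr] := ch.
subst m.
exists (U `&` (e @^-1` setT)), (fun q => e q 0 0), (fun q => e q 0 1); split=> //.
- have hc i q : U q -> reg (fun q' => e q' 0 i) q.
    move=> Uq; apply/(hr _ Uq); exists (fun z => z 0 i); split.
      exact: (greg_coord HG).
    exact: (nb_refl HL).
  have E q : tuple_map (G := G) (fun i q' => e q' 0 i) q = e q.
    by apply/rowP => i; rewrite mxE.
  split=> [q [Uq _]|q [Uq _]].
    by apply: (nbS HL) (hU _ Uq) => y Uy.
  split; [exact: hc | exact: hc | move=> f /(hr _ Uq)[F [hF hf]]].
  have hp i : reg (fun q' => gpd F (e q') i) q.
    apply/(hr _ Uq); exists (fun z => gpd F z i); split; first exact: (gpd_reg HG).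
    exact: (nb_refl HL).
  exists (fun q' => gpd F (e q') 0), (fun q' => gpd F (e q') 1); split=> //.
  have h1 : nb q [set y | greg F (e y)].
    have := reg_cts HL (g := fun i q' => e q' 0 i) (fun i => hc i _ Uq)
      (O := [set z | greg F z]).
    rewrite E => /(_ (greg_near HG hF)).
    by apply: (nbS HL) => y /=; rewrite E.
  apply: (nbS HL) (nbI HL (nbI HL h1 (hU _ Uq)) (nb_open HL hf)) => y [[k1 Uy] k2] v tv.
  rewrite (tan_comp tv (g := fun i q' => e q' 0 i) (F := F)).
  + have l1 : lift ord0 ord0 = 1 :> 'I_2 by apply: val_inj.
    by rewrite E big_ord_recl big_ord1 l1.
  + by move=> i; apply: hc.
  + by rewrite E.
  + by apply: (nbS HL) k2 => z /= ->; rewrite E.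
apply: (base_curves_model HG HL (X := fun z => z 0 0) (Y := fun z => z 0 1) ch Up) => P Q P0 Q0.
apply: smooth_curve_model => //.
by rewrite -eW; exists p.
Qed.

End SmoothCurves.

Theorem corollary22 (C : category) (S : gspace (geom C))
    (hS : is_manifold 2 S) (k : nat) (hk : (3 <= k)%N) (p : monster S k)
    (VO : nat -> nat)
    (hVO : forall j, (2 <= j <= k)%N -> vertical_order p j (VO j)) :
  (forall h, (2 <= h)%N ->
     (SG p h <= 2 + count (fun i => e_num k VO h i == 0)
                          (index_iota 2 (minn h k.+1).+1))%N) /\
  (forall i, (2 <= i <= k.+1)%N -> forall beta, is_beta p i.+1 beta ->
     (b_num k VO i <= beta)%N).
Proof.
case: C S hS p hVO => [R|R|K hK] S hS p hVO.
- have HG := real_geometry_laws R.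
  exact: (growth_bounds HG (manifold_laws HG hS) (smooth_curves HG hS)).
- have HG := complex_geometry_laws R.
  exact: (growth_bounds HG (manifold_laws HG hS) (smooth_curves HG hS)).
have char0 n : n.+1%:R != 0 :> K by have /pcharf0P -> := hK.
have HG := AlgebraicLaws.algebraic_geometry_laws char0.
exact: (growth_bounds HG (manifold_laws HG hS) (AlgebraicCurves.algebraic_curves char0 hS)).
Qed.
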